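(* Assume the Smooth Manifold Assumption holds, that the feasible set $\mathcal{C}$ is compact, and let $R,K$ be finite constants satisfying $\operatorname{Tr}(X)\le R$ for all $X\in\mathcal{C}$ and $\|\mathcal{A}^*\circ G(Y)^{\dagger}\circ\mathcal{A}\|_{\mathrm{op}}\le K$ for all $Y\in\mathcal{M}_k$. Let $W$ be a Gaussian Wigner matrix with variance $\sigma_W^2>0$ and let $\delta\in(0,1)$. Define $$\kappa = RK\left(\|C\|_{\mathrm{op}}+3\sigma_W\sqrt{n}\right).$$ There exists a universal constant $c_0>0$ such that the following holds. If $$k \ge 3\left[\log(n)+\sqrt{\log(1/\delta)}+\sqrt{m\log\left(1+\frac{6\kappa\sqrt{c_0 n}}{\sigma_W}\right)}\right],$$ then with probability at least $1-\delta-e^{-n/2}$ over $W$, every $(\varepsilon_g,\varepsilon_H)$-SOSP $Y\in\mathbb{K}^{n\times k}$ of problem (P) with cost matrix $C+W$ (for any $\varepsilon_g,\varepsilon_H\ge 0$) satisfies $$0\le g(Y)-f^\star \le (\varepsilon_H+\varepsilon_g^2\eta)R+\frac{\varepsilon_g}{2}\sqrt{R},$$ where $g(Y)=\langle (C+W)Y,Y\rangle$, $f^\star$ is the optimal value of (SDP) with cost matrix $C+W$, and $$\eta=\frac{c_0\, n\, K(2+KR)^2\left(\|C\|_{\mathrm{op}}+3\sigma_W\sqrt{n}\right)}{9m\,\sigma_W^2\log\left(1+\frac{6\kappa\sqrt{c_0 n}}{\sigma_W}\right)}.$$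
   Context: $\mathbb{K}=\mathbb{R}$ or $\mathbb{C}$. For matrices $A,B$ of the same size, $\langle A,B\rangle=\operatorname{Re}\operatorname{Tr}(A^*B)$, with Frobenius norm $\|A\|=\sqrt{\langle A,A\rangle}$; $\|\cdot\|_{\mathrm{op}}$ denotes the spectral norm of a matrix, and for a linear map $f$ between matrix spaces $\|f\|_{\mathrm{op}}=\sup_{A\ne0}\|f(A)\|/\|A\|$ (Frobenius norms). $\mathbb{S}^{n\times n}$ is the set of self-adjoint $n\times n$ matrices over $\mathbb{K}$ (real symmetric or complex Hermitian). Given $C,A_1,\dots,A_m\in\mathbb{S}^{n\times n}$ and $b\in\mathbb{R}^m$, let $\mathcal{A}(Z)_i=\langle A_i,Z\rangle$ for $Z\in\mathbb{K}^{n\times n}$, with adjoint $\mathcal{A}^*(\mu)=\sum_i\mu_iA_i$. The problem (SDP) is $\min\{\langle C,X\rangle: X\in\mathbb{S}^{n\times n},\ \mathcal{A}(X)=b,\ X\succeq0\}$ with feasible set $\mathcal{C}$. The problem (P) is $\min\{g(Y)=\langle CY,Y\rangle : Y\in\mathcal{M}_k\}$ where $\mathcal{M}_k=\{Y\in\mathbb{K}^{n\times k}:\mathcal{A}(YY^* )=b\}$. Smooth Manifold Assumption: for every $k\le n$ with $\mathcal{M}_k\neq\emptyset$, either (1) $A_1Y,\dots,A_mY$ are linearly independent in $\mathbb{K}^{n\times k}$ for all $Y\in\mathcal{M}_k$, or (2) $A_1Y,\dots,A_mY$ span a subspace of constant dimension for all $Y$ in an open neighborhood of $\mathcal{M}_k$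 in $\mathbb{K}^{n\times k}$. For $Y\in\mathcal{M}_k$: $G(Y)\in\mathbb{R}^{m\times m}$ with $G_{ij}=\langle A_iY,A_jY\rangle$, $G^\dagger$ its Moore–Penrose pseudo-inverse; $T_Y\mathcal{M}=\{\dot Y\in\mathbb{K}^{n\times k}:\langle A_iY,\dot Y\rangle=0,\ i=1,\dots,m\}$; $\mu(Y)=G^\dagger\mathcal{A}(CYY^* )$ and $S(Y)=C-\mathcal{A}^*(\mu(Y))$ (with $C$ replaced by the cost matrix of the problem under consideration). $Y\in\mathcal{M}_k$ is an $\varepsilon_g$-FOSP of (P) if $\|2S(Y)Y\|\le\varepsilon_g$; it is an $(\varepsilon_g,\varepsilon_H)$-SOSP if additionally $\langle\dot Y,S(Y)\dot Y\rangle\ge-\varepsilon_H\|\dot Y\|^2$ for all $\dot Y\in T_Y\mathcal{M}$. A Gaussian Wigner matrix with variance $\sigma_W^2$ is a random $W=W^*\in\mathbb{S}^{n\times n}$ whose entries on and above the diagonal are independent zero-mean Gaussian variables (real or complex according to $\mathbb{K}$) with variance $\sigma_W^2$. *)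

(* Defs.v *)
From HB Require Import structures.
From mathcomp Require Import all_boot all_order all_algebra.
From mathcomp Require Import all_classical all_reals all_analysis.
From mathcomp Require Import complex.


Unset Strict Implicit.
Unset Printing Implicit Defensive.

Import Order.TTheory GRing.Theory Num.Theory.
Import numFieldNormedType.Exports.
Local Open Scope classical_set_scope.
Local Open Scope ring_scope.

(* Scalars: K = R (cplx = false) or K = C (cplx = true); matrices over K are
   represented as matrices over R[i], restricted (in the real case) to have
   zero imaginary parts. *)

Definition Kscal {R : realType} (cplx : bool) (z : R[i]) : bool :=
  cplx || (complex.Im z == 0).

Definition Kmat {R : realType} (cplx : bool) {p q : nat} (M : 'M[R[i]]_(p, q)) : Prop :=
  forall i j, Kscal cplx (M i j).

Definition cadj {R : realType} {p q : nat} (M : 'M[R[i]]_(p, q)) : 'M[R[i]]_(q, p) :=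
  (map_mx (@conjc R) M)^T.

Definition inprod {R : realType} {p q : nat} (A B : 'M[R[i]]_(p, q)) : R :=
  complex.Re (\tr (cadj A *m B)).

Definition frob {R : realType} {p q : nat} (A : 'M[R[i]]_(p, q)) : R :=
  Num.sqrt (inprod A A).

Definition selfadj {R : realType} (cplx : bool) {n : nat} (M : 'M[R[i]]_n) : Prop :=
  Kmat cplx M /\ cadj M = M.

Definition rC {R : realType} (x : R) : R[i] := complex.Complex x 0.

Definition Aop {R : realType} {n m : nat} (A : 'I_m -> 'M[R[i]]_n) (Z : 'M[R[i]]_n)
  : 'cV[R]_m := \col_i inprod (A i) Z.

Definition Aadj {R : realType} {n m : nat} (A : 'I_m -> 'M[R[i]]_n) (mu : 'cV[R]_m)
  : 'M[R[i]]_n := \sum_i rC (mu i 0) *: A i.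

Definition Mset {R : realType} (cplx : bool) {n m : nat} (A : 'I_m -> 'M[R[i]]_n)
  (b : 'cV[R]_m) (k : nat) : set 'M[R[i]]_(n, k) :=
  [set Y | Kmat cplx Y /\ Aop A (Y *m cadj Y) = b].

Definition Gram {R : realType} {n m k : nat} (A : 'I_m -> 'M[R[i]]_n)
  (Y : 'M[R[i]]_(n, k)) : 'M[R]_m :=
  \matrix_(i, j) inprod (A i *m Y) (A j *m Y).

(* Moore--Penrose pseudo-inverse (of a real square matrix): the unique matrix
   satisfying the four Penrose equations. *)
Definition is_MP {R : realType} {m : nat} (G X : 'M[R]_m) : Prop :=
  [/\ G *m X *m G = G, X *m G *m X = X, (G *m X)^T = G *m X & (X *m G)^T = X *m G].

Definition pinvMP {R : realType} {m : nat} (G : 'M[R]_m) : 'M[R]_m :=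
  xget 0 [set X | is_MP G X].

Definition mu_of {R : realType} {n m k : nat} (A : 'I_m -> 'M[R[i]]_n)
  (C : 'M[R[i]]_n) (Y : 'M[R[i]]_(n, k)) : 'cV[R]_m :=
  pinvMP (Gram A Y) *m Aop A (C *m Y *m cadj Y).

Definition S_of {R : realType} {n m k : nat} (A : 'I_m -> 'M[R[i]]_n)
  (C : 'M[R[i]]_n) (Y : 'M[R[i]]_(n, k)) : 'M[R[i]]_n :=
  C - Aadj A (mu_of A C Y).

Definition tangent {R : realType} (cplx : bool) {n m k : nat} (A : 'I_m -> 'M[R[i]]_n)
  (Y : 'M[R[i]]_(n, k)) : set 'M[R[i]]_(n, k) :=
  [set Yd | Kmat cplx Yd /\ forall i, inprod (A i *m Y) Yd = 0].

Definition gcost {R : realType} {n k : nat} (C : 'M[R[i]]_n) (Y : 'M[R[i]]_(n, k)) : R :=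
  inprod (C *m Y) Y.

Definition is_FOSP {R : realType} (cplx : bool) {n m k : nat} (A : 'I_m -> 'M[R[i]]_n)
  (b : 'cV[R]_m) (C : 'M[R[i]]_n) (eg : R) (Y : 'M[R[i]]_(n, k)) : Prop :=
  Mset cplx A b k Y /\ frob (2%:R *: (S_of A C Y *m Y)) <= eg.

Definition is_SOSP {R : realType} (cplx : bool) {n m k : nat} (A : 'I_m -> 'M[R[i]]_n)
  (b : 'cV[R]_m) (C : 'M[R[i]]_n) (eg eH : R) (Y : 'M[R[i]]_(n, k)) : Prop :=
  is_FOSP cplx A b C eg Y /\
  forall Yd, tangent cplx A Y Yd ->
    - eH * frob Yd ^+ 2 <= inprod Yd (S_of A C Y *m Yd).

(* X >= 0 : x^* X x >= 0 for all x in K^n (in the order of R[i], i.e. real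
   and nonnegative) *)
Definition psd {R : realType} (cplx : bool) {n : nat} (X : 'M[R[i]]_n) : Prop :=
  forall x : 'cV[R[i]]_n, Kmat cplx x -> 0 <= (cadj x *m X *m x) 0 0.

Definition feasible {R : realType} (cplx : bool) {n m : nat} (A : 'I_m -> 'M[R[i]]_n)
  (b : 'cV[R]_m) : set 'M[R[i]]_n :=
  [set X | [/\ selfadj cplx X, Aop A X = b & psd cplx X]].

Definition fstar {R : realType} (cplx : bool) {n m : nat} (A : 'I_m -> 'M[R[i]]_n)
  (b : 'cV[R]_m) (C : 'M[R[i]]_n) : R :=
  inf [set inprod C X | X in feasible cplx A b].

Definition specnorm {R : realType} (cplx : bool) {n : nat} (M : 'M[R[i]]_n) : R :=
  sup [set frob (M *m x) / frob x | x in [set x : 'cV[R[i]]_n | Kmat cplx x /\ x != 0]].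

Definition opnorm {R : realType} (cplx : bool) {n : nat}
  (f : 'M[R[i]]_n -> 'M[R[i]]_n) : R :=
  sup [set frob (f Z) / frob Z | Z in [set Z : 'M[R[i]]_n | Kmat cplx Z /\ Z != 0]].

Definition openK {R : realType} (cplx : bool) {p q : nat} (U : set 'M[R[i]]_(p, q)) : Prop :=
  forall Y, U Y -> Kmat cplx Y ->
    exists2 e : R, 0 < e & forall Z, Kmat cplx Z -> frob (Z - Y) < e -> U Z.

Definition compactK {R : realType} {n : nat} (S : set 'M[R[i]]_n) : Prop :=
  forall u : nat -> 'M[R[i]]_n, (forall t, S (u t)) ->
    exists phi : nat -> nat, (forall t, (phi t < phi t.+1)%N) /\
      exists2 L, S L & (fun t => frob (u (phi t) - L)) @ \oo --> (0 : R).

Definition rcoords {R : realType} {p q : nat} (M : 'M[R[i]]_(p, q)) : 'rV[R]_(p * q + p * q) :=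
  row_mx (mxvec (map_mx (@complex.Re R) M)) (mxvec (map_mx (@complex.Im R) M)).

Definition span_dim {R : realType} {n m k : nat} (A : 'I_m -> 'M[R[i]]_n)
  (Y : 'M[R[i]]_(n, k)) : nat :=
  \rank (\matrix_(i < m) rcoords (A i *m Y)).

Definition lin_indep {R : realType} {n m k : nat} (A : 'I_m -> 'M[R[i]]_n)
  (Y : 'M[R[i]]_(n, k)) : Prop :=
  forall c : 'I_m -> R, \sum_i rC (c i) *: (A i *m Y) = 0 -> forall i, c i = 0.

Definition smooth_manifold_assumption {R : realType} (cplx : bool) {n m : nat}
  (A : 'I_m -> 'M[R[i]]_n) (b : 'cV[R]_m) : Prop :=
  forall k, (k <= n)%N -> Mset cplx A b k !=set0 ->
    (forall Y, Mset cplx A b k Y -> lin_indep A Y) \/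
    (exists U : set 'M[R[i]]_(n, k), [/\ openK cplx U, Mset cplx A b k `<=` U &
        exists d, forall Y, U Y -> Kmat cplx Y -> span_dim A Y = d]).

Definition indep_rvs {d} {T : measurableType d} {R : realType} (P : probability T R)
  {I : finType} (X : I -> T -> R) : Prop :=
  (forall i, measurable_fun setT (X i)) /\
  forall B : I -> set R, (forall i, measurable (B i)) ->
    P (\bigcap_i (X i @^-1` B i)) = (\prod_i P (X i @^-1` B i))%E.

(* indices of the free real parameters of a Wigner matrix:
   (i, j, false) = Re W_ij for i <= j ; (i, j, true) = Im W_ij for i < j
   (the latter only in the complex case) *)
Definition widx_pred (cplx : bool) (n : nat) (x : 'I_n * 'I_n * bool) : bool :=
  (x.1.1 <= x.1.2)%N && (~~ x.2 || (cplx && (x.1.1 < x.1.2)%N)).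

Definition widx (cplx : bool) (n : nat) := {x : 'I_n * 'I_n * bool | widx_pred cplx n x}.

Definition wentry {R : realType} {T : Type} {n : nat} (W : T -> 'M[R[i]]_n)
  (x : 'I_n * 'I_n * bool) : T -> R :=
  fun w => if x.2 then complex.Im (W w x.1.1 x.1.2) else complex.Re (W w x.1.1 x.1.2).

Definition wsd {R : realType} (cplx : bool) (n : nat) (sigma : R) (x : 'I_n * 'I_n * bool) : R :=
  if cplx && (x.1.1 != x.1.2) then sigma / Num.sqrt 2%:R else sigma.

Definition gaussian_wigner {d} {T : measurableType d} {R : realType} (P : probability T R)
  (cplx : bool) (n : nat) (sigma : R) (W : T -> 'M[R[i]]_n) : Prop :=
  [/\ forall w, selfadj cplx (W w),
      indep_rvs P (fun x : widx cplx n => wentry W (val x)) &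
      forall x : widx cplx n, forall B : set R, measurable B ->
        P (wentry W (val x) @^-1` B) = normal_prob 0 (wsd cplx n sigma (val x)) B].

(* Main.v *)
(** Let S = C + W - A^*(mu(Y)).  If some unit vector z makes |Yz| small, then projecting
    the matrices x z^* to the tangent space at Y and using second-order criticality shows
    that S is almost positive semidefinite, and a duality argument bounds the gap.
    Otherwise, since S Y is small, S is very small on the k-dimensional range of Y.  The
    matrices A^*(mu(Y)) lie in a ball of an m-dimensional space, which has a net of
    cardinality exp(O(k^2)) under the assumption on k, so it is enough to show that, for
    fixed Hermitian M, the matrix X = M + W is that small on a k-dimensional subspace with
    probability exp(- c k^2), where c is large.

    In that event the trace of e (X^2 + e)^-1 is at least k/2.  Choosing indices greedily
    according to its diagonal gives l = k/8 columns of X, each of which has a small quadratic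
    form for a resolvent built from the columns not chosen yet.  The columns are Gaussian, and
    integrating the real parameters of one column at a time costs a determinant
    of at least (1 + u)^(k/4) for each of them, with u large; a union bound over the n^l
    choices of indices remains affordable because log n <= k/3.

    A degenerate case is separate: if all A_i Y vanish for some feasible Y, then b = 0 and
    the trace bound forces X = 0.  Otherwise KR >= 1, which makes the logarithm in the
    assumption on k large. *)

Require Import Defs.
From HB Require Import structures.
From mathcomp Require Import all_boot all_order all_algebra.
From mathcomp Require Import all_classical all_reals all_analysis.
From mathcomp Require Import measurable_realfun complex.
From mathcomp Require Import ring lra spectral.

Set Implicit Arguments.
Unset Strict Implicit.
Unset Printing Implicit Defensive.

Import Order.TTheory GRing.Theory Num.Theory.
Import numFieldNormedType.Exports.
Local Open Scope classical_set_scope.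
Local Open Scope ring_scope.

(** * Matrices over R[i] with the real inner product *)

(** The matrix [S] depends on [W] also through [Y], so no probability estimate applies to it
    directly. Only its multiplier term is discretized, with exponent [m] rather than the dimension
    of all Hermitian matrices, and [Y] itself never enters a union bound. The obstacle to
    integrating column by column is that Hermitian symmetry places each off-diagonal parameter of
    [W] in two columns. Hence the rows of all chosen indices are deleted beforehand: the parameters
    of a pivot column in the remaining rows then occur neither in the resolvent attached to that
    column, nor in those attached to later pivots, nor in the compressed trace. Deleting rows and
    columns only raises the trace of the resolvent, and putting back one column lowers it by at most
    1, so that k/8 pivots leave a trace of at least k/4 for each determinant. Since m times the
    logarithm is at most k^2 / 9, the net costs exp(4 k^2 / 9); each of the at least k/16 pivots
    gains exp(- 10 k) before the choice of its index is paid for, and the balance still leaves room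
    for [delta]. *)

Section MatrixInnerProduct.
Context {R : realType}.
Implicit Types (p q r n : nat) (a b : R) (z : R[i]).

Lemma cReD z z' : complex.Re (z + z') = complex.Re z + complex.Re z'.
Proof. by case: z; case: z'. Qed.

Lemma cReN z : complex.Re (- z) = - complex.Re z.
Proof. by case: z. Qed.

Lemma cImD z z' : complex.Im (z + z') = complex.Im z + complex.Im z'.
Proof. by case: z; case: z'. Qed.

Lemma cReM z z' : complex.Re (z * z') =
  complex.Re z * complex.Re z' - complex.Im z * complex.Im z'.
Proof. by case: z; case: z'. Qed.

Lemma cImM z z' : complex.Im (z * z') =
  complex.Re z * complex.Im z' + complex.Im z * complex.Re z'.
Proof. by case: z; case: z'. Qed.

Lemma cRe_sum I (s : seq I) (P : pred I) (F : I -> R[i]) :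
  complex.Re (\sum_(i <- s | P i) F i) = \sum_(i <- s | P i) complex.Re (F i).
Proof. exact: (big_morph (@complex.Re R) cReD). Qed.

Lemma cIm_sum I (s : seq I) (P : pred I) (F : I -> R[i]) :
  complex.Im (\sum_(i <- s | P i) F i) = \sum_(i <- s | P i) complex.Im (F i).
Proof. exact: (big_morph (@complex.Im R) cImD). Qed.

Lemma cRe_conj z : complex.Re (conjc z) = complex.Re z. Proof. by case: z. Qed.
Lemma cIm_conj z : complex.Im (conjc z) = - complex.Im z. Proof. by case: z. Qed.

Lemma Im_rC a : complex.Im (rC a) = 0. Proof. by []. Qed.

Lemma conj_rC a : conjc (rC a) = rC a.
Proof. by rewrite /rC /= oppr0. Qed.

Lemma rCD a b : rC (a + b) = rC a + rC b.
Proof. by rewrite /rC /GRing.add /= addr0. Qed.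

Lemma rCM a b : rC (a * b) = rC a * rC b.
Proof. exact: (rmorphM (real_complex R)). Qed.

Lemma rCN a : rC (- a) = - rC a.
Proof. exact: (rmorphN (real_complex R)). Qed.

Lemma rC0 : rC (0 : R) = 0. Proof. by []. Qed.
Lemma rC1 : rC (1 : R) = 1. Proof. by []. Qed.

Lemma rC_eq0 a : (rC a == 0) = (a == 0).
Proof. exact: (fmorph_eq0 (real_complex R)). Qed.

Lemma rC_nat k : rC (k%:R : R) = k%:R.
Proof. exact: (rmorph_nat (real_complex R)). Qed.

Lemma rC_inj : injective (@rC R).
Proof. by move=> x y []. Qed.

Lemma complex_ext z z' : complex.Re z = complex.Re z' ->
  complex.Im z = complex.Im z' -> z = z'.
Proof. by case: z => a b; case: z' => a' b' /= -> ->. Qed.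

Lemma cadjE p q (A : 'M[R[i]]_(p, q)) i j : cadj A i j = conjc (A j i).
Proof. by rewrite /cadj !mxE. Qed.

Lemma cadjK p q (A : 'M[R[i]]_(p, q)) : cadj (cadj A) = A.
Proof. by apply/matrixP => i j; rewrite !cadjE conjcK. Qed.

Lemma cadjD p q (A B : 'M[R[i]]_(p, q)) : cadj (A + B) = cadj A + cadj B.
Proof. by rewrite /cadj map_mxD linearD. Qed.

Lemma cadjN p q (A : 'M[R[i]]_(p, q)) : cadj (- A) = - cadj A.
Proof. by rewrite /cadj map_mxN linearN. Qed.

Lemma cadjB p q (A B : 'M[R[i]]_(p, q)) : cadj (A - B) = cadj A - cadj B.
Proof. by rewrite cadjD cadjN. Qed.

Lemma cadjM p q r (A : 'M[R[i]]_(p, q)) (B : 'M[R[i]]_(q, r)) :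
  cadj (A *m B) = cadj B *m cadj A.
Proof. by rewrite /cadj map_mxM trmx_mul. Qed.

Lemma cadjZ p q z (A : 'M[R[i]]_(p, q)) : cadj (z *: A) = conjc z *: cadj A.
Proof. by rewrite /cadj map_mxZ linearZ. Qed.

Lemma cadj1 n : cadj (1%:M : 'M[R[i]]_n) = 1%:M.
Proof. by rewrite /cadj map_mx1 trmx1. Qed.

Lemma cadj0 p q : cadj (0 : 'M[R[i]]_(p, q)) = 0.
Proof. by rewrite /cadj map_mx0 trmx0. Qed.

Lemma cadj_scalar n a : cadj ((rC a)%:M : 'M[R[i]]_n) = (rC a)%:M.
Proof. by rewrite /cadj map_scalar_mx tr_scalar_mx -[in RHS](conj_rC a). Qed.

Lemma cadj_sum p q I (s : seq I) (P : pred I) (F : I -> 'M[R[i]]_(p, q)) :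
  cadj (\sum_(i <- s | P i) F i) = \sum_(i <- s | P i) cadj (F i).
Proof. exact: (big_morph _ (@cadjD p q) (@cadj0 p q)). Qed.

Lemma inprodE p q (A B : 'M[R[i]]_(p, q)) : inprod A B =
  \sum_i \sum_j (complex.Re (A i j) * complex.Re (B i j)
                 + complex.Im (A i j) * complex.Im (B i j)).
Proof.
rewrite /inprod /mxtrace cRe_sum exchange_big /=; apply: eq_bigr => j _.
rewrite mxE cRe_sum; apply: eq_bigr => i _.
by rewrite cadjE cReM cRe_conj cIm_conj; ring.
Qed.

Lemma inprodC p q (A B : 'M[R[i]]_(p, q)) : inprod A B = inprod B A.
Proof.
by rewrite !inprodE; apply: eq_bigr => i _; apply: eq_bigr => j _; ring.
Qed.

Lemma inprodDr p q (A B D : 'M[R[i]]_(p, q)) :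
  inprod A (B + D) = inprod A B + inprod A D.
Proof. by rewrite /inprod mulmxDr linearD /= cReD. Qed.

Lemma inprodDl p q (A B D : 'M[R[i]]_(p, q)) :
  inprod (B + D) A = inprod B A + inprod D A.
Proof. by rewrite inprodC inprodDr ![inprod A _]inprodC. Qed.

Lemma inprodNr p q (A B : 'M[R[i]]_(p, q)) : inprod A (- B) = - inprod A B.
Proof. by rewrite /inprod mulmxN linearN /= cReN. Qed.

Lemma inprodNl p q (A B : 'M[R[i]]_(p, q)) : inprod (- A) B = - inprod A B.
Proof. by rewrite inprodC inprodNr inprodC. Qed.

Lemma inprodBr p q (A B D : 'M[R[i]]_(p, q)) :
  inprod A (B - D) = inprod A B - inprod A D.
Proof. by rewrite inprodDr inprodNr. Qed.

Lemma inprodBl p q (A B D : 'M[R[i]]_(p, q)) :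
  inprod (B - D) A = inprod B A - inprod D A.
Proof. by rewrite inprodDl inprodNl. Qed.

Lemma inprodZr p q a (A B : 'M[R[i]]_(p, q)) :
  inprod A (rC a *: B) = a * inprod A B.
Proof. by rewrite /inprod -scalemxAr linearZ /= cReM /= mul0r subr0. Qed.

Lemma inprodZl p q a (A B : 'M[R[i]]_(p, q)) :
  inprod (rC a *: A) B = a * inprod A B.
Proof. by rewrite inprodC inprodZr inprodC. Qed.

Lemma inprod0r p q (A : 'M[R[i]]_(p, q)) : inprod A 0 = 0.
Proof. by rewrite /inprod mulmx0 linear0. Qed.

Lemma inprod0l p q (A : 'M[R[i]]_(p, q)) : inprod 0 A = 0.
Proof. by rewrite inprodC inprod0r. Qed.

Lemma inprod_sumr p q I (s : seq I) (P : pred I) (A : 'M[R[i]]_(p, q))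
    (F : I -> 'M[R[i]]_(p, q)) :
  inprod A (\sum_(i <- s | P i) F i) = \sum_(i <- s | P i) inprod A (F i).
Proof. exact: (big_morph _ (inprodDr A) (inprod0r A)). Qed.

Lemma inprod_suml p q I (s : seq I) (P : pred I) (A : 'M[R[i]]_(p, q))
    (F : I -> 'M[R[i]]_(p, q)) :
  inprod (\sum_(i <- s | P i) F i) A = \sum_(i <- s | P i) inprod (F i) A.
Proof. by rewrite inprodC inprod_sumr; apply: eq_bigr => i _; rewrite inprodC. Qed.

Lemma inprod_mull p q r (A : 'M[R[i]]_(p, q)) (B : 'M[R[i]]_(q, r)) D :
  inprod (A *m B) D = inprod B (cadj A *m D).
Proof. by rewrite /inprod cadjM mulmxA. Qed.

Lemma inprod_mulr p q r (A : 'M[R[i]]_(p, q)) (B : 'M[R[i]]_(q, r)) D :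
  inprod (A *m B) D = inprod A (D *m cadj B).
Proof. by rewrite /inprod cadjM -mulmxA mxtrace_mulC mulmxA. Qed.

Lemma inprod_ge0 p q (A : 'M[R[i]]_(p, q)) : 0 <= inprod A A.
Proof.
rewrite inprodE; apply: sumr_ge0 => i _; apply: sumr_ge0 => j _.
by rewrite -!expr2 addr_ge0 ?sqr_ge0.
Qed.

Lemma inprod_eq0 p q (A : 'M[R[i]]_(p, q)) : inprod A A = 0 -> A = 0.
Proof.
rewrite inprodE => /eqP; rewrite psumr_eq0 => [|i _]; last first.
  by apply: sumr_ge0 => j _; rewrite -!expr2 addr_ge0 ?sqr_ge0.
move=> /allP hA; apply/matrixP => i j; rewrite mxE.
have /eqP := hA i (mem_index_enum i).
move=> /eqP; rewrite /= psumr_eq0 => [|j' _]; last first.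
  by rewrite -!expr2 addr_ge0 ?sqr_ge0.
move=> /allP /(_ j (mem_index_enum j)) /=.
rewrite -!expr2 paddr_eq0 ?sqr_ge0 // !sqrf_eq0 => /andP[/eqP h1 /eqP h2].
exact: complex_ext.
Qed.

Lemma inprod_cadj p q (A B : 'M[R[i]]_(p, q)) :
  inprod (cadj A) (cadj B) = inprod A B.
Proof.
rewrite !inprodE exchange_big; apply: eq_bigr => i _; apply: eq_bigr => j _.
by rewrite !cadjE !cRe_conj !cIm_conj mulrNN.
Qed.

Lemma inprod_CS p q (A B : 'M[R[i]]_(p, q)) :
  inprod A B ^+ 2 <= inprod A A * inprod B B.
Proof.
have [B0|Bn0] := eqVneq (inprod B B) 0.
  by rewrite (inprod_eq0 B0) !inprod0r expr0n mulr0.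
have Bp : 0 < inprod B B by rewrite lt_def Bn0 inprod_ge0.
have := inprod_ge0 (rC (inprod B B) *: A - rC (inprod A B) *: B).
rewrite !(inprodBl, inprodBr, inprodZl, inprodZr) (inprodC B A).
move: (inprod A A) (inprod B B) (inprod A B) Bp => x y t yp h.
have : 0 <= y * (x * y - t ^+ 2).
  by apply: le_trans h _; rewrite le_eqVlt; apply/orP; left; apply/eqP; ring.
by rewrite (pmulr_rge0 _ yp) subr_ge0.
Qed.

Lemma frob_ge0 p q (A : 'M[R[i]]_(p, q)) : 0 <= frob A.
Proof. exact: sqrtr_ge0. Qed.

Lemma frob_sqr p q (A : 'M[R[i]]_(p, q)) : frob A ^+ 2 = inprod A A.
Proof. by rewrite sqr_sqrtr ?inprod_ge0. Qed.

Lemma frob_eq0 p q (A : 'M[R[i]]_(p, q)) : frob A = 0 -> A = 0.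
Proof. by move=> h; apply: inprod_eq0; rewrite -frob_sqr h expr0n. Qed.

Lemma frob0 p q : frob (0 : 'M[R[i]]_(p, q)) = 0.
Proof. by rewrite /frob inprod0r sqrtr0. Qed.

Lemma frob_gt0 p q (A : 'M[R[i]]_(p, q)) : A != 0 -> 0 < frob A.
Proof.
move=> A0; rewrite lt_def frob_ge0 andbT; apply: contra_neq A0; exact: frob_eq0.
Qed.

Lemma inprod_le p q (A B : 'M[R[i]]_(p, q)) : inprod A B <= frob A * frob B.
Proof.
apply: le_trans (ler_norm _) _.
rewrite -ler_sqr ?nnegrE ?normr_ge0 ?mulr_ge0 ?frob_ge0 //.
by rewrite real_normK ?num_real // exprMn !frob_sqr inprod_CS.
Qed.

Lemma inprod_ge p q (A B : 'M[R[i]]_(p, q)) : - (frob A * frob B) <= inprod A B.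
Proof.
rewrite lerNl -inprodNl; apply: le_trans (inprod_le _ _) _.
by rewrite {1}/frob inprodNl inprodNr opprK.
Qed.

Lemma frobD p q (A B : 'M[R[i]]_(p, q)) : frob (A + B) <= frob A + frob B.
Proof.
rewrite -ler_sqr ?nnegrE ?addr_ge0 ?frob_ge0 // sqrrD !frob_sqr.
rewrite !(inprodDl, inprodDr) (inprodC B A).
by have := inprod_le A B; move: (inprod _ _) (inprod _ _) (inprod _ _) => x y t; lra.
Qed.

Lemma frob_sum p q I (s : seq I) (F : I -> 'M[R[i]]_(p, q)) :
  frob (\sum_(i <- s) F i) <= \sum_(i <- s) frob (F i).
Proof.
elim: s => [|i s IH]; first by rewrite !big_nil frob0.
by rewrite !big_cons; apply: le_trans (frobD _ _) _; rewrite lerD2l.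
Qed.

Lemma frobN p q (A : 'M[R[i]]_(p, q)) : frob (- A) = frob A.
Proof. by rewrite /frob inprodNl inprodNr opprK. Qed.

Lemma frobB p q (A B : 'M[R[i]]_(p, q)) : frob (A - B) <= frob A + frob B.
Proof. by rewrite -(frobN B) frobD. Qed.

Lemma frobZ p q a (A : 'M[R[i]]_(p, q)) : frob (rC a *: A) = `|a| * frob A.
Proof.
rewrite /frob inprodZl inprodZr mulrA -expr2 sqrtrM ?sqr_ge0 //.
by rewrite sqrtr_sqr.
Qed.

Lemma frob_cadj p q (A : 'M[R[i]]_(p, q)) : frob (cadj A) = frob A.
Proof. by rewrite /frob inprod_cadj. Qed.

Lemma inprod_col p q (A B : 'M[R[i]]_(p, q)) :
  inprod A B = \sum_j inprod (col j A) (col j B).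
Proof.
rewrite !inprodE exchange_big; apply: eq_bigr => j _ /=.
rewrite inprodE; apply: eq_bigr => i _; rewrite big_ord1 !mxE //.
Qed.

Lemma inprod_row p q (A B : 'M[R[i]]_(p, q)) :
  inprod A B = \sum_i inprod (row i A) (row i B).
Proof.
rewrite !inprodE; apply: eq_bigr => i _ /=.
rewrite inprodE big_ord1; apply: eq_bigr => j _; rewrite !mxE //.
Qed.

Lemma frob_mulcV p q (A : 'M[R[i]]_(p, q)) (x : 'cV[R[i]]_q) :
  frob (A *m x) <= frob A * frob x.
Proof.
rewrite -ler_sqr ?nnegrE ?mulr_ge0 ?frob_ge0 // exprMn !frob_sqr.
rewrite (inprod_row A A) mulr_suml inprod_row; apply: ler_sum => i _.
rewrite row_mul; set a := row i A.
(* |a x|^2 for a row vector a, by Cauchy--Schwarz against (a x) x^* *)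
have h : inprod (a *m x) (a *m x) ^+ 2 <=
    inprod a a * (inprod (a *m x) (a *m x) * inprod x x).
  rewrite {1}inprod_mulr; apply: le_trans (inprod_CS _ _) _.
  rewrite ler_wpM2l ?inprod_ge0 //.
  rewrite inprod_mulr cadjK -mulmxA; set c := a *m x.
  have -> : cadj x *m x = (rC (inprod x x))%:M.
    apply/matrixP => i' j'; rewrite !ord1 [RHS]mxE eqxx mulr1n.
    rewrite mxE inprodE; apply: complex_ext; rewrite ?cRe_sum ?cIm_sum /=.
      apply: eq_bigr => k _; rewrite big_ord1 cadjE cReM cRe_conj cIm_conj.
      by ring.
    rewrite big1 // => k _; rewrite cadjE cImM cRe_conj cIm_conj; ring.
  by rewrite mul_mx_scalar inprodZr mulrC.
have [->|cn0] := eqVneq (inprod (a *m x) (a *m x)) 0.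
  by rewrite mulr_ge0 ?inprod_ge0.
have cp : 0 < inprod (a *m x) (a *m x) by rewrite lt_def cn0 inprod_ge0.
by rewrite -(ler_pM2r cp) -expr2 -mulrA (mulrC (inprod x x)).
Qed.

Lemma frobM p q r (A : 'M[R[i]]_(p, q)) (B : 'M[R[i]]_(q, r)) :
  frob (A *m B) <= frob A * frob B.
Proof.
rewrite -ler_sqr ?nnegrE ?mulr_ge0 ?frob_ge0 // exprMn !frob_sqr.
rewrite (inprod_col B B) mulr_sumr inprod_col; apply: ler_sum => i _.
rewrite colE -mulmxA -colE -!frob_sqr -exprMn.
by rewrite ler_sqr ?nnegrE ?mulr_ge0 ?frob_ge0 // frob_mulcV.
Qed.

End MatrixInnerProduct.

(** * Traces of resolvents *)

Definition resol_gram {R : realType} (e : R) {p q : nat} (N : 'M[R[i]]_(p, q)) :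
  'M[R[i]]_p := N *m cadj N + (rC e)%:M.

(** A matrix between 0 and 1, close to 1 on directions that [cadj N] shrinks well below sqrt e and
    close to 0 where it stretches them well beyond; its trace is a smooth count of small singular
    values. *)
Definition resol {R : realType} (e : R) {p q : nat} (N : 'M[R[i]]_(p, q)) :
  'M[R[i]]_p := rC e *: invmx (resol_gram e N).

Definition retr {R : realType} {n : nat} (B : 'M[R[i]]_n) : R :=
  complex.Re (\tr B).

Definition ecol {R : realType} {n : nat} (i : 'I_n) : 'cV[R[i]]_n :=
  delta_mx i 0.

Section Resolvent.
Context {R : realType}.
Local Opaque invmx.
Implicit Types (p q r n : nat) (e : R).

Lemma retrD n (A B : 'M[R[i]]_n) : retr (A + B) = retr A + retr B.
Proof. by rewrite /retr linearD cReD. Qed.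

Lemma retrN n (A : 'M[R[i]]_n) : retr (- A) = - retr A.
Proof. by rewrite /retr linearN cReN. Qed.

Lemma retrB n (A B : 'M[R[i]]_n) : retr (A - B) = retr A - retr B.
Proof. by rewrite retrD retrN. Qed.

Lemma retrZ n e (A : 'M[R[i]]_n) : retr (rC e *: A) = e * retr A.
Proof. by rewrite /retr mxtraceZ cReM /= mul0r subr0. Qed.

Lemma retr1 n : retr (1%:M : 'M[R[i]]_n) = n%:R.
Proof. by rewrite /retr mxtrace1 -rC_nat. Qed.

Lemma retr_mulC p q (A : 'M[R[i]]_(p, q)) (B : 'M[R[i]]_(q, p)) :
  retr (A *m B) = retr (B *m A).
Proof. by rewrite /retr mxtrace_mulC. Qed.

Lemma retrE n (B : 'M[R[i]]_n) : retr B = \sum_i complex.Re (B i i).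
Proof. by rewrite /retr /mxtrace cRe_sum. Qed.

Lemma retr_inprod p q (A B : 'M[R[i]]_(p, q)) :
  retr (cadj A *m B) = inprod A B.
Proof. by []. Qed.

Lemma mul_ecol p n (B : 'M[R[i]]_(p, n)) i : B *m ecol i = col i B.
Proof. by rewrite /ecol -colE. Qed.

Lemma mul_ecolE p n (B : 'M[R[i]]_(p, n)) i a j : (B *m ecol i) a j = B a i.
Proof. by rewrite mul_ecol mxE. Qed.

Lemma inprod_ecol n (i : 'I_n) (x : 'cV[R[i]]_n) :
  inprod (ecol i) x = complex.Re (x i 0).
Proof.
rewrite inprodE (bigD1 i) //= big_ord1 !mxE !eqxx /= mul1r mul0r addr0.
rewrite big1 ?addr0 // => j ji; rewrite big_ord1 !mxE (negPf ji) /=.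
by rewrite !mul0r addr0.
Qed.

Lemma retr_quad n (B : 'M[R[i]]_n) :
  retr B = \sum_i inprod (ecol i) (B *m ecol i).
Proof.
by rewrite retrE; apply: eq_bigr => i _; rewrite inprod_ecol mul_ecol mxE.
Qed.

Lemma retr_ge0 n (B : 'M[R[i]]_n) :
  (forall x : 'cV_n, 0 <= inprod x (B *m x)) -> 0 <= retr B.
Proof. by move=> h; rewrite retr_quad; apply: sumr_ge0. Qed.

Lemma inj_unitmx n (G : 'M[R[i]]_n) :
  (forall x : 'cV_n, G *m x = 0 -> x = 0) -> G \in unitmx.
Proof.
move=> h; rewrite -unitmx_tr -row_free_unit -kermx_eq0.
apply/eqP/row_matrixP => i; rewrite row0; apply: trmx_inj; rewrite trmx0.
apply: h; rewrite -{1}[G]trmxK -trmx_mul -row_mul mulmx_ker.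
by rewrite row0 trmx0.
Qed.

Lemma cadj_invmx n (G : 'M[R[i]]_n) : cadj G = G -> cadj (invmx G) = invmx G.
Proof.
move=> h; rewrite /cadj map_invmx trmx_inv.
by rewrite -[in RHS]h.
Qed.

Lemma resol_gram_herm e p q (N : 'M[R[i]]_(p, q)) :
  cadj (resol_gram e N) = resol_gram e N.
Proof. by rewrite /resol_gram cadjD cadjM cadjK cadj_scalar. Qed.

Lemma resol_gram_quad e p q (N : 'M[R[i]]_(p, q)) (x : 'cV[R[i]]_p) :
  inprod x (resol_gram e N *m x) =
  inprod (cadj N *m x) (cadj N *m x) + e * inprod x x.
Proof.
rewrite /resol_gram mulmxDl inprodDr mul_scalar_mx inprodZr -mulmxA.
by rewrite [in RHS]inprod_mull cadjK.
Qed.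

Lemma resol_gram_unit e p q (N : 'M[R[i]]_(p, q)) : 0 < e ->
  resol_gram e N \in unitmx.
Proof.
move=> e0; apply: inj_unitmx => x gx; apply: inprod_eq0.
have := resol_gram_quad e N x; rewrite gx inprod0r => h.
have h1 := inprod_ge0 (cadj N *m x).
have h2 : 0 <= e * inprod x x by rewrite mulr_ge0 ?inprod_ge0 // ltW.
have /eqP : e * inprod x x = 0 by lra.
by rewrite mulf_eq0 gt_eqF //= => /eqP.
Qed.

Lemma resol_herm e p q (N : 'M[R[i]]_(p, q)) : cadj (resol e N) = resol e N.
Proof. by rewrite /resol cadjZ conj_rC cadj_invmx // resol_gram_herm. Qed.

Lemma mul_resol_gram e p q (N : 'M[R[i]]_(p, q)) : 0 < e ->
  resol_gram e N *m resol e N = (rC e)%:M.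
Proof.
by move=> e0; rewrite /resol -scalemxAr mulmxV ?resol_gram_unit // scalemx1.
Qed.

Lemma resol_mul_gram e p q (N : 'M[R[i]]_(p, q)) : 0 < e ->
  resol e N *m resol_gram e N = (rC e)%:M.
Proof.
by move=> e0; rewrite /resol -scalemxAl mulVmx ?resol_gram_unit // scalemx1.
Qed.

(** The spectrum lies in [0,1], expressed without eigenvalues: the square is at most the matrix.
    Writing x as the regularized Gram matrix applied to h makes both sides explicit. *)
Lemma resol_sqr_le e p q (N : 'M[R[i]]_(p, q)) (x : 'cV[R[i]]_p) : 0 < e ->
  inprod (resol e N *m x) (resol e N *m x) <= inprod x (resol e N *m x).
Proof.
move=> e0; have u := resol_gram_unit N e0; rewrite /resol -scalemxAl.
set h := invmx _ *m x; have -> : x = resol_gram e N *m h by rewrite mulKVmx.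
rewrite inprodZl !inprodZr ler_wpM2l ?(ltW e0) //.
by rewrite [leRHS]inprodC resol_gram_quad lerDr inprod_ge0.
Qed.

Lemma resol_ge0 e p q (N : 'M[R[i]]_(p, q)) (x : 'cV[R[i]]_p) : 0 < e ->
  0 <= inprod x (resol e N *m x).
Proof. by move=> e0; apply: le_trans (resol_sqr_le N x e0); exact: inprod_ge0. Qed.

Lemma resol_le1 e p q (N : 'M[R[i]]_(p, q)) (x : 'cV[R[i]]_p) : 0 < e ->
  inprod x (resol e N *m x) <= inprod x x.
Proof.
move=> e0; have h1 := resol_sqr_le N x e0.
move: (resol e N *m x) h1 => y h1; have := inprod_ge0 (x - y).
rewrite inprodBl !inprodBr (inprodC y x); move: h1.
by move: (inprod x x) (inprod x y) (inprod y y) => a c d; lra.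
Qed.

(* 0 <= (1 - QB) B^-1 (1 - BQ) *)
Lemma retr_inv_ge n (B Q : 'M[R[i]]_n) : cadj B = B -> cadj Q = Q ->
    B \in unitmx -> (forall x : 'cV_n, 0 <= inprod x (invmx B *m x)) ->
  2 * retr Q - retr (Q *m B *m Q) <= retr (invmx B).
Proof.
move=> hB hQ uB pB.
have : 0 <= retr ((1%:M - Q *m B) *m invmx B *m (1%:M - B *m Q)).
  apply: retr_ge0 => x.
  have -> : 1%:M - Q *m B = cadj (1%:M - B *m Q).
    by rewrite cadjB cadj1 cadjM hB hQ.
  rewrite -!mulmxA -[cadj _ *m _]/(cadj _ *m _) inprodC inprod_mull cadjK.
  by rewrite inprodC pB.
have -> : (1%:M - Q *m B) *m invmx B *m (1%:M - B *m Q) =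
    invmx B - Q - Q + Q *m B *m Q.
  have -> : (1%:M - Q *m B) *m invmx B = invmx B - Q.
    by rewrite mulmxBl mul1mx -mulmxA mulmxV // mulmx1.
  rewrite mulmxBr mulmx1 mulmxBl !mulmxA mulVmx // mul1mx.
  by rewrite opprB addrA addrAC.
by rewrite retrD !retrB; lra.
Qed.

Lemma resol_inv_ge0 e p q (N : 'M[R[i]]_(p, q)) (x : 'cV[R[i]]_p) : 0 < e ->
  0 <= inprod x (invmx (resol_gram e N) *m x).
Proof.
move=> e0; have := resol_ge0 N x e0; rewrite /resol -scalemxAl inprodZr.
by rewrite pmulr_rge0.
Qed.

(** No matrix square root is involved: [retr_inv_ge] with B = G1 and Q = G2^-1 bounds tr G1^-1 below
    by 2 tr Q - tr (Q G1 Q), and G1 <= G2 bounds the last trace by tr (Q G2 Q) = tr Q. *)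
Lemma resol_retr_antitone e p q r (N1 : 'M[R[i]]_(p, q)) (N2 : 'M[R[i]]_(p, r)) :
  0 < e ->
  (forall x : 'cV_p, inprod (cadj N1 *m x) (cadj N1 *m x) <=
                     inprod (cadj N2 *m x) (cadj N2 *m x)) ->
  retr (resol e N2) <= retr (resol e N1).
Proof.
move=> e0 h; rewrite /resol !retrZ ler_wpM2l ?(ltW e0) //.
have := mulVmx (resol_gram_unit N2 e0).
have := cadj_invmx (resol_gram_herm e N2).
move: (invmx (resol_gram e N2)) => D hD DV.
have := @retr_inv_ge _ (resol_gram e N1) D (resol_gram_herm _ _) hD.
move=> /(_ (resol_gram_unit _ e0) (fun x => resol_inv_ge0 N1 x e0)).
apply: le_trans.
move: DV (resol_gram_quad e N1) (resol_gram_quad e N2).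
move: (resol_gram e N1) (resol_gram e N2) => G1 G2 DV q1 q2.
suff : retr (D *m G1 *m D) <= retr D by lra.
have -> : retr D = retr (D *m G2 *m D) by rewrite DV mul1mx.
have flip (G : 'M[R[i]]_p) i : inprod (ecol i) (D *m G *m D *m ecol i) =
    inprod (D *m ecol i) (G *m (D *m ecol i)).
  by rewrite -!mulmxA [in RHS]inprod_mull hD.
rewrite !retr_quad; apply: ler_sum => i _.
by rewrite (flip G1) (flip G2) (q1 (D *m ecol i)) (q2 (D *m ecol i)) lerD2r.
Qed.

(** Push-through identity (X^* X + e)^-1 X^* = X^* (X X^* + e)^-1, followed by cyclicity of the
    trace. *)
Lemma resol_retr_swap e n (X : 'M[R[i]]_n) : 0 < e ->
  retr (resol e (cadj X)) = retr (resol e X).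
Proof.
move=> e0.
have := mulVmx (resol_gram_unit (cadj X) e0).
have := mulVmx (resol_gram_unit X e0); have := mulmxV (resol_gram_unit X e0).
rewrite /resol !retrZ.
move: (invmx (resol_gram e X)) (invmx (resol_gram e (cadj X))) => B D BV VB DV.
have XD : D *m cadj X = cadj X *m B.
  rewrite -[LHS]mulmx1 -BV !mulmxA; congr (_ *m _).
  rewrite -[RHS]mul1mx -DV -!mulmxA; congr (_ *m _).
  rewrite /resol_gram cadjK mulmxDr mulmxDl mulmxA.
  by rewrite mul_mx_scalar mul_scalar_mx.
have E1 : rC e *: B = 1%:M - X *m cadj X *m B.
  by rewrite -BV /resol_gram mulmxDl mul_scalar_mx addrAC subrr add0r.
have E2 : rC e *: D = 1%:M - D *m cadj X *m X.
  rewrite -DV /resol_gram cadjK mulmxDr mul_mx_scalar -mulmxA.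
  by rewrite addrAC subrr add0r.
by rewrite -!retrZ E1 E2 XD !retrB (retr_mulC (cadj X *m B) X) mulmxA.
Qed.

(* by the Sherman--Morrison formula *)
Lemma resol_retr_rank1 e p q r (N : 'M[R[i]]_(p, q)) (N0 : 'M[R[i]]_(p, r))
    (f : 'cV[R[i]]_p) : 0 < e ->
  N *m cadj N = N0 *m cadj N0 + f *m cadj f ->
  retr (resol e N0) - 1 <= retr (resol e N).
Proof.
move=> e0 hN.
have := resol_gram_unit N0 e0.
have := cadj_invmx (resol_gram_herm e N0).
have := fun x => resol_inv_ge0 N0 x e0.
have := resol_sqr_le N0 f e0; rewrite /resol -scalemxAl inprodZl !inprodZr.
have := resol_gram_unit N e0.
have -> : resol_gram e N = resol_gram e N0 + f *m cadj f.
  by rewrite /resol_gram hN addrAC.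
move: (resol_gram e N0) => B0 uB sq pB hB uB0.
rewrite ler_pM2l // in sq.
have VB := mulVmx uB0; move: (invmx B0) hB VB pB sq => Bi hBi VB pB sq.
have VN : Bi *m f *m cadj (Bi *m f) *m B0 = Bi *m f *m cadj f.
  by rewrite -mulmxA cadjM hBi -(mulmxA (cadj f)) VB mulmx1.
have cf : cadj (Bi *m f) *m f = cadj f *m (Bi *m f).
  by rewrite cadjM hBi mulmxA.
have BF : Bi *m (f *m cadj f) = Bi *m f *m cadj f by rewrite mulmxA.
move: (Bi *m f) (pB f) sq VN cf BF => h; set a := inprod f h.
move=> a0 sq VN cf BF.
have fh : cadj f *m h = (rC a)%:M.
  apply/matrixP => i j; rewrite !ord1 [RHS]mxE eqxx mulr1n.
  apply: complex_ext; first by rewrite /a /inprod trace_mx11.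
  have : cadj (cadj f *m h) = cadj f *m h by rewrite cadjM cadjK cf.
  move=> /matrixP /(_ 0 0); rewrite cadjE => /(congr1 (@complex.Im R)).
  by rewrite cIm_conj Im_rC; lra.
set c := (1 + a)^-1.
have a1 : 1 + a != 0 by rewrite gt_eqF // ltr_pwDl.
have inv : invmx (B0 + f *m cadj f) = Bi - rC c *: (h *m cadj h).
  apply: (can_inj (mulmxK uB)); rewrite mulVmx //.
  rewrite mulmxDr !mulmxBl VB BF -!scalemxAl VN.
  have -> : h *m cadj h *m (f *m cadj f) = rC a *: (h *m cadj f).
    by rewrite -mulmxA (mulmxA (cadj h)) cf fh mul_scalar_mx -scalemxAr.
  rewrite scalerA -rCM; move: (h *m cadj f) => Z.
  have -> : rC (c * a) *: Z = Z - rC c *: Z.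
    have -> : c * a = 1 - c by rewrite /c; field.
    by rewrite rCD rCN rC1 scalerBl scale1r.
  by rewrite subKr subrK.
rewrite !retrZ inv retrB retrZ retr_mulC retr_inprod mulrBr lerB //.
rewrite mulrCA /c mulrC ler_pdivrMr ?ltr_pwDl // mul1r.
by apply: le_trans sq _; lra.
Qed.

(** The left side is in fact the minimum of the right side over [w], as in ridge regression of [f]
    on the columns of [N]; any test vector therefore bounds the quadratic form of the resolvent. *)
Lemma resol_quad_min e p q (N : 'M[R[i]]_(p, q)) (f : 'cV[R[i]]_p)
    (w : 'cV[R[i]]_q) : 0 < e ->
  inprod f (resol e N *m f) <=
    inprod (f + N *m w) (f + N *m w) + e * inprod w w.
Proof.
move=> e0; have u := resol_gram_unit N e0.
rewrite /resol -scalemxAl inprodZr; set h := invmx _ *m f.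
set g := f + N *m w.
have fE : f = resol_gram e N *m h by rewrite mulKVmx.
have q1 : inprod f h = inprod (cadj N *m h) (cadj N *m h) + e * inprod h h.
  by rewrite {1}fE inprodC resol_gram_quad.
have q2 : inprod f h = inprod g h - inprod w (cadj N *m h).
  by rewrite /g inprodDl inprod_mull addrK.
clearbody g h.
have s1 := inprod_ge0 (g - rC e *: h).
have s2 := inprod_ge0 (w + cadj N *m h).
move: s1 s2; rewrite !(inprodDl, inprodDr, inprodNl, inprodNr, inprodZl, inprodZr).
rewrite (inprodC h g) (inprodC (cadj N *m h) w) => s1 s2.
have := mulr_ge0 (ltW e0) s2.
move: (inprod f h) (inprod g g) (inprod g h) (inprod h h) (inprod w w)
  (inprod w (cadj N *m h)) (inprod (cadj N *m h) (cadj N *m h)) q1 q2 s1.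
move=> F G H K W V T q1 q2 s1 s3.
have E1 : e * F = e * H - e * V by rewrite q2 mulrBr.
have E2 : e * F = e * T + e * (e * K) by rewrite q1 mulrDr.
lra.
Qed.

(* With P the orthogonal projector onto the range of Y, use [retr_inv_ge] at Q = P / (2e). *)
Lemma resol_retr_near_kernel e n k (X : 'M[R[i]]_n) (Y : 'M[R[i]]_(n, k)) :
  0 < e -> cadj X = X ->
  (forall z : 'cV_k, Y *m z = 0 -> z = 0) ->
  (forall z : 'cV_k, inprod (X *m (Y *m z)) (X *m (Y *m z)) <=
                     e * inprod (Y *m z) (Y *m z)) ->
  k%:R / 2 <= retr (resol e X).
Proof.
move=> e0 hX injY hY.
set H := cadj Y *m Y.
have uH : H \in unitmx.
  apply: inj_unitmx => z Hz; apply: injY; apply: inprod_eq0.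
  by rewrite inprod_mull mulmxA -/H Hz inprod0r.
have hH : cadj H = H by rewrite /H cadjM cadjK.
set P := Y *m invmx H *m cadj Y.
have hP : cadj P = P by rewrite /P !cadjM cadjK cadj_invmx // mulmxA.
have PP : P *m P = P.
  by rewrite /P -!mulmxA (mulmxA (cadj Y)) -/H mulKmx.
have tP : retr P = k%:R.
  by rewrite /P retr_mulC mulmxA -/H mulmxV // retr1.
have rP (x : 'cV_n) : exists z, P *m x = Y *m z.
  by exists (invmx H *m cadj Y *m x); rewrite /P !mulmxA.
clearbody P.
have := resol_gram_quad e X; have := resol_gram_herm e X.
have := resol_gram_unit X e0.
have := fun x => resol_inv_ge0 X x e0.
rewrite /resol retrZ; move: (resol_gram e X) => B pB uB hB qB.
have tPBP : retr (P *m B *m P) <= 2 * e * k%:R.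
  rewrite -tP -[in leRHS]PP !retr_quad mulr_sumr; apply: ler_sum => i _.
  have flip (D : 'M[R[i]]_n) : inprod (ecol i) (P *m D *m P *m ecol i) =
      inprod (P *m ecol i) (D *m (P *m ecol i)).
    by rewrite -!mulmxA [in RHS]inprod_mull hP.
  have flip1 : inprod (ecol i) (P *m P *m ecol i) =
      inprod (P *m ecol i) (P *m ecol i).
    by rewrite -!mulmxA [in RHS]inprod_mull hP.
  rewrite flip flip1 qB hX.
  have [z ->] := rP (ecol i); rewrite -mulrA mulr_natl mulr2n.
  by rewrite lerD2r; exact: hY.
have := @retr_inv_ge _ B (rC (2 * e)^-1 *: P) hB.
rewrite cadjZ conj_rC hP => /(_ erefl uB pB).
rewrite -!scalemxAl -scalemxAr !retrZ tP => h.
rewrite -ler_pdivrMl //; apply: le_trans h.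
have e2 : 0 < (2 * e)^-1 by rewrite invr_gt0 mulr_gt0.
have -> : e^-1 * (k%:R / 2) =
    2 * ((2 * e)^-1 * k%:R) - (2 * e)^-1 * ((2 * e)^-1 * (2 * e * k%:R)).
  by field; rewrite gt_eqF.
rewrite lerD2l lerN2 !ler_wpM2l // ltW //.
Qed.

End Resolvent.

(** * Greedy choice of pivot columns *)

Definition dproj {R : realType} {n : nat} (s : seq 'I_n) : 'M[R[i]]_n :=
  diag_mx (\row_i (i \notin s)%:R).

Section GreedySelection.
Context {R : realType}.
Local Opaque resol.

Lemma dproj_coef n (s : seq 'I_n) p (x : 'M[R[i]]_(n, p)) i j :
  (dproj s *m x) i j = (i \notin s)%:R * x i j.
Proof. by rewrite /dproj mul_diag_mx !mxE. Qed.

Lemma cadj_dproj n (s : seq 'I_n) : cadj (dproj s) = dproj s :> 'M[R[i]]_n.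
Proof.
apply/matrixP => i j; rewrite cadjE !mxE eq_sym.
case: eqP => [->|_]; last by rewrite !mulr0n conjc0.
by rewrite !mulr1n conjc_nat.
Qed.

Lemma dproj_id n (s : seq 'I_n) p (x : 'M[R[i]]_(n, p)) :
  (forall i j, i \in s -> x i j = 0) -> dproj s *m x = x.
Proof.
move=> h; apply/matrixP => i j; rewrite dproj_coef.
by case: (boolP (i \in s)) => [/h->|_]; rewrite ?mul0r ?mul1r.
Qed.

Lemma dproj_le n (s : seq 'I_n) p (x : 'M[R[i]]_(n, p)) :
  inprod (dproj s *m x) (dproj s *m x) <= inprod x x.
Proof.
rewrite !inprodE; apply: ler_sum => i _; apply: ler_sum => j _.
rewrite dproj_coef; case: (i \notin s); first by rewrite mul1r.
by rewrite mul0r /= !mulr0 addr0 -!expr2 addr_ge0 ?sqr_ge0.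
Qed.

Lemma dproj_mul n (s t : seq 'I_n) : {subset s <= t} ->
  dproj s *m dproj t = dproj t :> 'M[R[i]]_n.
Proof.
move=> st; apply/matrixP => i j; rewrite dproj_coef !mxE.
case: (boolP (i \in s)) => [/st is_|_]; last by rewrite mul1r.
by rewrite is_ mul0r mul0rn.
Qed.

Lemma dproj_rcons n (s : seq 'I_n) i : i \notin s ->
  dproj s = dproj (rcons s i) + ecol i *m cadj (ecol i) :> 'M[R[i]]_n.
Proof.
move=> si; apply/matrixP => a b; rewrite !mxE big_ord1 cadjE !mxE !eqxx !andbT.
rewrite mem_rcons inE negb_or conjc_nat.
have [->|ab] := eqVneq a b; rewrite ?mulr1n ?mulr0n.
  case: (eqVneq b i) => [->|bi] /=; first by rewrite si mulr1 add0r.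
  by rewrite mul0r addr0.
have [ai|ai] := eqVneq a i; last by rewrite mul0r addr0.
by rewrite -ai eq_sym (negPf ab) mulr0 addr0.
Qed.

Lemma resol_retr_mulproj e n (X : 'M[R[i]]_n) (s : seq 'I_n) : 0 < e ->
  retr (resol e X) <= retr (resol e (X *m dproj s)).
Proof.
move=> e0; apply: (resol_retr_antitone e0) => x.
by rewrite cadjM cadj_dproj -mulmxA; exact: dproj_le.
Qed.

(** Deleting columns shrinks the Gram matrix and so raises the trace; rows are deleted by passing to
    the adjoint through [resol_retr_swap]. *)
Lemma resol_retr_compress e n (X : 'M[R[i]]_n) (s : seq 'I_n) : 0 < e ->
  retr (resol e X) <= retr (resol e (dproj s *m X *m dproj s)).
Proof.
move=> e0; apply: le_trans (resol_retr_mulproj _ _ e0).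
have := resol_retr_swap X e0; have := resol_retr_swap (dproj s *m X) e0.
rewrite cadjM cadj_dproj => h1 h2; rewrite -[leRHS]h1 -[leLHS]h2.
exact: resol_retr_mulproj.
Qed.

Lemma resol_fix e p q (N : 'M[R[i]]_(p, q)) (x : 'cV[R[i]]_p) : 0 < e ->
  cadj N *m x = 0 -> resol e N *m x = x.
Proof.
move=> e0 Nx.
have h : resol_gram e N *m x = rC e *: x.
  by rewrite /resol_gram mulmxDl -mulmxA Nx mulmx0 add0r mul_scalar_mx.
have /(congr1 (mulmx (resol e N))) := h.
rewrite mulmxA resol_mul_gram // mul_scalar_mx -scalemxAr.
have en0 : rC e != 0 by rewrite rC_eq0 gt_eqF.
by move=> /(congr1 ( *:%R (rC e)^-1)); rewrite !scalerA mulVf // !scale1r.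
Qed.

(** The resolvent [r] of the matrix without the columns in [s] fixes the coordinates in [s], which
    contribute fewer than [L] to its trace; hence some other diagonal entry rho exceeds (T - L) / n.
    The vector r e_i / rho minimizes the regularized form among vectors with i-th coordinate 1, with
    value e / rho. *)
Lemma greedy_step e n (X : 'M[R[i]]_n) (s : seq 'I_n) (T L : R) :
  0 < e -> (0 < n)%N -> uniq s -> (size s)%:R < L -> L < T ->
  T <= retr (resol e X) ->
  exists i, exists v : 'cV[R[i]]_n, [/\ i \notin s, v i 0 = 1,
    forall a, a \in s -> v a 0 = 0 &
    inprod (X *m v) (X *m v) + e * inprod v v <= e * n%:R / (T - L)].
Proof.
move=> e0 n0 us sL LT hT.
set N := X *m dproj s; set r := resol e (cadj N).
have hr : T <= retr r.
  have -> : retr r = retr (resol e N) by exact: resol_retr_swap.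
  by apply: le_trans hT _; apply: resol_retr_mulproj.
have rs a : a \in s -> r *m ecol a = ecol a.
  move=> sa; apply: resol_fix => //; rewrite cadjK /N -mulmxA.
  have -> : dproj s *m ecol a = 0 :> 'cV[R[i]]_n; last by rewrite mulmx0.
  apply/matrixP => i j; rewrite dproj_coef !mxE.
  have [->|_] := eqVneq i a; last by rewrite mulr0.
  by rewrite sa mul0r.
have [i si ri] : exists2 i, i \notin s &
    (T - L) / n%:R < inprod (ecol i) (r *m ecol i).
  apply: contrapT => hn.
  have : retr r <= (size s)%:R + (T - L).
    rewrite retr_quad (bigID (fun i => i \in s)) /=; apply: lerD.
      rewrite (eq_bigr (fun=> 1)) => [|a sa]; last first.
        by rewrite rs // inprod_ecol !mxE !eqxx.
      rewrite sumr_const ler_nat; have /card_uniqP <- := us.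
      by apply: eq_leq; apply: eq_card => a.
    apply: (@le_trans _ _ (\sum_(i < n) (T - L) / n%:R)).
      rewrite [leRHS](bigID (fun i => i \in s)) /= -[leLHS]add0r.
      apply: lerD; first by apply: sumr_ge0 => a _; rewrite divr_ge0 // subr_ge0 ltW.
      apply: ler_sum => a sa; rewrite leNgt; apply/negP => h.
      by apply: hn; exists a.
    by rewrite sumr_const card_ord -[_ *+ n]mulr_natr divfK // pnatr_eq0 -lt0n.
  move=> h; move: (le_trans hr h) sL; clear => h1 h2; lra.
set rho := inprod (ecol i) (r *m ecol i).
have rho0 : 0 < rho by apply: le_lt_trans ri; rewrite divr_ge0 // subr_ge0 ltW.
have hermr : cadj r = r by exact: resol_herm.
have rii : (r *m ecol i) i 0 = rC rho.
  apply: complex_ext; first by rewrite /rho inprod_ecol.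
  have := congr1 (fun M : 'M[R[i]]_n => complex.Im (M i i)) hermr.
  rewrite /= cadjE cIm_conj mul_ecolE ?Im_rC.
  by clear; lra.
exists i, (rC rho^-1 *: (r *m ecol i)); split => //.
- by rewrite mxE rii -rCM mulVf // gt_eqF.
- move=> a sa; rewrite mxE mul_ecolE -hermr cadjE.
  rewrite -(mul_ecolE r a i 0) rs // !mxE; have [ia|_] := eqVneq i a; first by rewrite ia sa in si.
  by rewrite conjc0 mulr0.
set v := _ *: _.
have Xv : X *m v = cadj (cadj N) *m v.
  rewrite cadjK /N -mulmxA dproj_id // => a j; rewrite ord1 => sa.
  rewrite mxE mul_ecolE -hermr cadjE.
  rewrite -(mul_ecolE r a i 0) rs // !mxE; have [ia|_] := eqVneq i a; first by rewrite ia sa in si.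
  by rewrite conjc0 mulr0.
rewrite Xv -resol_gram_quad /v -scalemxAr inprodZl inprodZr.
have -> : resol_gram e (cadj N) *m (r *m ecol i) = rC e *: ecol i.
  by rewrite mulmxA mul_resol_gram // mul_scalar_mx.
rewrite inprodZr inprodC -/rho.
have -> : rho^-1 * (rho^-1 * (e * rho)) = e / rho by field; rewrite gt_eqF.
have TL : 0 < T - L by rewrite subr_gt0.
rewrite -mulrA ler_pM2l // -[n%:R / _]invf_div lef_pV2 ?posrE //.
  exact: ltW.
by rewrite divr_gt0 // ltr0n.
Qed.

(** The vector [v] of step j is 1 at the new pivot and 0 at the earlier ones, so [v - ecol i] lives
    on the columns outside [take j.+1 s] and is a test vector for [resol_quad_min]. The rows of all
    pivots, not yet known at step j, can be deleted at the end because this only lowers the norm of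
    X v. *)
Lemma greedy_selection e n (X : 'M[R[i]]_n) (l : nat) (T : R) :
  0 < e -> (0 < n)%N -> cadj X = X -> l%:R < T -> T <= retr (resol e X) ->
  exists s : l.-tuple 'I_n, [/\ uniq s,
    T <= retr (resol e (dproj s *m X *m dproj s)) &
    forall j : 'I_l,
      inprod (dproj s *m X *m ecol (tnth s j))
        (resol e (dproj s *m X *m dproj (take j.+1 s)) *m
           (dproj s *m X *m ecol (tnth s j))) <= e * n%:R / (T - l%:R)].
Proof.
move=> e0 n0 hX lT hT.
suff [s us hs] : exists2 s : l.-tuple 'I_n, uniq s & forall j : 'I_l,
    exists v : 'cV[R[i]]_n, [/\ v (tnth s j) 0 = 1,
    forall a, a \in take j s -> v a 0 = 0 &
    inprod (X *m v) (X *m v) + e * inprod v v <= e * n%:R / (T - l%:R)].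
  exists s; split; first exact: us.
    by apply: le_trans hT _; exact: resol_retr_compress.
  move=> j; have [v [v1 v0 hv]] := hs j.
  set i := tnth s j in v1 *; set P := dproj (take j.+1 s).
  have dv : v - ecol i = P *m (v - ecol i).
    rewrite dproj_id // => a b; rewrite ord1.
    rewrite (take_nth i) ?size_tuple // mem_rcons inE.
    rewrite -(tnth_nth i s j) -/i => /orP[/eqP->|ha].
      by rewrite !mxE v1 !eqxx subrr.
    rewrite !mxE v0 //; have [ai|_] := eqVneq a i; last by rewrite subr0.
    move: ha; rewrite ai => /(nthP i)[c]; rewrite size_take size_tuple ltn_ord.
    move=> cj; rewrite nth_take // => E.
    have : nth i s c == nth i s j by rewrite E /i -tnth_nth.
    rewrite nth_uniq ?size_tuple //; last exact: ltn_trans cj _.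
    by move=> /eqP cjE; rewrite cjE ltnn in cj.
  apply: le_trans (resol_quad_min _ _ (v - ecol i) e0) _.
  apply: le_trans hv; apply: lerD.
    rewrite -!mulmxA -dv -!mulmxDr [ecol i + _]addrC subrK.
    exact: dproj_le.
  rewrite ler_wpM2l ?(ltW e0) //.
  have : v = (v - ecol i) + ecol i by rewrite subrK.
  have : inprod (v - ecol i) (ecol i) = 0.
    by rewrite inprodC inprod_ecol !mxE v1 !eqxx subrr.
  move: (v - ecol i) => w wi ->.
  rewrite !(inprodDl, inprodDr) (inprodC (ecol i)) wi addr0 add0r.
  by rewrite lerDl inprod_ge0.
have : forall j, (j <= l)%N -> exists s : seq 'I_n, [/\ uniq s, size s = j &
   forall a x0, (a < j)%N -> exists v : 'cV[R[i]]_n, [/\ v (nth x0 s a) 0 = 1,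
    forall b, b \in take a s -> v b 0 = 0 &
    inprod (X *m v) (X *m v) + e * inprod v v <= e * n%:R / (T - l%:R)]].
  elim => [|j IH] jl; first by exists [::].
  have [s [us ss hs]] := IH (ltnW jl).
  have sl : (size s)%:R < l%:R :> R by rewrite ss ltr_nat.
  have [i [v [si v1 v0 hv]]] := greedy_step e0 n0 us sl lT hT.
  exists (rcons s i); split; rewrite ?rcons_uniq ?us ?si ?size_rcons ?ss //.
  move=> a x0; rewrite ltnS leq_eqVlt => /orP[/eqP->|aj].
    exists v; split => //; first by rewrite nth_rcons ss ltnn eqxx.
    by move=> b; rewrite -cats1 take_cat ss ltnn subnn take0 cats0; exact: v0.
  have [v' [h1 h2 h3]] := hs a x0 aj; exists v'; split => //.
    by rewrite nth_rcons ss aj.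
  by move=> b; rewrite -cats1 take_cat ss aj; exact: h2.
move=> /(_ l (leqnn l))[s [us ss hs]].
have st : size s == l by apply/eqP.
exists (Tuple st) => // j.
have [v [h1 h2 h3]] := hs j (tnth (Tuple st) j) (ltn_ord j).
by exists v; split => //; rewrite (tnth_nth (tnth (Tuple st) j)).
Qed.

(** Putting back one column adds a rank-one term to the Gram matrix and lowers the trace by at most
    1; at most [size s] columns are put back. *)
Lemma resol_retr_proj_take e n (N : 'M[R[i]]_n) (s : seq 'I_n) j :
  0 < e -> uniq s ->
  retr (resol e (N *m dproj s)) - (size s)%:R <=
    retr (resol e (N *m dproj (take j s))).
Proof.
move=> e0 us; set g := fun t : seq 'I_n => retr (resol e (N *m dproj t)).
have step t i : i \notin t -> g (rcons t i) - 1 <= g t.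
  move=> it; apply: (@resol_retr_rank1 _ _ _ _ _ _ _ (N *m ecol i) e0).
  have S p (A : 'M[R[i]]_(n, p)) :
      N *m A *m cadj (N *m A) = N *m (A *m cadj A) *m cadj N.
    by rewrite cadjM !mulmxA.
  rewrite !S -mulmxDl -mulmxDr !cadj_dproj !dproj_mul //.
  by congr (_ *m _ *m _); exact: dproj_rcons.
suff h t d : uniq t -> (d <= size t)%N -> g t - d%:R <= g (take (size t - d) t).
  change (g s - (size s)%:R <= g (take j s)).
  have [js|js] := leqP (size s) j.
    by rewrite take_oversize // gerBl.
  apply: (@le_trans _ _ (g s - (size s - j)%:R)).
    by rewrite lerD2l lerN2 ler_nat leq_subr.
  by have := h s (size s - j)%N us (leq_subr _ _); rewrite subKn // ltnW.
clearbody g; elim: d t => [|d IH] t ut dt.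
  by rewrite subn0 take_size subr0.
case/lastP: t ut dt => [//|t i]; rewrite rcons_uniq size_rcons ltnS subSS.
move=> /andP[it ut] dt; rewrite -cats1 take_cat.
have -> : (if (size t - d < size t)%N then take (size t - d) t
    else t ++ take (size t - d - size t) [:: i]) = take (size t - d) t.
  case: ltnP => // h; rewrite (_ : (size t - d)%N = size t) ?subnn ?take0 ?cats0 ?take_size //.
  by apply/eqP; rewrite eqn_leq h leq_subr.
apply: le_trans (IH _ ut dt); rewrite cats1.
by have := step _ _ it; rewrite -natr1; lra.
Qed.

End GreedySelection.

(** * Hermitian matrices and determinants *)

Section HermitianSpectrum.
Context {R : realType}.

Lemma herm_spectral n (A : 'M[R[i]]_n) : cadj A = A ->
  exists U : 'M[R[i]]_n, exists d : 'I_n -> R,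
    [/\ U *m cadj U = 1%:M, cadj U *m U = 1%:M &
        A = cadj U *m diag_mx (\row_i rC (d i)) *m U].
Proof.
move=> hA.
have hs : A \is hermsymmx.
  apply/is_hermitianmxP; rewrite expr0 scale1r.
  by rewrite -[in LHS]hA /cadj map_trmx.
have Ad := orthomx_spectralP (hermitian_normalmx hs).
have Ur := hermitian_spectral_diag_real hs.
have Uu := spectral_unitarymx A.
have U1 : spectralmx A *m cadj (spectralmx A) = 1%:M.
  by move/unitarymxP: Uu; rewrite /cadj map_trmx.
exists (spectralmx A), (fun i => complex.Re (spectral_diag A 0 i)).
split; [exact: U1|exact: mulmx1C|].
have -> : cadj (spectralmx A) = invmx (spectralmx A).
  by rewrite invmx_unitary // /cadj map_trmx.
rewrite [LHS]Ad; congr (_ *m diag_mx _ *m _).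
apply/rowP => i; rewrite !mxE.
by have /mxOverP /(_ 0 i) /RRe_real := Ur.
Qed.

(** Bernoulli's inequality for exponents in [0,1], from convexity of [expR] between 0 and ln (1 +
    u). *)
Lemma bernoulli_expR (u d : R) : 0 <= u -> 0 <= d <= 1 ->
  expR (d * ln (1 + u)) <= 1 + u * d.
Proof.
move=> u0 /andP[d0 d1].
have := @convex_expR R (Itv01 d0 d1) (ln (1 + u)) 0.

rewrite !convRE /= expR0 mulr0 addr0 lnK ?posrE; last by rewrite ltr_pwDl.
rewrite /unstable.onem mulr1 => h; apply: le_trans h _.
by rewrite le_eqVlt; apply/orP; left; apply/eqP; ring.
Qed.


(** One block matrix is factored as lower times upper triangular and as upper times lower
    triangular. *)
Lemma det_sylvester (F : comPzRingType) m n (A : 'M[F]_(m, n)) (B : 'M[F]_(n, m)) :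
  \det (1%:M + A *m B) = \det (1%:M + B *m A).
Proof.
have e1 : block_mx 1%:M (- A) B 1%:M =
    block_mx 1%:M 0 B 1%:M *m block_mx 1%:M (- A) 0 (1%:M + B *m A).
  rewrite mulmx_block ?(mul1mx, mul0mx, mulmx0, mulmx1, addr0, add0r).
  by rewrite mulmxN addrCA addNr addr0.
have e2 : block_mx 1%:M (- A) B 1%:M =
    block_mx (1%:M + A *m B) (- A) 0 1%:M *m block_mx 1%:M 0 B 1%:M.
  rewrite mulmx_block ?(mul1mx, mul0mx, mulmx0, mulmx1, addr0, add0r).
  by rewrite mulNmx addrK.
have := congr1 determinant e1; rewrite {1}e2 !det_mulmx.
by rewrite !det_ublock !det_lblock !det1 !mulr1 !mul1r.
Qed.

End HermitianSpectrum.

(** * Determinants by successive rank-one pivots *)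

Definition sproj {R : realType} {n : nat} (s : seq 'I_n) : 'M[R[i]]_n :=
  diag_mx (\row_i (i \in s)%:R).

Definition dentry {R : realType} {n : nat} (B : 'M[R[i]]_n) (b : 'I_n) : R :=
  inprod (ecol b) (B *m ecol b).

(* (B^-1 + u e_b e_b^* )^-1 when B is invertible *)
Definition rank1_upd {R : realType} {n : nat} (u : R) (B : 'M[R[i]]_n) (b : 'I_n) :
  'M[R[i]]_n :=
  B - rC (u / (1 + u * dentry B b)) *: (B *m ecol b *m cadj (B *m ecol b)).

(** This is det (1 + u P_s B) evaluated by elimination ([det_pivot_prod]). The factor 1 + u B_bb is
    the inverse square of what integrating one Gaussian parameter at coordinate b contributes, and
    the update of [B] is the effect of that integration on the quadratic form. *)
Fixpoint pivot_prod {R : realType} {n : nat} (u : R) (B : 'M[R[i]]_n)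
  (s : seq 'I_n) : R :=
  if s is b :: s' then (1 + u * dentry B b) * pivot_prod u (rank1_upd u B b) s'
  else 1.

Section PivotProduct.
Context {R : realType}.
Implicit Types (u : R).

Lemma retr_sproj n (B : 'M[R[i]]_n) (s : seq 'I_n) :
  retr (sproj s *m B) = \sum_(b | b \in s) dentry B b.
Proof.
rewrite retrE [RHS]big_mkcond; apply: eq_bigr => b _.
rewrite /sproj mul_diag_mx !mxE /dentry inprod_ecol mul_ecolE.
by case: (b \in s); rewrite ?mul1r ?mul0r.
Qed.

Lemma sproj_cons n (s : seq 'I_n) b : b \notin s ->
  sproj (b :: s) = ecol b *m cadj (ecol b) + sproj s :> 'M[R[i]]_n.
Proof.
move=> sb; apply/matrixP => i j; rewrite !mxE big_ord1 cadjE !mxE !eqxx !andbT.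
rewrite inE conjc_nat.
have [->|ij] := eqVneq i j; rewrite ?mulr1n ?mulr0n.
  have [->|jb] := eqVneq j b; first by rewrite (negPf sb) mulr1 addr0.
  by rewrite mul0r add0r.
have [ib|ib] := eqVneq i b; last by rewrite mul0r addr0.
by rewrite -ib eq_sym (negPf ij) mulr0 addr0.
Qed.

Lemma sproj_idem n (s : seq 'I_n) : sproj s *m sproj s = sproj s :> 'M[R[i]]_n.
Proof.
apply/matrixP => i j; rewrite /sproj mul_diag_mx !mxE.
by case: (i \in s); rewrite ?mul1r ?mul0r ?mul0rn.
Qed.

Lemma cadj_sproj n (s : seq 'I_n) : cadj (sproj s) = sproj s :> 'M[R[i]]_n.
Proof.
apply/matrixP => i j; rewrite cadjE !mxE eq_sym.
case: eqP => [->|_]; last by rewrite !mulr0n conjc0.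
by rewrite !mulr1n conjc_nat.
Qed.

Lemma herm_quad11 n (B : 'M[R[i]]_n) b : cadj B = B ->
  cadj (ecol b) *m (B *m ecol b) = (rC (dentry B b))%:M.
Proof.
move=> hB; set z := _ *m _.
have hz : cadj z = z by rewrite /z cadjM cadjM cadjK hB mulmxA.
apply/matrixP => i j; rewrite !ord1 [RHS]mxE eqxx mulr1n.
apply: complex_ext; first by rewrite /dentry /inprod trace_mx11.
move/matrixP: hz => /(_ 0 0); rewrite cadjE => /(congr1 (@complex.Im R)).
by rewrite cIm_conj Im_rC; clear; lra.
Qed.

Lemma rank1_upd_herm n u (B : 'M[R[i]]_n) b : cadj B = B ->
  cadj (rank1_upd u B b) = rank1_upd u B b.
Proof.
by move=> hB; rewrite /rank1_upd cadjB cadjZ conj_rC [cadj (_ *m cadj _)]cadjM cadjK hB.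
Qed.

Lemma rank1_upd_quad n u (B : 'M[R[i]]_n) b (x : 'cV_n) :
  inprod x (rank1_upd u B b *m x) = inprod x (B *m x) -
    u / (1 + u * dentry B b) *
      inprod (cadj (B *m ecol b) *m x) (cadj (B *m ecol b) *m x).
Proof.
rewrite /rank1_upd; move: (B *m ecol b) (_ / _) => w t.
by rewrite mulmxBl inprodBr -scalemxAl inprodZr -mulmxA [in RHS]inprod_mull cadjK.
Qed.

(** Positivity of [B] is tested at x - t e_b z with z = (B x)_b and t = u / (1 + u B_bb); what is
    left over, t |z|^2 (1 - t B_bb), is nonnegative because t B_bb <= 1. *)
Lemma rank1_upd_ge0 n u (B : 'M[R[i]]_n) b : 0 <= u -> cadj B = B ->
  (forall x : 'cV_n, 0 <= inprod x (B *m x)) ->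
  forall x : 'cV_n, 0 <= inprod x (rank1_upd u B b *m x).
Proof.
move=> u0 hB pB x; rewrite rank1_upd_quad.
set t := u / _; set z := cadj _ *m x.
have d0 : 0 <= dentry B b by exact: pB.
have a1 : 0 < 1 + u * dentry B b by rewrite ltr_pwDl // mulr_ge0.
have t0 : 0 <= t by rewrite divr_ge0 // ltW.
have td : t * dentry B b <= 1.
  by rewrite /t mulrAC ler_pdivrMr // mul1r; lra.
have zE : z = cadj (ecol b) *m (B *m x) by rewrite /z cadjM hB mulmxA.
have := pB (x - rC t *: (ecol b *m z)).
rewrite mulmxBr -scalemxAr !(inprodDl, inprodDr, inprodNl, inprodNr, inprodZl, inprodZr).
have -> : inprod x (B *m (ecol b *m z)) = inprod z z.
  by rewrite mulmxA inprodC inprod_mull.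
have -> : inprod (ecol b *m z) (B *m x) = inprod z z.
  by rewrite inprod_mull -zE.
have -> : inprod (ecol b *m z) (B *m (ecol b *m z)) = dentry B b * inprod z z.
  rewrite inprod_mull (mulmxA B) mulmxA herm_quad11 //.
  by rewrite mul_scalar_mx inprodZr.
have z0 := inprod_ge0 z.
have := mulr_ge0 (mulr_ge0 t0 z0) (_ : 0 <= 1 - t * dentry B b).
rewrite subr_ge0 => /(_ td).
move: (inprod x (B *m x)) (inprod z z) (dentry B b) => q Z d; clear; lra.
Qed.

(** With B' the update at b and M = 1 + u e_b e_b^* B one has B' M = B, so that the matrix for b ::
    s factors as (1 + u P_s B') M; Sylvester's identity gives det M = 1 + u B_bb. *)
Lemma det_pivot_prod n u (B : 'M[R[i]]_n) (s : seq 'I_n) : 0 <= u ->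
  cadj B = B -> (forall x : 'cV_n, 0 <= inprod x (B *m x)) -> uniq s ->
  \det (1%:M + rC u *: (sproj s *m B)) = rC (pivot_prod u B s).
Proof.
move=> u0; elim: s B => [|b s IH] B hB pB /= us.
  have -> : sproj [::] = 0 :> 'M[R[i]]_n.
    by apply/matrixP => i j; rewrite !mxE in_nil mul0rn.
  by rewrite mul0mx scaler0 addr0 det1.
case/andP: us => sb us.
rewrite rCM -IH //; [|exact: rank1_upd_herm|exact: rank1_upd_ge0].
have d0 : 0 <= dentry B b by exact: pB.
have a1 : 0 < 1 + u * dentry B b by rewrite ltr_pwDl // mulr_ge0.
set M := 1%:M + rC u *: (ecol b *m cadj (ecol b) *m B).
have detM : \det M = rC (1 + u * dentry B b).
  rewrite /M -mulmxA scalemxAl det_sylvester -mulmxA -scalemxAr -scalemxAr herm_quad11 //.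
  by rewrite det_mx11 !mxE eqxx !mulr1n -rCM -rC1 -rCD.
rewrite -detM mulrC -det_mulmx; congr (\det _).
rewrite mulmxDl mul1mx -scalemxAl -mulmxA.
have -> : rank1_upd u B b *m M = B.
  set Z := B *m ecol b *m cadj (B *m ecol b).
  have e1 : B *m M = B + rC u *: Z.
    by rewrite /M mulmxDr mulmx1 -scalemxAr /Z cadjM hB !mulmxA.
  have e2 : Z *m M = rC (1 + u * dentry B b) *: Z.
    rewrite /M mulmxDr mulmx1 -scalemxAr rCD rC1 scalerDl scale1r.
    rewrite rCM -scalerA; congr (_ + _ *: _).
    rewrite /Z cadjM hB -!mulmxA (mulmxA (cadj (ecol b)) B) (mulmxA _ (ecol b)).
    rewrite -(mulmxA (cadj (ecol b)) B) herm_quad11 // mul_scalar_mx.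
    by rewrite -!scalemxAr.
  rewrite /rank1_upd -/Z mulmxBl e1 -scalemxAl e2 scalerA -rCM divfK ?gt_eqF //.
  by rewrite addrK.
by rewrite /M (sproj_cons sb) mulmxDl scalerDr addrA.
Qed.

(** The eigenvalues d_i of P_s B P_s lie in [0,1], so each factor 1 + u d_i of the determinant is at
    least (1 + u)^d_i, and the d_i add up to the trace of P_s B. From here on only a trace has to be
    controlled. *)
Lemma pivot_prod_ge n u (B : 'M[R[i]]_n) (s : seq 'I_n) : 0 <= u ->
  cadj B = B -> (forall x : 'cV_n, 0 <= inprod x (B *m x)) ->
  (forall x : 'cV_n, inprod x (B *m x) <= inprod x x) -> uniq s ->
  expR (retr (sproj s *m B) * ln (1 + u)) <= pivot_prod u B s.
Proof.
move=> u0 hB pB B1 us.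
set A := sproj s *m B *m sproj s.
have hA : cadj A = A by rewrite /A !cadjM cadj_sproj hB mulmxA.
have trA : retr A = retr (sproj s *m B).
  by rewrite /A retr_mulC mulmxA sproj_idem.
have detA : \det (1%:M + rC u *: (sproj s *m B)) = \det (1%:M + rC u *: A).
  rewrite -{1}[sproj s]sproj_idem -mulmxA scalemxAl det_sylvester.
  by rewrite -scalemxAr.
have := det_pivot_prod u0 hB pB us; rewrite detA.
have [U [d [UU U1 AE]]] := herm_spectral hA.
have dA i : d i = inprod (cadj U *m ecol i) (A *m (cadj U *m ecol i)).
  rewrite {1}AE -!mulmxA (mulmxA U) UU mul1mx inprod_mull cadjK mulmxA UU mul1mx.
  rewrite inprod_ecol mul_diag_mx !mxE eqxx.
  by rewrite cReM /= mulr1 mul0r subr0.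
have dAB i : d i = inprod (sproj s *m (cadj U *m ecol i))
    (B *m (sproj s *m (cadj U *m ecol i))).
  by rewrite dA /A -!mulmxA [in RHS]inprod_mull cadj_sproj.
have sle (x : 'cV[R[i]]_n) : inprod (sproj s *m x) (sproj s *m x) <= inprod x x.
  rewrite !inprodE; apply: ler_sum => i _; apply: ler_sum => j _.
  rewrite /sproj mul_diag_mx !mxE; case: (i \in s); first by rewrite mul1r.
  by rewrite mul0r /= !mulr0 addr0 -!expr2 addr_ge0 ?sqr_ge0.
have d01 i : 0 <= d i <= 1.
  rewrite dAB pB /=; apply: le_trans (B1 _) _; apply: le_trans (sle _) _.
  by rewrite inprod_mull cadjK mulmxA UU mul1mx inprod_ecol mxE !eqxx.
have detE : \det (1%:M + rC u *: A) = rC (\prod_i (1 + u * d i)).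
  have -> : 1%:M + rC u *: A =
      cadj U *m diag_mx (\row_i rC (1 + u * d i)) *m U.
    have -> : diag_mx (\row_i rC (1 + u * d i)) =
        1%:M + rC u *: diag_mx (\row_i rC (d i)).
      apply/matrixP => i j; rewrite !mxE; have [_|_] := eqVneq i j.
        by rewrite !mulr1n rCD rCM.
      by rewrite !mulr0n mulr0 addr0.
    by rewrite mulmxDr mulmxDl mulmx1 U1 -scalemxAr -scalemxAl -AE.
  rewrite !det_mulmx mulrAC -det_mulmx U1 det1 mul1r det_diag.
  rewrite (big_morph _ rCM rC1); apply: eq_bigr => i _; by rewrite mxE.
rewrite detE => /rC_inj <-.
have -> : retr (sproj s *m B) = \sum_i d i.
  rewrite -trA AE retr_mulC mulmxA UU mul1mx retrE.
  by apply: eq_bigr => i _; rewrite !mxE eqxx mulr1n.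
rewrite mulr_suml expR_sum; apply: ler_prod => i _.
by rewrite expR_ge0 /= bernoulli_expR.
Qed.

End PivotProduct.

(** * Gaussian integrals *)

Section Density.
Local Open Scope ereal_scope.
Context d (T : measurableType d) (R : realType).
Variables (mu nu : {measure set T -> \bar R}) (g : T -> R).
Hypotheses (mg : measurable_fun setT g) (g0 : forall x, (0 <= g x)%R).
Hypothesis nuE : forall A, measurable A -> nu A = \int[mu]_(x in A) (g x)%:E.

Import HBNNSimple.

Let density_indic E : measurable E ->
  \int[nu]_x (\1_E x)%:E = \int[mu]_x ((\1_E x)%:E * (g x)%:E).
Proof.
move=> mE; rewrite integral_indic // setIT nuE // integral_mkcond.
apply: eq_integral => x _; rewrite patchE indicE.
by case: ifPn => xE; rewrite ?mul1e ?mul0e.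
Qed.

Let density_nnsfun (f : {nnsfun T >-> R}) :
  \int[nu]_x (f x)%:E = \int[mu]_x ((f x)%:E * (g x)%:E).
Proof.
under [LHS]eq_integral do rewrite fimfunE -fsumEFin//.
rewrite [LHS]ge0_integral_fsum//; last 2 first.
  - by move=> r; exact/measurable_EFinP/measurableT_comp.
  - by move=> n x _; rewrite EFinM nnfun_muleindic_ge0.
under [RHS]eq_integral.
  move=> x xD; rewrite fimfunE -fsumEFin// ge0_mule_fsuml; last first.
    by move=> r; rewrite EFinM nnfun_muleindic_ge0.
  over.
rewrite [RHS]ge0_integral_fsum//; last 2 first.
  - move=> r; apply: emeasurable_funM; last exact/measurable_EFinP.
    by apply/measurable_EFinP/measurableT_comp.
  - by move=> r x _; rewrite mule_ge0 ?lee_fin// -lee_fin EFinM nnfun_muleindic_ge0.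
apply: eq_fsbigr => r _.
under [RHS]eq_integral do rewrite EFinM -muleA.
rewrite integralZl_indic_nnsfun//= density_indic //.
(* A nonnegative simple function does not take a negative value [r]; its preimage is empty and both
   sides vanish. *)
have [r0|r0] := leP 0%R r.
  rewrite ge0_integralZl// ?lee_fin//.
    apply: emeasurable_funM; last exact/measurable_EFinP.
    exact/measurable_EFinP/measurable_indic.
  by move=> x _; rewrite mule_ge0 ?lee_fin.
rewrite preimage_nnfun0// integral0_eq; last by move=> x _; rewrite indic0 mul0e.
by rewrite mule0 integral0_eq// => x _; rewrite indic0 mul0e mule0.
Qed.

Lemma ge0_integral_density (f : T -> \bar R) :
  measurable_fun setT f -> (forall x, 0 <= f x) ->
  \int[nu]_x f x = \int[mu]_x (f x * (g x)%:E).
Proof.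
move=> mf f0.
pose f_ := nnsfun_approx measurableT mf.
transitivity (lim (\int[nu]_x (f_ n x)%:E @[n --> \oo])).
  rewrite -monotone_convergence//=.
  - apply: eq_integral => ? /[!inE] xD; apply/esym/cvg_lim => //=.
    exact: cvg_nnsfun_approx.
  - by move=> n; exact/measurable_EFinP/measurable_funTS.
  - by move=> n ? _; rewrite lee_fin.
  - by move=> ? _ ? ? mn; rewrite lee_fin; exact/lefP/nd_nnsfun_approx.
transitivity (lim (\int[mu]_x ((f_ n x)%:E * (g x)%:E) @[n --> \oo])).
  by apply: congr_lim; apply/funext => n /=; exact: density_nnsfun.
rewrite -monotone_convergence//=.
- apply: eq_integral => x _; apply/cvg_lim => //; rewrite muleC.
  under eq_cvg do rewrite muleC.
  by apply: cvgeZl => //; exact: cvg_nnsfun_approx.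
- move=> n; apply: emeasurable_funM; last exact/measurable_EFinP.
  exact/measurable_EFinP/measurable_funTS.
- by move=> n x _; rewrite mule_ge0 ?lee_fin.
- move=> x _ m n mn; rewrite lee_wpmul2r ?lee_fin//.
  exact/lefP/nd_nnsfun_approx.
Qed.

End Density.

Section GaussianIntegral.
Context {R : realType}.

(** Exponent of exp (- (a x^2 + b x)) times a centred Gaussian of variance [u], with a = (q - 1) /
    (2 u): again Gaussian, of variance u / q and mean - b u / q. *)
Lemma complete_square (x b u q : R) : u != 0 -> q != 0 ->
  - ((q - 1) / (2 * u) * x ^+ 2 + b * x) + - x ^+ 2 / (u * 2) =
  b ^+ 2 * u / (2 * q) + - (x - - b * (u / q)) ^+ 2 / (u / q * 2).
Proof. by move=> u0 q0; field; rewrite u0 q0. Qed.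

(** The integrand times the density [normal_pdf 0 s] is a constant times the density
    [normal_pdf m' s']; the constant is the ratio of the two peaks times the term left over by
    [complete_square]. *)
Lemma normal_prob_exp_quad (s a b : R) : 0 < s -> 0 <= a ->
  (\int[normal_prob 0 s]_y (expR (- (a * y ^+ 2 + b * y)))%:E =
  ((Num.sqrt (1 + 2 * a * s ^+ 2))^-1 *
    expR (b ^+ 2 * s ^+ 2 / (2 * (1 + 2 * a * s ^+ 2))))%:E)%E.
Proof.
move=> s0 a0.
set q := 1 + 2 * a * s ^+ 2.
have q0 : 0 < q by have := mulr_ge0 a0 (sqr_ge0 s); rewrite /q; lra.
have sq0 : 0 < Num.sqrt q by rewrite sqrtr_gt0.
have qE : Num.sqrt q ^+ 2 = q by rewrite sqr_sqrtr // ltW.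
set s' := s / Num.sqrt q; have s'0 : 0 < s' by rewrite divr_gt0.
set m' := - b * s' ^+ 2.
set k := (Num.sqrt q)^-1 * _.
have sn : s != 0 by rewrite gt_eqF.
have s'n : s' != 0 by rewrite gt_eqF.
rewrite (@ge0_integral_density _ _ _ lebesgue_measure _ (normal_pdf 0 s)) //.
- transitivity (\int[lebesgue_measure]_x (k%:E * (normal_pdf m' s' x)%:E))%E.
    apply: eq_integral => x _; rewrite -!EFinM; congr (_%:E).
    rewrite !normal_pdfE // /normal_fun.
    have -> : normal_peak s = normal_peak s' * (Num.sqrt q)^-1.
      rewrite /normal_peak.
      have -> : s ^+ 2 * pi *+ 2 = (s' ^+ 2 * pi *+ 2) * q.
        by rewrite /s' expr_div_n qE; field; rewrite gt_eqF.
      by rewrite sqrtrM ?invfM // mulrn_wge0 // mulr_ge0 ?sqr_ge0 // pi_ge0.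
    set e1 := expR (- (_ + _)); set e2 := expR (_ / _); set e3 := expR (_ / _).
    set p := normal_peak s'.
    have E : e1 * e2 = expR (b ^+ 2 * s ^+ 2 / (2 * q)) * e3.
      rewrite -!expRD; congr expR.
      rewrite /m' /s' expr_div_n qE subr0.
      rewrite -(mulr_natr (s ^+ 2)) -(mulr_natr (s ^+ 2 / q)).
      have uE : a = (q - 1) / (2 * s ^+ 2) by rewrite /q; field.
      rewrite uE; apply: complete_square; last by rewrite gt_eqF.
      by rewrite sqrf_eq0.
    rewrite /k; transitivity ((Num.sqrt q)^-1 * p * (e1 * e2)); first by ring.
    by rewrite E; ring.
  rewrite ge0_integralZl //.
  + by rewrite integral_normal_pdf mule1.
  + by apply/measurable_EFinP; exact: measurable_normal_pdf.
  + by move=> x _; rewrite lee_fin normal_pdf_ge0.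
  + by rewrite lee_fin mulr_ge0 ?expR_ge0 // invr_ge0 ltW.
- exact: measurable_normal_pdf.
- by move=> x; exact: normal_pdf_ge0.
- apply/measurable_EFinP; apply: measurableT_comp => //.
  apply: measurable_funN; apply: measurable_funD.
    by apply: measurable_funM => //; exact: measurable_funX.
  by apply: measurable_funM.
Qed.

End GaussianIntegral.

(** * Integrating independent variables one at a time *)

Definition upd {R : realType} {I : eqType} (x : I -> R) (i : I) (y : R) : I -> R :=
  fun j => if j == i then y else x j.

(** The product sigma-algebra is taken on tuples along the enumeration of [I]; measurability of
    functions of a family, as in [vmeas], is tested through this reading of a tuple. *)
Definition tupfun {R : realType} {I : finType} (t : #|I|.-tuple (measurableTypeR R)) : I -> R :=
  fun i => tnth t (enum_rank i).

Definition vmeas {R : realType} {I : finType} {d} {S : measurableType d}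
  (h : (I -> R) -> S) : Prop :=
  measurable_fun [set: #|I|.-tuple (measurableTypeR R)] (fun t => h (tupfun t)).

Definition Int1 {R : realType} {I : eqType} (mu : I -> probability (measurableTypeR R) R) (i : I)
  (h : (I -> R) -> \bar R) : (I -> R) -> \bar R :=
  fun x => (\int[mu i]_y h (upd x i y))%E.

(* the head of the list is integrated first *)
Fixpoint IntL {R : realType} {I : eqType} (mu : I -> probability (measurableTypeR R) R) (s : seq I)
  (h : (I -> R) -> \bar R) : (I -> R) -> \bar R :=
  if s is i :: s' then IntL mu s' (Int1 mu i h) else h.

Section IndependentCoordinates.
Context {R : realType} {I : finType}.
Implicit Types (h : (I -> R) -> \bar R).

Let updt (i : I) (p : #|I|.-tuple (measurableTypeR R) * measurableTypeR R) : #|I|.-tuple (measurableTypeR R) :=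
  [tuple if enum_val j == i then p.2 else tnth p.1 j | j < #|I|].

Let updtE i p : tupfun (updt i p) = upd (tupfun p.1) i p.2.
Proof.
by apply/funext => j; rewrite /tupfun /updt tnth_mktuple enum_rankK.
Qed.

Let measurable_updt i : measurable_fun setT (updt i).
Proof.
apply/measurable_fun_tnthP => j.
have [ji|ji] := eqVneq (enum_val j) i.
  rewrite (_ : _ \o _ = snd) //; apply/funext => p /=.
  by rewrite tnth_mktuple ji eqxx.
rewrite (_ : _ \o _ = (@tnth _ (measurableTypeR R) ^~ j) \o fst).
  by apply: measurableT_comp => //; exact: measurable_tnth.
by apply/funext => p /=; rewrite tnth_mktuple (negPf ji).
Qed.

Lemma Int1_ge0 (mu : I -> probability (measurableTypeR R) R) i h : (forall x, (0 <= h x)%E) ->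
  forall x, (0 <= Int1 mu i h x)%E.
Proof. by move=> h0 x; apply: integral_ge0. Qed.

Lemma vmeas_upd i y {d'} {S : measurableType d'} (h : (I -> R) -> S) : vmeas h ->
  vmeas (fun x => h (upd x i y)).
Proof.
move=> mh; rewrite /vmeas.
have mp : measurable_fun setT (fun t : #|I|.-tuple (measurableTypeR R) => (t, y)).
  exact: measurable_pair2.
have := measurableT_comp mh (measurableT_comp (measurable_updt i) mp).
by apply: eq_measurable_fun => t _ /=; rewrite updtE.
Qed.

Lemma vmeas_slice i x h : vmeas h -> measurable_fun setT (fun y : measurableTypeR R => h (upd x i y)).
Proof.
move=> mh.
pose t : #|I|.-tuple (measurableTypeR R) := [tuple x (enum_val j) | j < #|I|].
have mp : measurable_fun setT (fun y : measurableTypeR R => (t, y)) by exact: measurable_pair1.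
have := measurableT_comp mh (measurableT_comp (measurable_updt i) mp).
apply: eq_measurable_fun => y _ /=; rewrite updtE; congr h; congr upd.
by apply/funext => j; rewrite /tupfun tnth_mktuple enum_rankK.
Qed.

Lemma le_Int1 (mu : I -> probability (measurableTypeR R) R) i h h' x : vmeas h -> vmeas h' ->
  (forall y, (0 <= h y)%E) -> (forall y, (h y <= h' y)%E) ->
  (Int1 mu i h x <= Int1 mu i h' x)%E.
Proof.
move=> mh mh' h0 hh'; rewrite /Int1; apply: ge0_le_integral => //.
- exact: vmeas_slice.
- exact: vmeas_slice.
Qed.

Lemma vmeas_Int1 (mu : I -> probability (measurableTypeR R) R) i h : vmeas h ->
  (forall x, (0 <= h x)%E) -> vmeas (Int1 mu i h).
Proof.
move=> mh h0; rewrite /vmeas /Int1.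
have mf : measurable_fun setT (fun p => h (tupfun (updt i p))).
  exact: (measurableT_comp mh (measurable_updt i)).
have := @measurable_fun_fubini_tonelli_F _ _ _ _ _ (mu i) _ mf (fun=> h0 _).
rewrite /fubini_F; apply: eq_measurable_fun => t _ /=.
by apply: eq_integral => y _; rewrite updtE.
Qed.

Context d (T : measurableType d) (P : probability T R) (X : I -> T -> R)
  (mu : I -> probability (measurableTypeR R) R).
Hypothesis indX : indep_rvs P X.
Hypothesis lawX : forall i B, measurable B -> P (X i @^-1` B) = mu i B.

Let Xt (w : T) : #|I|.-tuple (measurableTypeR R) := [tuple X (enum_val j) w | j < #|I|].

Let XtE w : tupfun (Xt w) = X ^~ w.
Proof. by apply/funext => i; rewrite /tupfun tnth_mktuple enum_rankK. Qed.

Let measurable_Xt : measurable_fun setT Xt.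
Proof.
apply/measurable_fun_tnthP => j.
rewrite (_ : _ \o _ = X (enum_val j)); first by move=> mT B mB; exact: (proj1 indX _ mT B mB).
by apply/funext => w /=; rewrite tnth_mktuple.
Qed.

Lemma vmeas_comp d' (S : measurableType d') (h : (I -> R) -> S) : vmeas h ->
  measurable_fun setT (fun w => h (X ^~ w)).
Proof.
move=> mh; have := measurableT_comp mh measurable_Xt.
by apply: eq_measurable_fun => w _ /=; rewrite XtE.
Qed.

(** A pi-system generating the product sigma-algebra, on which independence and the marginals
    determine the joint law. *)
Let boxes : set (set (#|I|.-tuple (measurableTypeR R))) :=
  [set A | exists B : I -> set R, (forall i, measurable (B i)) /\
     A = [set t | forall i, B i (tupfun t i)]].

Let boxes_gen : @measurable _ (#|I|.-tuple (measurableTypeR R)) = <<s boxes >>.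
Proof.
apply/seteqP; split.
  apply: smallest_sub; first exact: smallest_sigma_algebra.
  move=> A; rewrite -bigcup_seq => -[j /= _ [B mB <-]].
  apply: sub_sigma_algebra.
  exists (fun i => if i == enum_val j then B else setT); split.
    by move=> i; case: ifP => // _; exact: measurableT.
  apply/seteqP; split => t /=.
    move=> [_ Bt] i; case: eqP => // ->.
    by rewrite /tupfun enum_valK.
  by move=> /(_ (enum_val j)); rewrite eqxx /tupfun enum_valK.
apply: smallest_sub; first exact: sigma_algebra_measurable.
move=> A [B [mB ->]].
rewrite (_ : mkset _ = \bigcap_(i in [set: I]) [set t | B i (tupfun t i)]); last first.
  by apply/seteqP; split => t /= h i; [move=> _; exact: h|exact: h].
apply: fin_bigcap_measurable => // i _.
rewrite -[X in measurable X]setTI.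
exact: (measurable_tnth (T := measurableTypeR R) (enum_rank i) measurableT (mB i)).
Qed.

Let boxesI : setI_closed boxes.
Proof.
move=> _ _ [B [mB ->]] [B' [mB' ->]].
exists (fun i => B i `&` B' i); split; first by move=> i; exact: measurableI.
apply/seteqP; split => t /=; first by move=> [h h'] i; split.
by move=> h; split => i; have [] := h i.
Qed.

Let Xm : {mfun T >-> #|I|.-tuple (measurableTypeR R)} :=
  HB.pack Xt (isMeasurableFun.Build _ _ _ _ Xt measurable_Xt).

Let um i : {mfun (#|I|.-tuple (measurableTypeR R) * measurableTypeR R)%type >-> #|I|.-tuple (measurableTypeR R)} :=
  HB.pack (updt i) (isMeasurableFun.Build _ _ _ _ (updt i) (measurable_updt i)).

Let nu : probability (#|I|.-tuple (measurableTypeR R)) R := distribution P Xm.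

Let nu_box (B : I -> set R) : (forall i, measurable (B i)) ->
  nu [set t | forall i, B i (tupfun t i)] = (\prod_i mu i (B i))%E.
Proof.
move=> mB; have [_ h] := indX; rewrite /nu /= /distribution /pushforward.
rewrite (_ : _ @^-1` _ = \bigcap_i (X i @^-1` B i)).
  by rewrite h //; apply: eq_bigr => i _; exact: lawX.
by apply/seteqP; split => w /= hw i; have := hw i; rewrite XtE //; apply.
Qed.

(** Law of the vector after coordinate [i] has been replaced by an independent sample of [mu i]. *)
Let nu2 i : probability (#|I|.-tuple (measurableTypeR R)) R :=
  distribution ((nu \x mu i)%E : probability _ R) (um i).

Let nu2E i A : measurable A -> nu A = nu2 i A.
Proof.
apply: (measure_unique boxes (fun=> setT)) => //.
- by move=> _; exists (fun=> setT); split => //; apply/seteqP; split.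
- by rewrite bigcup_const.
- move=> _ [B [mB ->]]; apply: etrans (nu_box mB) _.
  rewrite /nu2 /= /distribution /pushforward.
  set B' := fun j => if j == i then setT else B j.
  (* After resampling, the old value at [i] is unconstrained and the condition [B i] falls on the
     new value. *)
  have mB' j : measurable (B' j) by rewrite /B'; case: ifP => // _; exact: mB.
  rewrite (_ : _ @^-1` _ = [set t | forall j, B' j (tupfun t j)] `*` B i).
    have mbox : measurable [set t | forall j, B' j (tupfun t j)].
      by rewrite boxes_gen; apply: sub_sigma_algebra; exists B'.
    apply/esym; apply: etrans (product_measure1E nu (mu i) mbox (mB i)) _.
    transitivity ((\prod_j mu j (B' j)) * mu i (B i))%E.
      by congr (_ * _)%E; exact: nu_box.
    rewrite [in RHS](bigD1 i) //= (bigD1 i) //= {1}/B' eqxx.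
    rewrite probability_setT mul1e muleC; congr (_ * _)%E.
    by apply: eq_bigr => j /negPf ji; rewrite /B' ji.
  apply/seteqP; split => -[t y] /=.
    move=> h; split.
      move=> j; rewrite /B'; case: eqP => // /eqP ji.
      by have := h j; rewrite updtE /upd (negPf ji).
    by have := h i; rewrite updtE /upd eqxx.
  move=> [h hy] j; rewrite updtE /upd; case: eqP => [->//|/eqP ji].
  by have := h j; rewrite /B' (negPf ji).
- move=> _; exact: le_lt_trans (probability_le1 nu measurableT) (ltry 1).
Qed.

(** Resampling one coordinate leaves the joint law unchanged ([nu2E]); Tonelli on the pair of old
    vector and new value then exhibits the integral over that value. The joint law is never expanded
    as an iterated product. *)
Lemma expectation_Int1 i h : vmeas h -> (forall x, (0 <= h x)%E) ->
  (\int[P]_w h (X ^~ w) = \int[P]_w Int1 mu i h (X ^~ w))%E.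
Proof.
move=> mh h0.
have viaXt h' : vmeas h' -> (forall x, (0 <= h' x)%E) ->
    (\int[P]_w h' (X ^~ w) = \int[nu]_t h' (tupfun t))%E.
  move=> mh' h0'; rewrite /nu ge0_integral_distribution //.
  by apply: eq_integral => w _ /=; rewrite XtE.
rewrite viaXt // viaXt; last 2 first.
- exact: vmeas_Int1.
- by move=> x; apply: integral_ge0 => y _; exact: h0.
transitivity (\int[nu2 i]_t h (tupfun t))%E.
  by apply: eq_measure_integral => A mA _; exact: nu2E.
rewrite /nu2 ge0_integral_distribution //.
have mf : measurable_fun setT (fun p => h (tupfun (updt i p))).
  exact: (measurableT_comp mh (measurable_updt i)).
rewrite (@fubini_tonelli1 _ _ _ _ _ nu (mu i) _ mf (fun=> h0 _)).
apply: eq_integral => t _; rewrite /fubini_F /Int1.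
by apply: eq_integral => y _; rewrite updtE.
Qed.

Lemma vmeas_IntL s h : vmeas h -> (forall x, (0 <= h x)%E) -> vmeas (IntL mu s h).
Proof.
elim: s h => [//|i s IH] h mh h0 /=; apply: IH; first exact: vmeas_Int1.
by move=> x; exact: Int1_ge0.
Qed.

Lemma IntL_ge0 s h : (forall x, (0 <= h x)%E) -> forall x, (0 <= IntL mu s h x)%E.
Proof.
by elim: s h => [//|i s IH] h h0 x /=; apply: IH => y; exact: Int1_ge0.
Qed.

Lemma expectation_IntL s h : vmeas h -> (forall x, (0 <= h x)%E) ->
  (\int[P]_w h (X ^~ w) = \int[P]_w IntL mu s h (X ^~ w))%E.
Proof.
elim: s h => [//|i s IH] h mh h0 /=.
rewrite -IH; first exact: expectation_Int1.
  exact: vmeas_Int1.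
by move=> x; exact: Int1_ge0.
Qed.

End IndependentCoordinates.

(** * Measurability of complex matrix functions *)

Definition cmeas {R : realType} {d} {T : measurableType d} (f : T -> R[i]) : Prop :=
  measurable_fun setT (fun t => complex.Re (f t)) /\
  measurable_fun setT (fun t => complex.Im (f t)).

Definition mmeas {R : realType} {d} {T : measurableType d} {p q}
  (F : T -> 'M[R[i]]_(p, q)) : Prop := forall i j, cmeas (fun t => F t i j).

Section ComplexMeasurability.
Context {R : realType} {d} {T : measurableType d}.
Implicit Types (f g : T -> R[i]).

(** The inverse is written as x times the inverse of x^2, a power of a nonnegative number; at 0 both
    expressions are 0. *)
Lemma measurable_funV (f : T -> R) : measurable_fun setT f ->
  measurable_fun setT (fun t => (f t)^-1).
Proof.
move=> mf.
have -> : (fun t => (f t)^-1) = (fun t => f t * powR (f t ^+ 2) (-1)).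
  apply/funext => t; rewrite powR_inv1 ?sqr_ge0 //.
  have [->|ft] := eqVneq (f t) 0; first by rewrite invr0 mul0r.
  by field.
apply: measurable_funM => //.
apply: (measurableT_comp (measurable_powR _)).
exact: measurable_funX.
Qed.

Lemma cmeas_cst (z : R[i]) : cmeas (fun _ : T => z).
Proof. by split; exact: measurable_cst. Qed.

Lemma cmeasD f g : cmeas f -> cmeas g -> cmeas (fun t => f t + g t).
Proof.
move=> [f1 f2] [g1 g2]; split.
  by under eq_fun do rewrite cReD; exact: measurable_funD.
by under eq_fun do rewrite cImD; exact: measurable_funD.
Qed.

Lemma cmeasM f g : cmeas f -> cmeas g -> cmeas (fun t => f t * g t).
Proof.
move=> [f1 f2] [g1 g2]; split.
  under eq_fun do rewrite cReM.
  by apply: measurable_funB; exact: measurable_funM.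
under eq_fun do rewrite cImM.
by apply: measurable_funD; exact: measurable_funM.
Qed.

Lemma cmeas_conj f : cmeas f -> cmeas (fun t => conjc (f t)).
Proof.
move=> [f1 f2]; split.
  by under eq_fun do rewrite cRe_conj.
by under eq_fun do rewrite cIm_conj; exact: measurable_funN.
Qed.

Lemma cmeas_rC (h : T -> R) : measurable_fun setT h -> cmeas (fun t => rC (h t)).
Proof. by move=> mh; split => //; exact: measurable_cst. Qed.

Lemma cmeasV f : cmeas f -> cmeas (fun t => (f t)^-1).
Proof.
move=> mf.
have -> : (fun t => (f t)^-1) =
    (fun t => rC ((complex.Re (f t) ^+ 2 + complex.Im (f t) ^+ 2)^-1) * conjc (f t)).
  apply/funext => t; case: (f t) => a b; apply: complex_ext.
    by rewrite cReM /=; ring.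
  by rewrite cImM /=; ring.
apply: cmeasM; last exact: cmeas_conj.
apply/cmeas_rC/measurable_funV; case: mf => f1 f2.
by apply: measurable_funD; exact: measurable_funX.
Qed.

Lemma cmeas_sum (J : finType) (P : pred J) (F : J -> T -> R[i]) :
  (forall j, cmeas (F j)) -> cmeas (fun t => \sum_(j | P j) F j t).
Proof.
move=> mF; rewrite (_ : (fun t => _) = (fun t => \sum_(j <- index_enum J)
    (if P j then F j t else 0))); last by apply/funext => t; rewrite big_mkcond.
elim: (index_enum J) => [|j s IH].
  by under eq_fun do rewrite big_nil; exact: cmeas_cst.
under eq_fun do rewrite big_cons; apply: cmeasD => //.
by case: (P j); [exact: mF|exact: cmeas_cst].
Qed.

Lemma cmeas_prod (J : finType) (F : J -> T -> R[i]) :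
  (forall j, cmeas (F j)) -> cmeas (fun t => \prod_j F j t).
Proof.
move=> mF; elim: (index_enum J) => [|j s IH].
  by under eq_fun do rewrite big_nil; exact: cmeas_cst.
by under eq_fun do rewrite big_cons; exact: cmeasM.
Qed.

Lemma mmeas_cst p q (M : 'M[R[i]]_(p, q)) : mmeas (fun _ : T => M).
Proof. by move=> i j; exact: cmeas_cst. Qed.

Lemma mmeasD p q (F G : T -> 'M[R[i]]_(p, q)) : mmeas F -> mmeas G ->
  mmeas (fun t => F t + G t).
Proof.
by move=> mF mG i j; under eq_fun do rewrite mxE; apply: cmeasD.
Qed.

Lemma mmeasM p q r (F : T -> 'M[R[i]]_(p, q)) (G : T -> 'M[R[i]]_(q, r)) :
  mmeas F -> mmeas G -> mmeas (fun t => F t *m G t).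
Proof.
move=> mF mG i j; under eq_fun do rewrite mxE.
by apply: cmeas_sum => k; exact: cmeasM.
Qed.

Lemma mmeas_cadj p q (F : T -> 'M[R[i]]_(p, q)) : mmeas F ->
  mmeas (fun t => cadj (F t)).
Proof.
by move=> mF i j; under eq_fun do rewrite cadjE; exact: cmeas_conj.
Qed.

Lemma cmeas_trace p (F : T -> 'M[R[i]]_p) : mmeas F -> cmeas (fun t => \tr (F t)).
Proof. by move=> mF; apply: cmeas_sum. Qed.

Lemma cmeas_det p (F : T -> 'M[R[i]]_p) : mmeas F -> cmeas (fun t => \det (F t)).
Proof.
move=> mF; apply: cmeas_sum => s; apply: cmeasM; first exact: cmeas_cst.
exact: cmeas_prod.
Qed.

Lemma measurable_retr p (F : T -> 'M[R[i]]_p) : mmeas F ->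
  measurable_fun setT (fun t => retr (F t)).
Proof. by move=> /cmeas_trace []. Qed.

Lemma measurable_inprod p q (F G : T -> 'M[R[i]]_(p, q)) : mmeas F -> mmeas G ->
  measurable_fun setT (fun t => inprod (F t) (G t)).
Proof.
move=> mF mG; apply: measurable_retr.
by apply: mmeasM => //; exact: mmeas_cadj.
Qed.

(** Cramer's rule: the entries are cofactors divided by a determinant. *)
Lemma mmeas_resol e p q (F : T -> 'M[R[i]]_(p, q)) : 0 < e -> mmeas F ->
  mmeas (fun t => resol e (F t)).
Proof.
move=> e0 mF i j.
have mG : mmeas (fun t => resol_gram e (F t)).
  apply: mmeasD; last exact: mmeas_cst.
  by apply: mmeasM => //; exact: mmeas_cadj.
have -> : (fun t => resol e (F t) i j) = (fun t => rC e *
    ((\det (resol_gram e (F t)))^-1 * cofactor (resol_gram e (F t)) j i)).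
  apply/funext => t; rewrite /resol /invmx resol_gram_unit //.
  by move: (resol_gram e (F t)) => G; rewrite !mxE.
apply: cmeasM; first exact: cmeas_cst.
apply: cmeasM; first exact/cmeasV/cmeas_det.
apply: cmeasM; first exact: cmeas_cst.
apply: cmeas_det => a b.
by under eq_fun do rewrite [row' _ _ _ _]mxE [col' _ _ _ _]mxE; exact: mG.
Qed.

End ComplexMeasurability.

Section IntLFacts.
Context {R : realType} {I : finType}.
Implicit Types (h : (I -> R) -> \bar R) (mu : I -> probability (measurableTypeR R) R).

Lemma le_IntL mu s h h' x : vmeas h -> vmeas h' ->
  (forall y, (0 <= h y)%E) -> (forall y, (h y <= h' y)%E) ->
  (IntL mu s h x <= IntL mu s h' x)%E.
Proof.
elim: s h h' => [|i s IH] h h' mh mh' h0 hh' //=.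
have h'0 y : (0 <= h' y)%E by exact: le_trans (h0 y) (hh' y).
apply: IH.
- exact: vmeas_Int1.
- exact: vmeas_Int1.
- by move=> y; exact: Int1_ge0.
- by move=> y; exact: le_Int1.
Qed.

(** Integration over [s] only visits points that agree with [x] outside [s], so whatever does not
    depend on these coordinates can be frozen first. *)
Lemma IntL_ext mu s h h' x :
  (forall x', (forall j, j \notin s -> x' j = x j) -> h x' = h' x') ->
  IntL mu s h x = IntL mu s h' x.
Proof.
elim: s h h' x => [|i s IH] h h' x hh' /=; first exact: hh'.
apply: IH => x' ex'; rewrite /Int1; apply: eq_integral => y _; apply: hh' => j.
rewrite inE negb_or => /andP[ji js].
by rewrite /upd (negPf ji) ex'.
Qed.

Lemma IntL_cat mu s s' h : IntL mu (s ++ s') h = IntL mu s' (IntL mu s h).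
Proof. by elim: s h => //= i s IH h; rewrite IH. Qed.

End IntLFacts.

(** * Integrating one Gaussian column *)

Section GaussianQuadratic.
Context {R : realType}.
Variables (n : nat) (s lam : R).
Hypotheses (s0 : 0 < s) (lam0 : 0 <= lam).
Let u := 2 * lam * s ^+ 2.

(** The exponent is quadratic in y, so [normal_prob_exp_quad] applies with coefficients lam <v, B v>
    and 2 lam <v, B g>. The result is again an exponential of a quadratic form in [g], which makes
    the integration repeatable. *)
Lemma gauss_line (B : 'M[R[i]]_n) (c : R) (g v : 'cV[R[i]]_n) :
  cadj B = B -> (forall x : 'cV_n, 0 <= inprod x (B *m x)) -> 0 <= c ->
  (\int[normal_prob 0 s]_y
     (c * expR (- lam * inprod (g + rC y *: v) (B *m (g + rC y *: v))))%:E =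
   (c * (Num.sqrt (1 + u * inprod v (B *m v)))^-1 *
     expR (- lam * (inprod g (B *m g) -
        u / (1 + u * inprod v (B *m v)) * inprod v (B *m g) ^+ 2)))%:E)%E.
Proof.
move=> hB pB c0.
set rho := inprod v _; set I := inprod v (B *m g).
have rho0 : 0 <= rho by exact: pB.
have q y : inprod (g + rC y *: v) (B *m (g + rC y *: v)) =
    inprod g (B *m g) + 2 * y * I + y ^+ 2 * rho.
  rewrite mulmxDr -scalemxAr !(inprodDl, inprodDr, inprodZl, inprodZr).
  rewrite (inprodC g (B *m v)) inprod_mull hB -/I -/rho.
  by move: (inprod g _) (I) (rho) => G a k; ring.
transitivity (\int[normal_prob 0 s]_y ((c * expR (- lam * inprod g (B *m g)))%:E *
    (expR (- ((lam * rho) * y ^+ 2 + (2 * lam * I) * y)))%:E))%E.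
  apply: eq_integral => y _; rewrite -EFinM q; congr (_%:E).
  rewrite -[RHS]mulrA -expRD; congr (_ * expR _).
  by move: (inprod g _) (I) (rho) => G a k; ring.
rewrite ge0_integralZl //; last 2 first.
- apply/measurable_EFinP; apply: measurableT_comp => //.
  apply: measurable_funN; apply: measurable_funD.
    by apply: measurable_funM => //; exact: measurable_funX.
  by apply: measurable_funM.
- by rewrite lee_fin mulr_ge0 // expR_ge0.
rewrite normal_prob_exp_quad // ?mulr_ge0 // -EFinM; congr (_%:E).
have -> : 1 + 2 * (lam * rho) * s ^+ 2 = 1 + u * rho by rewrite /u; ring.
have u0 : 0 <= u by rewrite /u mulr_ge0 ?sqr_ge0 // mulr_ge0.
have q0 : 0 < 1 + u * rho by rewrite ltr_pwDl // mulr_ge0.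
set e1 := expR _; set e2 := expR _; set r := (Num.sqrt _)^-1.
transitivity (c * r * (e1 * e2)); first by ring.
congr (_ * _); rewrite -expRD; congr expR.
rewrite /u in q0 *; move: (inprod g _) => G.
by field; rewrite gt_eqF.
Qed.

End GaussianQuadratic.

Definition gaussian_law {R : realType} {I : Type} (sd : I -> R) : I -> probability (measurableTypeR R) R :=
  fun j => normal_prob 0 (sd j).

Section GaussianColumn.
Context {R : realType}.

Lemma inprod_scale_ecol n (z : R[i]) (b : 'I_n) (w : 'cV[R[i]]_n) :
  inprod (z *: ecol b) w = complex.Re (conjc z * w b 0).
Proof.
rewrite inprodE (bigD1 b) //= big_ord1 !mxE !eqxx mulr1.
rewrite big1 ?addr0 => [|j jb]; last first.
  by rewrite big_ord1 !mxE (negPf jb) /= mulr0 /= !mul0r addr0.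
by rewrite cReM cRe_conj cIm_conj mulNr opprK.
Qed.

Lemma rank1_upd_ecol n u (B : 'M[R[i]]_n) b (g : 'cV[R[i]]_n) : cadj B = B ->
  inprod g (rank1_upd u B b *m g) = inprod g (B *m g) -
    u / (1 + u * dentry B b) *
      (complex.Re ((B *m g) b 0) ^+ 2 + complex.Im ((B *m g) b 0) ^+ 2).
Proof.
move=> hB; rewrite rank1_upd_quad; congr (_ - _ * _).
rewrite inprodE !big_ord1 -!expr2.
suff -> : (cadj (B *m ecol b) *m g) 0 0 = (B *m g) b 0 by [].
rewrite cadjM hB -mulmxA; move: (B *m g) => w.
rewrite mxE (bigD1 b) //= big1 ?addr0 => [|j jb].
  by rewrite cadjE !mxE !eqxx conjc1 mul1r.
by rewrite cadjE !mxE (negPf jb) conjc0 mul0r.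
Qed.

Variables (n : nat) (s lam : R).
Hypotheses (s0 : 0 < s) (lam0 : 0 <= lam).
Let u := 2 * lam * s ^+ 2.
Let u0 : 0 <= u. Proof. by rewrite /u mulr_ge0 ?sqr_ge0 // mulr_ge0. Qed.

Let kernel (B : 'M[R[i]]_n) (c : R) (g : 'cV[R[i]]_n) : R :=
  c * expR (- lam * inprod g (B *m g)).

(** One real parameter only removes the square of Re (B g)_b from the form. Removing the square of
    Im (B g)_b as well enlarges the exponential, so one rank-one update serves both scalar
    fields. *)
Let step1 (B : 'M[R[i]]_n) c g b : cadj B = B ->
  (forall x : 'cV_n, 0 <= inprod x (B *m x)) -> 0 <= c ->
  (\int[normal_prob 0 s]_y (kernel B c (g + rC y *: ecol b))%:E <=
   (kernel (rank1_upd u B b) (c * (Num.sqrt (1 + u * dentry B b))^-1) g)%:E)%E.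
Proof.
move=> hB pB c0; rewrite /kernel gauss_line // lee_fin -/u -/(dentry B b).
rewrite ler_wpM2l ?mulr_ge0 ?invr_ge0 ?sqrtr_ge0 // ler_expR.
rewrite rank1_upd_ecol // !mulNr lerN2 ler_wpM2l // lerD2l lerN2.
have d0 : 0 <= dentry B b by exact: pB.
apply: ler_wpM2l; first exact: divr_ge0 u0 (addr_ge0 ler01 (mulr_ge0 u0 d0)).
by rewrite inprod_ecol lerDl sqr_ge0.
Qed.

(** The inner integral produces the square of Re (B g)_b, which the second parameter does not move
    because B_bb is real; the outer one produces the square of Im (B g)_b. Each brings a factor r <=
    1, and one of the two is discarded to reach the same bound as with a single parameter. *)
Let step2 (B : 'M[R[i]]_n) c g b (e : R) : e ^+ 2 = 1 -> cadj B = B ->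
  (forall x : 'cV_n, 0 <= inprod x (B *m x)) -> 0 <= c ->
  (\int[normal_prob 0 s]_y2 \int[normal_prob 0 s]_y1
    (kernel B c (g + rC y2 *: (Complex 0 e *: ecol b) + rC y1 *: ecol b))%:E <=
   (kernel (rank1_upd u B b) (c * (Num.sqrt (1 + u * dentry B b))^-1) g)%:E)%E.
Proof.
move=> e1 hB pB c0.
have d0 : 0 <= dentry B b by exact: pB.
have q0 : 0 < 1 + u * dentry B b by rewrite ltr_pwDl //; exact: mulr_ge0 u0 d0.
set r := (Num.sqrt (1 + u * dentry B b))^-1.
have r0 : 0 <= r by rewrite invr_ge0 sqrtr_ge0.
have r1 : r <= 1.
  rewrite invf_le1 ?sqrtr_gt0 // -{1}[1]sqrtr1 ler_wsqrtr //.
  by rewrite lerDl; exact: mulr_ge0 u0 d0.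
set v2 := Complex 0 e *: ecol b.
have Bv2 : (B *m v2) b 0 = Complex 0 (e * dentry B b).
  rewrite /v2 -scalemxAr mxE mul_ecolE.
  have -> : B b b = rC (dentry B b).
    have := herm_quad11 b hB => /matrixP /(_ 0 0).
    rewrite [RHS]mxE eqxx mulr1n => <-.
    rewrite mxE (bigD1 b) //= big1 ?addr0 => [|j jb].
      by rewrite cadjE mul_ecolE !mxE !eqxx conjc1 mul1r.
    by rewrite cadjE !mxE (negPf jb) conjc0 mul0r.
  by apply: complex_ext; rewrite ?cReM ?cImM /=; ring.
have rho2 : inprod v2 (B *m v2) = dentry B b.
  rewrite /v2 inprod_scale_ecol -/v2 Bv2 cReM /= .
  have -> : 0 * 0 - - e * (e * dentry B b) = e ^+ 2 * dentry B b by ring.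
  by rewrite e1 mul1r.
set t := u / (1 + u * dentry B b).
set z := (B *m g) b 0.
have I1 y : inprod (ecol b) (B *m (g + rC y *: v2)) = complex.Re z.
  have addE (A A' : 'cV[R[i]]_n) : (A + A') b 0 = A b 0 + A' b 0 by rewrite mxE.
  have scaleE k (A : 'cV[R[i]]_n) : (k *: A) b 0 = k * A b 0 by rewrite mxE.
  rewrite inprod_ecol mulmxDr -scalemxAr addE scaleE.
  by rewrite -/z cReD cReM Bv2 /=; ring.
have I2 : inprod v2 (B *m g) ^+ 2 = complex.Im z ^+ 2.
  rewrite /v2 inprod_scale_ecol -/z cReM /=.
  by rewrite -[RHS]mul1r -e1; ring.
under eq_integral => y _.
  rewrite /kernel gauss_line // -/u -/(dentry B b) -/r -/t I1.
  have -> : c * r * expR (- lam * (inprod (g + rC y *: v2) (B *m (g + rC y *: v2)) -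
      t * complex.Re z ^+ 2)) =
    (c * r * expR (lam * t * complex.Re z ^+ 2)) *
      expR (- lam * inprod (g + rC y *: v2) (B *m (g + rC y *: v2))).
    by rewrite -!mulrA -expRD; congr (_ * (_ * expR _)); ring.
  over.
rewrite gauss_line //; last by rewrite !mulr_ge0 // expR_ge0.
rewrite -/u rho2 -/r -/t I2 /kernel rank1_upd_ecol // -/t -/z lee_fin.
set G := inprod g _.
have -> : c * r * expR (lam * t * complex.Re z ^+ 2) * r *
    expR (- lam * (G - t * complex.Im z ^+ 2)) =
  r * (c * r * expR (- lam * (G - t * (complex.Re z ^+ 2 + complex.Im z ^+ 2)))).
  rewrite [RHS](_ : _ = c * r * r * (expR (lam * t * complex.Re z ^+ 2) *
    expR (- lam * (G - t * complex.Im z ^+ 2)))); first by ring.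
  by rewrite -expRD; transitivity (c * r * r * expR (- lam * (G - t * (complex.Re z ^+ 2 + complex.Im z ^+ 2)))); [ring|congr (_ * expR _); ring].
by rewrite ler_piMl // !mulr_ge0 // expR_ge0.
Qed.

Context {I : finType}.
Variables (sd : I -> R) (V : I -> 'cV[R[i]]_n) (vl : 'I_n -> seq I).

(* the coordinate b of the column depends on one real parameter (real case) or two (complex case) *)
Definition column_params (b : 'I_n) : Prop :=
  (exists2 q, vl b = [:: q] & V q = ecol b) \/
  (exists q1 q2 e, [/\ vl b = [:: q1; q2], q1 != q2, e ^+ 2 = 1,
     V q1 = ecol b & V q2 = Complex 0 e *: ecol b]).

Let vmeas_kernel B c (f : (I -> R) -> 'cV[R[i]]_n) :
  mmeas (fun t => f (tupfun t)) -> vmeas (fun x => (kernel B c (f x))%:E).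
Proof.
move=> mf; apply/measurable_EFinP; apply: measurable_funM => //.
apply: measurableT_comp => //; apply: measurable_funM => //.
apply: measurable_inprod => //; apply: mmeasM => //; exact: mmeas_cst.
Qed.

Let mmeas_upd (f : (I -> R) -> 'cV[R[i]]_n) j y :
  mmeas (fun t => f (tupfun t)) -> mmeas (fun t => f (upd (tupfun t) j y)).
Proof.
move=> mf a a'; have [m1 m2] := mf a a'; split.
  exact: (@vmeas_upd _ _ j y _ _ (fun x => complex.Re (f x a a')) m1).
exact: (@vmeas_upd _ _ j y _ _ (fun x => complex.Im (f x a a')) m2).
Qed.

Let updC (x : I -> R) j y k z : k != j -> upd (upd x j y) k z = upd (upd x k z) j y.
Proof.
move=> kj; apply/funext => a; rewrite /upd.
by case: eqP => // ->; rewrite (negPf kj).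
Qed.

(** Induction on the coordinates: integrating the parameters of [b] leaves a kernel of the same
    shape, with [B] replaced by its update and these parameters set to 0 in the affine map [f]. The
    accumulated factors form the inverse square root of the pivot product. *)
Lemma gaussian_column_bound (bs : seq 'I_n) (B : 'M[R[i]]_n) c
    (f : (I -> R) -> 'cV[R[i]]_n) x :
  uniq (flatten (map vl bs)) -> (forall b, b \in bs -> column_params b) ->
  (forall j, j \in flatten (map vl bs) -> sd j = s) ->
  (forall j x y, j \in flatten (map vl bs) ->
     f (upd x j y) = f x + rC (y - x j) *: V j) ->
  mmeas (fun t => f (tupfun t)) -> cadj B = B ->
  (forall x : 'cV_n, 0 <= inprod x (B *m x)) -> 0 <= c ->
  (IntL (gaussian_law sd) (flatten (map vl bs))
    (fun x => (c * expR (- lam * inprod (f x) (B *m f x)))%:E) x <=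
   (c * (Num.sqrt (pivot_prod u B bs))^-1)%:E)%E.
Proof.
elim: bs B c f => [|b bs IH] B c f /= ub cp sdE fE mf hB pB c0.
  rewrite lee_fin sqrtr1 invr1 mulr1 ler_piMr //.
  by rewrite -expR0 ler_expR mulNr oppr_le0 mulr_ge0 // pB.
have d0 : 0 <= dentry B b by exact: pB.
set c' := c * (Num.sqrt (1 + u * dentry B b))^-1.
have c'0 : 0 <= c' by rewrite mulr_ge0 // invr_ge0 sqrtr_ge0.
have -> : c * (Num.sqrt ((1 + u * dentry B b) * pivot_prod u (rank1_upd u B b) bs))^-1
   = c' * (Num.sqrt (pivot_prod u (rank1_upd u B b) bs))^-1.
  by rewrite sqrtrM ?invfM ?mulrA //; exact: addr_ge0 ler01 (mulr_ge0 u0 d0).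
move: ub; rewrite cat_uniq => /and3P[u1 /hasPn disj u2].
have sub2 j : j \in flatten [seq vl b | b <- bs] ->
    j \in vl b ++ flatten [seq vl b | b <- bs].
  by rewrite mem_cat orbC => ->.
rewrite IntL_cat.
suff [f' [mf' f'E f'le]] : exists f' : (I -> R) -> 'cV[R[i]]_n,
   [/\ mmeas (fun t => f' (tupfun t)),
      (forall j x y, j \in flatten [seq vl b | b <- bs] ->
         f' (upd x j y) = f' x + rC (y - x j) *: V j) &
      (forall x, (IntL (gaussian_law sd) (vl b)
          (fun x => (kernel B c (f x))%:E) x <=
         (kernel (rank1_upd u B b) c' (f' x))%:E)%E)].
  apply: le_trans (@le_IntL _ _ (gaussian_law sd) (flatten [seq vl b | b <- bs]) _ _ x _ _ _ f'le) _.
  - by apply: vmeas_IntL; [exact: vmeas_kernel|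
      move=> y; rewrite lee_fin mulr_ge0 // expR_ge0].
  - exact: vmeas_kernel.
  - by move=> y; apply: IntL_ge0 => z; rewrite lee_fin mulr_ge0 // expR_ge0.
  apply: IH => //.
  - by move=> b' hb'; apply: cp; rewrite inE hb' orbT.
  - by move=> j /sub2; exact: sdE.
  - exact: rank1_upd_herm.
  - exact: rank1_upd_ge0.
have [[q vlq Vq]|[q1 [q2 [e [vlq q12 e1 V1 V2]]]]] := cp b (mem_head _ _).
  exists (fun x => f (upd x q 0)); split.
  - exact: mmeas_upd.
  - move=> j y z jf.
    have jq : j != q by have := disj _ jf; rewrite vlq /= inE.
    rewrite -(updC _ _ _ jq) fE; last exact: sub2.
    congr (_ + rC (_ - _) *: _).
    by rewrite /upd (negPf jq).
  move=> y; rewrite vlq /= /Int1 /gaussian_law sdE ?mem_cat ?vlq ?mem_head //.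
  under eq_integral => z _.
    have -> : f (upd y q z) = f (upd y q 0) + rC z *: ecol b.
      rewrite !fE ?mem_cat ?vlq ?mem_head // Vq -addrA -scalerDl -rCD.
      by congr (_ + rC _ *: _); rewrite sub0r addrC.
    over.
  exact: step1.
exists (fun x => f (upd (upd x q2 0) q1 0)); split.
- exact: (@mmeas_upd (fun x => f (upd x q1 0)) q2 0 (mmeas_upd _ _ mf)).
- move=> j y z jf.
  have /andP[jq1 jq2] : (j != q1) && (j != q2).
    by have := disj _ jf; rewrite vlq /= !inE negb_or.
  rewrite -(updC _ _ _ jq2) -(updC _ _ _ jq1) fE; last exact: sub2.
  by congr (_ + rC (_ - _) *: _); rewrite /upd (negPf jq1) (negPf jq2).
have in1 : q1 \in vl b ++ flatten [seq vl b | b <- bs].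
  by rewrite mem_cat vlq mem_head.
have in2 : q2 \in vl b ++ flatten [seq vl b | b <- bs].
  by rewrite mem_cat vlq !inE eqxx orbT.
move=> y; rewrite vlq /= /Int1 /gaussian_law (sdE q1) // (sdE q2) //.
under eq_integral => z2 _.
  under eq_integral => z1 _.
    have -> : f (upd (upd y q2 z2) q1 z1) = f (upd (upd y q2 0) q1 0) +
        rC z2 *: (Complex 0 e *: ecol b) + rC z1 *: ecol b.
      rewrite !fE // /upd (negPf q12) V1 V2.
      have E (v w : 'cV[R[i]]_n) (a2 a1 : R) : f y + rC (z2 - a2) *: v + rC (z1 - a1) *: w =
          f y + rC (0 - a2) *: v + rC (0 - a1) *: w + rC z2 *: v + rC z1 *: w.
        rewrite !rCD !scalerDl rC0 !scale0r !add0r.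
        rewrite (addrC (rC z2 *: v)) (addrC (rC z1 *: w)) !addrA.
        by congr (_ + _); rewrite addrAC.
      exact: E.
    over.
  over.
exact: step2.
Qed.

End GaussianColumn.

(** * Small-ball estimate for shifted Wigner matrices *)

(** Extension by 0 to triples without a parameter: entries below the diagonal, imaginary parts on it
    and, over the reals, all imaginary parts. *)
Definition wext {R : realType} {cplx : bool} {n : nat} (x : widx cplx n -> R)
  (p : 'I_n * 'I_n * bool) : R := if insub p is Some q then x q else 0.

Definition wmat {R : realType} {cplx : bool} {n : nat} (x : widx cplx n -> R) :
  'M[R[i]]_n :=
  \matrix_(i, j) if (i <= j)%N
    then Complex (wext x (i, j, false)) (wext x (i, j, true))
    else Complex (wext x (j, i, false)) (- wext x (j, i, true)).

Definition opair {n : nat} (b i : 'I_n) : 'I_n * 'I_n :=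
  if (b <= i)%N then (b, i) else (i, b).

Definition wvars (cplx : bool) {n : nat} (i b : 'I_n) : seq (widx cplx n) :=
  pmap insub [:: (opair b i, false); (opair b i, true)].

Section WignerParametrization.
Context {R : realType} {cplx : bool} {n : nat}.
Implicit Types (x : widx cplx n -> R).

Lemma wext_diag x i : wext x (i, i, true) = 0.
Proof.
have F : widx_pred cplx n (i, i, true) = false.
  by rewrite /widx_pred /= leqnn /= ltnn andbF.
by rewrite /wext insubF.
Qed.

Lemma wmat_wentry {T : Type} (W : T -> 'M[R[i]]_n) w : selfadj cplx (W w) ->
  wmat (fun q : widx cplx n => wentry W (val q) w) = W w.
Proof.
move=> [hK hA].
have ImW i j : cplx = false -> complex.Im (W w i j) = 0.
  by move=> cf; have := hK i j; rewrite /Kscal cf => /eqP.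
have Wji i j : W w j i = conjc (W w i j) by rewrite -{1}hA cadjE.
have Wd i : complex.Im (W w i i) = 0.
  by have := congr1 (@complex.Im R) (Wji i i); rewrite cIm_conj; lra.
have re (i j : 'I_n) : (i <= j)%N ->
    wext (fun q : widx cplx n => wentry W (val q) w) (i, j, false) =
    complex.Re (W w i j).
  move=> ij; have F : widx_pred cplx n (i, j, false) by rewrite /widx_pred /= ij.
  by rewrite /wext insubT.
have im (i j : 'I_n) : (i <= j)%N ->
    wext (fun q : widx cplx n => wentry W (val q) w) (i, j, true) =
    complex.Im (W w i j).
  rewrite leq_eqVlt => /orP[/eqP/val_inj <-|ij]; first by rewrite wext_diag Wd.
  have [ct|cf] : cplx = true \/ cplx = false by case: (cplx); [left|right].
  2: {
    have F : widx_pred cplx n (i, j, true) = false.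
      by rewrite /widx_pred /= cf andbF.
    by rewrite ImW // /wext insubF. }
  have F : widx_pred cplx n (i, j, true) by rewrite /widx_pred /= ct ij (ltnW ij).
  by rewrite /wext insubT.
apply/matrixP => i j; rewrite mxE; case: leqP => ij.
  by rewrite re // im //; case: (W w i j).
rewrite re ?(ltnW ij) // im ?(ltnW ij) // (Wji j i).
by case: (W w j i).
Qed.

Lemma wext_upd x q y p : wext (upd x q y) p = if p == val q then y else wext x p.
Proof.
rewrite /wext; case: insubP => [q' pq' <-|].
  by rewrite /upd (inj_eq val_inj).
move=> hp; case: eqP => // pE; move: hp; rewrite pE.
by case: q {pE} => q' /= ->.
Qed.

Lemma opairC (a c b i : 'I_n) : opair a c = opair b i ->
  (a = b /\ c = i) \/ (a = i /\ c = b).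
Proof.
rewrite /opair; case: leqP => _; case: leqP => _ [-> ->]; by [left|right].
Qed.

Lemma wmat_opair x (a c : 'I_n) : wmat x a c =
  Complex (wext x (opair a c, false))
    (if (a <= c)%N then wext x (opair a c, true) else - wext x (opair a c, true)).
Proof. by rewrite mxE /opair; case: leqP. Qed.

Lemma wmat_ext x x' (a c : 'I_n) :
  (forall q : widx cplx n, (val q).1 = opair a c -> x' q = x q) ->
  wmat x' a c = wmat x a c.
Proof.
move=> h; rewrite !wmat_opair.
have e t : wext x' (opair a c, t) = wext x (opair a c, t).
  by rewrite /wext; case: insubP => // q _ qE; apply: h; rewrite qE.
by rewrite !e.
Qed.

Lemma wvars_pair (i b : 'I_n) q : q \in wvars cplx i b -> (val q).1 = opair b i.
Proof.
rewrite /wvars mem_pmap => /mapP[p].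
by rewrite !inE => /orP[] /eqP -> /esym; case: insubP => // q' _ qE [<-]; rewrite qE.
Qed.

Lemma wvars_shape (i b : 'I_n) : b != i ->
  (exists2 q, wvars cplx i b = [:: q] & val q = (opair b i, false)) \/
  (exists q1 q2, [/\ cplx, wvars cplx i b = [:: q1; q2],
     val q1 = (opair b i, false) & val q2 = (opair b i, true)]).
Proof.
move=> bi; rewrite /wvars /=.
have lt : ((opair b i).1 < (opair b i).2)%N.
  by rewrite /opair; case: (ltngtP b i) => [//|//|/val_inj E]; rewrite E eqxx in bi.
have F1 : widx_pred cplx n (opair b i, false) by rewrite /widx_pred /= (ltnW lt).
rewrite (insubT _ F1) /=.
case: insubP => [q2 h2 v2|_] /=; last by left; eexists.
right; do 2 eexists; split; [|reflexivity|by []|exact: v2].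
by move: h2; rewrite /widx_pred /= => /andP[_ /andP[]].
Qed.

Lemma uniq_flatten_wvars (i : 'I_n) (bs : seq 'I_n) : i \notin bs -> uniq bs ->
  uniq (flatten [seq wvars cplx i b | b <- bs]).
Proof.
elim: bs => [//|b bs IH] /=; rewrite inE negb_or => /andP[ib ibs] /andP[bbs ubs].
rewrite cat_uniq IH // andbT; apply/andP; split.
  have bi : b != i by rewrite eq_sym.
  have [[q -> _]//|[q1 [q2 [_ -> v1 v2]]]] := wvars_shape bi.
  rewrite /= andbT inE; apply: contraTneq isT => E.
  by move: v1; rewrite E v2.
apply/hasPn => q /flattenP[s' /mapP[b' b'bs ->]] /wvars_pair e'.
apply/negP => /wvars_pair e; move: e'; rewrite e => /opairC[[E _]|[E _]].
  by rewrite -E (negPf bbs) in b'bs.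
by rewrite E eqxx in ib.
Qed.

End WignerParametrization.

Definition soff {R : realType} (cplx : bool) (sigma : R) : R :=
  if cplx then sigma / Num.sqrt 2 else sigma.

Lemma prod_split {R : realType} l (k : 'I_l) (g g' : 'I_l -> R) c a :
  (forall j : 'I_l, (k <= j)%N && (j != k) -> g j = g' j) -> g k = a ->
  c * \prod_(j < l | (k <= j)%N) g j = c * \prod_(j < l | (k < j)%N) g' j * a.
Proof.
move=> gg' gk; rewrite (bigD1 k) //= gk (eq_bigr _ gg').
rewrite (eq_bigl (fun j : 'I_l => (k < j)%N)); last first.
  by move=> j; rewrite [in RHS]ltn_neqAle andbC (inj_eq val_inj) eq_sym.
by rewrite -mulrA; congr (_ * _); rewrite mulrC.
Qed.

Lemma matrix_addE {R : realType} p q (A B : 'M[R[i]]_(p, q)) i j :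
  (A + B) i j = A i j + B i j.
Proof. by rewrite mxE. Qed.

Lemma matrix_scaleE {R : realType} p q (z : R[i]) (A : 'M[R[i]]_(p, q)) i j :
  (z *: A) i j = z * A i j.
Proof. by rewrite mxE. Qed.

Lemma ecolE {R : realType} n (b a : 'I_n) c :
  (ecol b : 'cV[R[i]]_n) a c = (a == b)%:R.
Proof. by rewrite ord1 mxE eqxx andbT. Qed.

Section SmallBallFixed.
Context {R : realType} (cplx : bool) (n l : nat).
Variables (M : 'M[R[i]]_n) (s : l.-tuple 'I_n) (e lam y0 sigma T0 : R).
Hypotheses (hM : cadj M = M) (us : uniq s) (e0 : 0 < e) (lam0 : 0 <= lam)
  (sigma0 : 0 < sigma).
Implicit Types (x : widx cplx n -> R).
Local Opaque wmat resol.

Let X x : 'M[R[i]]_n := M + wmat x.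
Let Pr : 'M[R[i]]_n := dproj s.
Let pcol x (j : 'I_l) := Pr *m X x *m ecol (tnth s j).
Let pres x (j : 'I_l) := resol e (Pr *m X x *m dproj (take j.+1 s)).

Definition pivot_form x (j : 'I_l) : R := inprod (pcol x j) (pres x j *m pcol x j).

Definition compress_trace x : R := retr (resol e (Pr *m X x *m Pr)).

Let term x j := expR (lam * (y0 - pivot_form x j)).

(** Weight for a Chernoff bound: on [pivot_event] every factor is at least 1, so H 0 dominates the
    indicator, while H l is at most 1. Integrating the k-th pivot column leads from H k to H
    k.+1. *)
Let H (k : nat) x : R :=
  ((T0 <= compress_trace x)%R)%:R * \prod_(j < l | (k <= j)%N) term x j.

Lemma mmeas_wmat :
  mmeas (fun t : #|{: widx cplx n}|.-tuple (measurableTypeR R) => wmat (tupfun t)).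
Proof.
have mw p : measurable_fun setT
    (fun t : #|{: widx cplx n}|.-tuple (measurableTypeR R) => wext (tupfun t) p).
  rewrite /wext; case: insubP => [q _ _|_]; last exact: measurable_cst.
  exact: (measurable_tnth (T := measurableTypeR R) (enum_rank q)).
move=> i j; rewrite /cmeas.
under eq_fun do rewrite wmat_opair.
under [X in _ /\ measurable_fun _ X]eq_fun do rewrite wmat_opair.
case: (i <= j)%N; split => /=; try exact: mw.
exact: measurable_funN.
Qed.

Let mmeas_X : mmeas (fun t => X (tupfun t)).
Proof. by apply: mmeasD; [exact: mmeas_cst|exact: mmeas_wmat]. Qed.

Let mmeas_PX p (D : 'M[R[i]]_(n, p)) : mmeas (fun t => Pr *m X (tupfun t) *m D).
Proof.
apply: mmeasM; last exact: mmeas_cst.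
by apply: mmeasM; [exact: mmeas_cst|exact: mmeas_X].
Qed.

Lemma vmeas_pivot_form j : vmeas (fun x => pivot_form x j).
Proof.
apply: measurable_inprod; first exact: mmeas_PX.
by apply: mmeasM; [apply: mmeas_resol => //|]; exact: mmeas_PX.
Qed.

Lemma vmeas_compress_trace : vmeas compress_trace.
Proof. by apply: measurable_retr; apply: mmeas_resol => //; exact: mmeas_PX. Qed.

Let vmeas_term j : vmeas (fun x => term x j).
Proof.
apply: measurableT_comp => //; apply: measurable_funM => //.
by apply: measurable_funB => //; exact: vmeas_pivot_form.
Qed.

Let vmeas_H k : vmeas (fun x => (H k x)%:E).
Proof.
apply/measurable_EFinP; apply: measurable_funM.
  rewrite (_ : (fun t => _) =
      (fun t => if T0 <= compress_trace (tupfun t) then 1 else 0)); last first.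
    by apply/funext => t; case: (T0 <= _).
  apply: measurable_fun_ifT => //.
  by apply: measurable_fun_ler => //; exact: vmeas_compress_trace.
rewrite (_ : (fun t => _) = (fun t => \prod_(j <- index_enum 'I_l)
    (if (k <= j)%N then term (tupfun t) j else 1))).
  apply: measurable_prod => j _; case: (k <= j)%N => //; exact: vmeas_term.
by apply/funext => t; rewrite big_mkcond.
Qed.

Let H_ge0 k x : 0 <= H k x.
Proof.
by rewrite mulr_ge0 ?ler0n // prodr_ge0 // => j _; exact: expR_ge0.
Qed.

Let sc : seq 'I_n := [seq b <- enum 'I_n | b \notin s].
Let vars (k : 'I_l) : seq (widx cplx n) :=
  flatten [seq wvars cplx (tnth s k) b | b <- sc].

(** A parameter in column s_k and row b outside [s] sits only in the entries (b, s_k) and (s_k, b).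
    The second lies in a deleted row, so no surviving entry outside column s_k moves; this is the
    purpose of deleting the rows of all pivots. *)
Let wmat_frozen (k : 'I_l) x x' (a c : 'I_n) :
  (forall q, q \notin vars k -> x' q = x q) -> a \notin s -> c != tnth s k ->
  wmat x' a c = wmat x a c.
Proof.
move=> xx' sa ck; apply: wmat_ext => q qE; apply: xx'.
apply/negP => /flattenP[t /mapP[b _ ->]] /wvars_pair.
rewrite qE => /opairC[[_ E]|[E _]]; first by rewrite E eqxx in ck.
by rewrite E mem_tnth in sa.
Qed.

Let PX_coef x (a c : 'I_n) : (Pr *m X x) a c = (a \notin s)%:R * (M a c + wmat x a c).
Proof. by rewrite dproj_coef (matrix_addE M). Qed.

Let mulmx_dproj_coef (Y : 'M[R[i]]_n) (t : seq 'I_n) a c :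
  (Y *m dproj t) a c = Y a c * (c \notin t)%:R.
Proof. by rewrite /dproj mul_mx_diag !mxE. Qed.

Let PXD_frozen (k : 'I_l) x x' (t : seq 'I_n) : tnth s k \in t ->
  (forall q, q \notin vars k -> x' q = x q) ->
  Pr *m X x' *m dproj t = Pr *m X x *m dproj t.
Proof.
move=> kt xx'; apply/matrixP => a c; rewrite !mulmx_dproj_coef !PX_coef.
have [ca|ca] := eqVneq c (tnth s k); first by rewrite ca kt !mulr0.
case: (boolP (a \in s)) => sa; first by rewrite !mul0r.
by rewrite (wmat_frozen xx').
Qed.

Let pcol_frozen (k j : 'I_l) x x' : j != k ->
  (forall q, q \notin vars k -> x' q = x q) -> pcol x' j = pcol x j.
Proof.
move=> jk xx'; apply/matrixP => a c; rewrite !mul_ecolE !PX_coef.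
case: (boolP (a \in s)) => sa; first by rewrite !mul0r.
rewrite (wmat_frozen xx') //.
by rewrite (inj_eq (tuple_uniqP _ us)).
Qed.

Let mem_take (k j : 'I_l) : (k <= j)%N -> tnth s k \in take j.+1 s.
Proof.
move=> kj; rewrite (tnth_nth (tnth s k)) -(nth_take _ (n0 := j.+1)) //.
by rewrite mem_nth // size_takel // size_tuple.
Qed.

Let pres_frozen (k j : 'I_l) x x' : (k <= j)%N ->
  (forall q, q \notin vars k -> x' q = x q) -> pres x' j = pres x j.
Proof. by move=> kj xx'; rewrite /pres (PXD_frozen (mem_take kj) xx'). Qed.

(** Column s_k is removed from the compressed trace and from the resolvents of the factors j >= k,
    and the factors j > k use other columns. Only the vector in the k-th quadratic form still
    varies. *)
Let H_frozen (k : 'I_l) x x' : (forall q, q \notin vars k -> x' q = x q) ->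
  H k x' = H k.+1 x * expR (lam * y0) *
    expR (- lam * inprod (pcol x' k) (pres x k *m pcol x' k)).
Proof.
move=> xx'.
have t1 : compress_trace x' = compress_trace x.
  by rewrite /compress_trace (PXD_frozen (mem_tnth k s) xx').
have t2 (j : 'I_l) : (k <= j)%N && (j != k) -> term x' j = term x j.
  move=> /andP[kj jk]; rewrite /term /pivot_form.
  by rewrite (pres_frozen kj xx') (pcol_frozen jk xx').
have t3 : term x' k = expR (lam * y0) *
    expR (- lam * inprod (pcol x' k) (pres x k *m pcol x' k)).
  rewrite /term /pivot_form (pres_frozen (leqnn k) xx') -expRD; congr expR.
  by rewrite mulrBr mulNr.
apply: etrans (congr1 (fun c => ((T0 <= c)%R)%:R *
  \prod_(j < l | (k <= j)%N) term x' j) t1) _.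
by apply: etrans (prod_split _ t2 t3) _; rewrite mulrA.
Qed.

Let wmat_upd x q y : wmat (upd x q y) =
  wmat x + rC (y - x q) *: wmat (upd (fun=> 0) q 1).
Proof.
apply/matrixP => a c.
apply: etrans (wmat_opair (upd x q y) a c) _.
apply: esym; apply: etrans (matrix_addE _ _ a c) _.
apply: etrans (congr2 +%R (wmat_opair x a c) (etrans (matrix_scaleE _ _ a c)
  (congr1 ( *%R _) (wmat_opair (upd (fun=> 0) q 1) a c)))) _.
rewrite !wext_upd.
have z0 p : wext (fun=> 0 : R) p = 0 by rewrite /wext; case: insub.
have xE p : p = val q -> wext x p = x q.
  move=> ->; rewrite /wext; case: insubP => [q' _ /val_inj -> //|].
  by rewrite (valP q).
rewrite !z0.
pose I1 t : R := if (opair a c, t) == val q then 1 else 0.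
have Ht t : (if (opair a c, t) == val q then y else wext x (opair a c, t)) =
    wext x (opair a c, t) + (y - x q) * I1 t.
  by rewrite /I1; case: eqP => [/xE ->|_]; ring.
rewrite !Ht -!/(I1 _); clearbody I1; clear Ht.
apply: complex_ext; first by rewrite cReD cReM /=; ring.
by rewrite cImD cImM /=; case: (a <= c)%N; ring.
Qed.

Let V (k : 'I_l) (q : widx cplx n) : 'cV[R[i]]_n :=
  Pr *m wmat (upd (fun=> 0) q 1) *m ecol (tnth s k).

Let pcol_upd (k : 'I_l) x q y : pcol (upd x q y) k = pcol x k + rC (y - x q) *: V k q.
Proof.
rewrite /pcol /X wmat_upd addrA mulmxDr mulmxDl -scalemxAr -scalemxAl.
by [].
Qed.

Let V_params (k : 'I_l) b : b \notin s -> column_params (V k) (wvars cplx (tnth s k)) b.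
Proof.
move=> sb.
have bk : b != tnth s k by apply: contraNneq sb => ->; exact: mem_tnth.
have z0 p : wext (fun=> 0 : R) p = 0 by rewrite /wext; case: insub.
have VE (q : widx cplx n) t : val q = (opair b (tnth s k), t) ->
    V k q = (if t then Complex 0 (if (b <= tnth s k)%N then 1 else -1) else 1) *: ecol b.
  move=> qE; apply/matrixP => a c; rewrite ord1 /V mul_ecolE dproj_coef.
  rewrite (matrix_scaleE _ (ecol b)) ecolE.
  rewrite wmat_opair !wext_upd !z0 qE.
  have [->|ab] := eqVneq a b.
    rewrite sb mul1r mulr1; case: t {qE}; rewrite !xpair_eqE !eqxx /=.
      by case: ifP => _; rewrite ?oppr0.
    by case: ifP => _; rewrite ?oppr0.
  rewrite mulr0; have [sa|sa] := boolP (a \in s); first by rewrite mul0r.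
  have ne : (opair a (tnth s k) == opair b (tnth s k)) = false.
    apply/negP => /eqP /opairC[[E _]|[E _]]; first by rewrite E eqxx in ab.
    by rewrite E mem_tnth in sa.
  by rewrite !xpair_eqE ne /=; case: ifP => _; rewrite ?oppr0 mulr0.
have [[q wE qE]|[q1 [q2 [_ wE q1E q2E]]]] := @wvars_shape cplx n _ _ bk.
  by left; exists q => //; rewrite (VE _ _ qE) scale1r.
(* Parameters are stored above the diagonal; for an entry of the column below it, the imaginary part
   enters with a minus sign. *)
right; exists q1, q2, (if (b <= tnth s k)%N then 1 else -1); split => //.
- by apply/eqP => E; move: q1E; rewrite E q2E.
- by case: ifP => _; rewrite ?expr1n // sqrrN expr1n.
- by rewrite (VE _ _ q1E) scale1r.
- exact: (VE _ _ q2E).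
Qed.

Let sdw (q : widx cplx n) : R := wsd cplx n sigma (val q).

Let sdwE (k : 'I_l) q : q \in vars k -> sdw q = soff cplx sigma.
Proof.
move=> /flattenP[t /mapP[b]]; rewrite mem_filter => /andP[sb _] ->.
have bk : b != tnth s k by apply: contraNneq sb => ->; exact: mem_tnth.
move=> /wvars_pair qE; rewrite /sdw /wsd /soff qE.
suff -> : (opair b (tnth s k)).1 != (opair b (tnth s k)).2 by rewrite andbT.
by rewrite /opair; case: leqP => _ //=; rewrite eq_sym.
Qed.

Lemma soff_gt0 : 0 < soff cplx sigma.
Proof. by rewrite /soff; case: cplx => //; rewrite divr_gt0 // sqrtr_gt0. Qed.

Let u := 2 * lam * soff cplx sigma ^+ 2.
Let u0 : 0 <= u. Proof. by rewrite /u mulr_ge0 ?sqr_ge0 // mulr_ge0. Qed.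

(** Cost of one column: the Chernoff factor exp (lam y0) times the inverse square root of a pivot
    product that is at least (1 + u)^(T0 - 2 l). *)
Definition pivot_rate : R :=
  expR (lam * y0) * expR (- ((T0 - (2 * l)%:R) * ln (1 + u) / 2)).

(** The number [l] is lost twice: putting back the later pivot columns lowers the trace by at most 1
    each, and the [l] coordinates in [s], on which the resolvent is the identity, are not
    integrated. *)
Let trace_bound (k : 'I_l) x : T0 <= compress_trace x ->
  T0 - (2 * l)%:R <= retr (sproj sc *m pres x k).
Proof.
move=> hT.
have h1 : T0 - l%:R <= retr (pres x k).
  have := resol_retr_proj_take (Pr *m X x) k.+1 e0 us.
  rewrite size_tuple; apply: le_trans.
  by rewrite lerD2r.
have h2 : retr (pres x k) = retr (sproj sc *m pres x k) + l%:R.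
  rewrite retr_sproj retr_quad (bigID (fun b => b \in sc)) /=; congr (_ + _).
  rewrite (eq_bigr (fun=> 1)) => [|b sb]; last first.
    have {}sb : b \in s.
      by move: sb; rewrite mem_filter mem_enum andbT negbK.
    rewrite resol_fix ?inprod_ecol ?ecolE ?eqxx // !cadjM -!mulmxA.
    have -> : cadj Pr *m ecol b = 0; last by rewrite !mulmx0.
    rewrite cadj_dproj; apply/matrixP => a c; rewrite dproj_coef ecolE [RHS]mxE.
    by have [->|_] := eqVneq a b; rewrite ?sb ?mul0r ?mulr0.
  rewrite sumr_const -(size_tuple s); have /card_uniqP <- := us; congr (_%:R).
  by apply: eq_card => b; rewrite -topredE /= mem_filter mem_enum andbT negbK.
by rewrite mul2n -addnn natrD opprD addrA lerBlDr -h2.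
Qed.

Let step_pointwise (k : 'I_l) x :
  (IntL (gaussian_law sdw) (vars k) (fun x' => (H k x')%:E) x <=
   pivot_rate%:E * (H k.+1 x)%:E)%E.
Proof.
rewrite (@IntL_ext _ _ _ _ _ (fun x' => (H k.+1 x * expR (lam * y0) *
    expR (- lam * inprod (pcol x' k) (pres x k *m pcol x' k)))%:E)); last first.
  by move=> x' xx'; rewrite (H_frozen xx').
have scs b : b \in sc -> b \notin s by rewrite mem_filter => /andP[].
have hB : cadj (pres x k) = pres x k by exact: resol_herm.
have pB (z : 'cV_n) : 0 <= inprod z (pres x k *m z) by exact: resol_ge0.
have c0 : 0 <= H k.+1 x * expR (lam * y0) by rewrite mulr_ge0 ?expR_ge0.
have usc : uniq sc by rewrite filter_uniq // enum_uniq.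
apply: le_trans (@gaussian_column_bound _ _ _ _ soff_gt0 lam0 _ sdw (V k)
  (wvars cplx (tnth s k)) sc (pres x k) _ (fun x' => pcol x' k) x
  _ _ _ _ _ hB pB c0) _.
- apply: uniq_flatten_wvars => //.
  by rewrite mem_filter mem_tnth.
- by move=> b /scs; exact: V_params.
- by move=> j; exact: sdwE.
- by move=> j x' y _; exact: pcol_upd.
- exact: mmeas_PX.
rewrite -EFinM lee_fin -/u.
(* If the trace condition fails, the indicator makes both sides 0. *)
have [hT|hT] := boolP (T0 <= compress_trace x); last first.
  by rewrite /H (negPf hT) !mul0r mulr0.
rewrite /pivot_rate [leRHS]mulrC mulrA; apply: ler_wpM2l; first exact: c0.
rewrite expRN lef_pV2 ?posrE ?expR_gt0 //; last first.
  rewrite sqrtr_gt0; apply: lt_le_trans (pivot_prod_ge u0 hB pB _ usc) => //.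
    exact: expR_gt0.
  by move=> z; exact: resol_le1.
rewrite -[leLHS]ger0_norm ?expR_ge0 // -sqrtr_sqr; apply: ler_wsqrtr.
apply: le_trans (pivot_prod_ge u0 hB pB _ usc) => //; last first.
  by move=> z; exact: resol_le1.
rewrite -expRM_natl ler_expR mulrC divfK //.
rewrite ler_wpM2r ?trace_bound // ln_ge0 //.
by rewrite lerDl u0.
Qed.

Context d (T : measurableType d) (P : probability T R) (W : T -> 'M[R[i]]_n).
Hypothesis gW : gaussian_wigner P cplx n sigma W.

Let Z : widx cplx n -> T -> R := fun q => wentry W (val q).

Let indZ : indep_rvs P Z. Proof. by have [_ h _] := gW. Qed.

Let lawZ q B : measurable B -> P (Z q @^-1` B) = gaussian_law sdw q B.
Proof. by have [_ _ h] := gW => mB; exact: h. Qed.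

Let expect_H k : (k <= l)%N ->
  (\int[P]_w (H (l - k) (Z ^~ w))%:E <= (pivot_rate ^+ k)%:E)%E.
Proof.
elim: k => [|k IH] kl.
  rewrite subn0 expr0 -(@probability_setT _ _ _ P) -[leRHS]mul1e -integral_cst //.
  apply: ge0_le_integral => //.
  - by move=> w _; rewrite lee_fin.
  - exact: (vmeas_comp indZ (vmeas_H l)).
  - move=> w _; rewrite lee_fin /H big1 => [|j]; last by rewrite leqNgt ltn_ord.
    by rewrite mulr1 lern1 leq_b1.
have lt : (l - k.+1 < l)%N by rewrite ltn_subrL (leq_trans _ kl).
have E : (l - k = (l - k.+1).+1)%N by rewrite subnSK.
rewrite (expectation_IntL indZ lawZ (vars (Ordinal lt)) (vmeas_H _)); last first.
  by move=> x; rewrite lee_fin.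
apply: (@le_trans _ _ (\int[P]_w (pivot_rate%:E * (H (l - k) (Z ^~ w))%:E))%E).
  apply: ge0_le_integral => //.
  - by move=> w _; apply: IntL_ge0 => x; rewrite lee_fin.
  - apply: (vmeas_comp indZ); apply: vmeas_IntL; first exact: vmeas_H.
    by move=> x; rewrite lee_fin.
  - apply: emeasurable_funM => //; exact: (vmeas_comp indZ (vmeas_H _)).
  - by move=> w _; rewrite E; exact: step_pointwise.
have r0 : 0 <= pivot_rate by rewrite mulr_ge0 // expR_ge0.
rewrite ge0_integralZl //; last 2 first.
- exact: (vmeas_comp indZ (vmeas_H _)).
- by move=> w _; rewrite lee_fin.
rewrite exprS (EFinM pivot_rate); apply: lee_wpmul2l; first by rewrite lee_fin.
by apply: IH; exact: ltnW.
Qed.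

Definition pivot_event : set T := [set w | T0 <= compress_trace (Z ^~ w) /\
  forall j, pivot_form (Z ^~ w) j <= y0].

Lemma measurable_pivot_event : measurable pivot_event.
Proof.
have -> : pivot_event = [set w | T0 <= compress_trace (Z ^~ w)] `&`
    \bigcap_(j in [set: 'I_l]) [set w | pivot_form (Z ^~ w) j <= y0].
  apply/seteqP; split => w /= [h1 h2]; split => // j; last exact: h2.
  by move=> _; exact: h2.
have mle (f g : T -> R) : measurable_fun setT f -> measurable_fun setT g ->
    measurable [set w | f w <= g w].
  move=> mf mg; have := measurable_fun_ler mf mg.
  by move=> /(_ measurableT [set true] I); rewrite setTI.
apply: measurableI.
  by apply: mle => //; exact: (vmeas_comp indZ vmeas_compress_trace).
apply: fin_bigcap_measurable => // j _.
by apply: mle => //; exact: (vmeas_comp indZ (vmeas_pivot_form j)).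
Qed.

Lemma pivot_event_bound : (P pivot_event <= (pivot_rate ^+ l)%:E)%E.
Proof.
have := expect_H (leqnn l); rewrite subnn; apply: le_trans.
rewrite -(setIT pivot_event) -integral_indic //; last exact: measurable_pivot_event.
apply: ge0_le_integral => //.
- by apply/measurable_EFinP; apply: measurable_indic; exact: measurable_pivot_event.
- exact: (vmeas_comp indZ (vmeas_H _)).
move=> w _; rewrite lee_fin indicE.
have [|wn] := boolP (w \in pivot_event); last by rewrite H_ge0.
rewrite inE => -[h1 h2]; rewrite /H h1 mul1r.
elim/big_ind: _ => // [a b a1 b1|j _]; first by rewrite mulr_ege1.
by rewrite -expR0 ler_expR mulr_ge0 // subr_ge0.
Qed.

End SmallBallFixed.

Lemma measure_finite_union {d} {T : measurableType d} {R : realType}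
    (P : probability T R) (J : finType) (E : J -> set T) (p : R) :
  (forall j, measurable (E j)) -> (forall j, P (E j) <= p%:E)%E ->
  measurable (\big[setU/set0]_j E j) /\
  (P (\big[setU/set0]_j E j) <= (#|J|%:R * p)%:E)%E.
Proof.
move=> mE pE.
have mU (s : seq J) : measurable (\big[setU/set0]_(j <- s) E j).
  by apply: bigsetU_measurable => j _; exact: mE.
split; first exact: mU.
rewrite cardE /index_enum -enumT; elim: (enum J) => [|j s IH].
  by rewrite big_nil measure0 mul0r.
rewrite big_cons /= -natr1 mulrDl mul1r.
apply: le_trans (measureU2 P (mE j) (mU s)) _.
by apply: le_trans (leeD (pE j) IH) _; rewrite -EFinD lee_fin addrC.
Qed.

(** * Subspaces on which a shifted Wigner matrix is small *)

Section NearKernel.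
Context {R : realType}.

(* X is small on a k-dimensional subspace, the range of Y *)
Definition near_kernel (e : R) {n : nat} (k : nat) (X : 'M[R[i]]_n) : Prop :=
  exists Y : 'M[R[i]]_(n, k), (forall z : 'cV_k, Y *m z = 0 -> z = 0) /\
    forall z : 'cV_k, inprod (X *m (Y *m z)) (X *m (Y *m z)) <=
                      e * inprod (Y *m z) (Y *m z).

(* Small enough that the rate of one pivot step, about e^(3k) sb_const^(k/8), is at most e^(-10k). *)
Definition sb_const : R := expR (- 104).

(** The square of e^-52 sigma k / sqrt n. The k-th smallest absolute eigenvalue of an unshifted
    Wigner matrix is of order sigma k / sqrt n, so a k-dimensional subspace this far below that
    level is very unlikely. *)
Definition sb_eps (n k : nat) (sigma : R) : R :=
  sb_const * sigma ^+ 2 * k%:R ^+ 2 / n%:R.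

(** The choice lam = 1 / (sb_const sigma^2) cancels [n] and [sigma]: lam y0 = k^2 / (k/2 - l) <= 3
    k, while 1 + u >= e^104 and T0 - 2 l >= k/4, so the exponent is at most 3 k - 13 k. *)
Lemma pivot_rate_le (cplx : bool) (n k : nat) (sigma : R) : (0 < n)%N ->
  (8 <= k)%N -> 0 < sigma ->
  pivot_rate cplx (k %/ 8) (sb_const * sigma ^+ 2)^-1
    (sb_eps n k sigma * n%:R / (k%:R / 2 - (k %/ 8)%:R)) sigma (k%:R / 2) <=
  expR (- (10 * k%:R)).
Proof.
move=> n0 k8 s0; rewrite /pivot_rate -expRD ler_expR.
have c0 : 0 < sb_const by exact: expR_gt0.
have k0 : 0 < k%:R :> R by rewrite ltr0n (leq_trans _ k8).
have l8 : (k %/ 8)%:R <= k%:R / 8 :> R.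
  by rewrite ler_pdivlMr // -natrM ler_nat leq_divM.
have cs0 : 0 < sb_const * sigma ^+ 2 by rewrite mulr_gt0 // exprn_gt0.
set q := k%:R / 2 - _.
have q0 : 3 / 8 * k%:R <= q by rewrite /q; lra.
have qp : 0 < q by apply: lt_le_trans q0; rewrite mulr_gt0.
have -> : (sb_const * sigma ^+ 2)^-1 * (sb_eps n k sigma * n%:R / q) = k%:R ^+ 2 / q.
  rewrite /sb_eps; field.
  by rewrite !gt_eqF // ltr0n.
have h1 : k%:R ^+ 2 / q <= 3 * k%:R.
  rewrite ler_pdivrMr //.
  by have := mulr_ge0 (ltW k0) (ltW k0); nra.
set u := 2 * _ * _.
have hu : sb_const^-1 <= u.
  rewrite /u /soff; case: (cplx) => /=.
    rewrite expr_div_n sqr_sqrtr //.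
    by rewrite le_eqVlt; apply/orP; left; apply/eqP; field; rewrite !gt_eqF.
  have -> : 2 * (sb_const * sigma ^+ 2)^-1 * sigma ^+ 2 = sb_const^-1 + sb_const^-1.
    by field; rewrite !gt_eqF.
  by rewrite lerDl invr_ge0 ltW.
have hl : 104 <= ln (1 + u).
  rewrite -[leLHS]expRK ler_ln ?posrE ?expR_gt0 //.
    by apply: le_trans (_ : sb_const^-1 <= _);
      [rewrite /sb_const -expRN opprK|rewrite (le_trans hu) // lerDr].
  by rewrite ltr_pwDl // (le_trans _ hu) // invr_ge0 ltW.
have ht : k%:R / 4 <= k%:R / 2 - (2 * (k %/ 8))%:R :> R.
  by rewrite natrM; lra.
have : k%:R / 4 * 104 <= (k%:R / 2 - (2 * (k %/ 8))%:R) * ln (1 + u).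
  by apply: ler_pM => //; apply: divr_ge0 => //; exact: ltW.
move: h1 k0; move: (_ * ln _) (k%:R ^+ 2 / q); move: (k%:R : R) => K a b; clear.
by lra.
Qed.

(** The event [E] is a measurable cover, the union of the pivot events over all n^(k/8) index
    tuples; measurability of [near_kernel], an existential statement over [Y], never comes into
    question. The trace level k/2 is that of [resol_retr_near_kernel]. *)
Lemma near_kernel_bound (cplx : bool) (n k : nat) (sigma : R) (M : 'M[R[i]]_n)
    {d} {T : measurableType d} (P : probability T R) (W : T -> 'M[R[i]]_n) :
  (0 < n)%N -> (8 <= k)%N -> 0 < sigma -> cadj M = M ->
  gaussian_wigner P cplx n sigma W ->
  exists E : set T, [/\ measurable E,
    (P E <= (n%:R ^+ (k %/ 8) * expR (- (10 * k%:R)) ^+ (k %/ 8))%:E)%E &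
    forall w, near_kernel (sb_eps n k sigma) k (M + W w) -> E w].
Proof.
move=> n0 k8 s0 hM gW.
set l := (k %/ 8)%N; set e := sb_eps n k sigma.
have c0 : 0 < sb_const by exact: expR_gt0.
have k0 : 0 < k%:R :> R by rewrite ltr0n (leq_trans _ k8).
have e0 : 0 < e.
  by apply: divr_gt0; rewrite ?ltr0n //; apply: mulr_gt0; [apply: mulr_gt0 => //|]; exact: exprn_gt0.
have lam0 : 0 <= (sb_const * sigma ^+ 2)^-1.
  by rewrite invr_ge0; apply: mulr_ge0; [exact: ltW|exact: sqr_ge0].
set y0 := e * n%:R / (k%:R / 2 - l%:R).
pose Ev (s : l.-tuple 'I_n) := if uniq s then
  pivot_event cplx M s e y0 (k%:R / 2) W else set0.
have mEv s : measurable (Ev s).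
  rewrite /Ev; case: (boolP (uniq s)) => us; last exact: measurable0.
  exact: (measurable_pivot_event M s y0 (k%:R / 2) e0 gW).
have pEv s : (P (Ev s) <= (expR (- (10 * k%:R)) ^+ l)%:E)%E.
  rewrite /Ev; case: (boolP (uniq s)) => us; last first.
    by rewrite measure0 lee_fin exprn_ge0 // expR_ge0.
  apply: le_trans (pivot_event_bound M y0 (k%:R / 2) us e0 lam0 s0 gW) _.
  rewrite lee_fin; apply: lerXn2r; rewrite ?nnegrE ?expR_ge0 //.
    by rewrite mulr_ge0 // expR_ge0.
  exact: pivot_rate_le.
have [mU pU] := @measure_finite_union _ _ _ P _ Ev _ mEv pEv.
exists (\big[setU/set0]_s Ev s); split => //.
  by move: pU; rewrite card_tuple card_ord natrX.
move=> w [Y [injY hY]].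
have [_ _] := gW; have [hW _ _] := gW.
have hX : cadj (M + W w) = M + W w by rewrite cadjD hM; have [_ ->] := hW w.
have ht := resol_retr_near_kernel e0 hX injY hY.
have lk : l%:R < k%:R / 2 :> R.
  have : l%:R <= k%:R / 8 :> R.
    by rewrite ler_pdivlMr // -natrM ler_nat leq_divM.
  by move: k0; move: (k%:R : R) (l%:R : R) => a b; clear; lra.
have [s [us h1 h2]] := greedy_selection e0 n0 hX lk ht.
rewrite -bigcup_seq /=; exists s; first by rewrite /= mem_index_enum.
rewrite /Ev us; split; rewrite /compress_trace /pivot_form /= wmat_wentry //.
Qed.

End NearKernel.

(** * Norm of a Wigner matrix *)

Section GaussianLinear.
Context {R : realType}.

Lemma IntL_exp_linear {I : finType} (sd c : I -> R) (s : seq I) (a : R) x :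
  (forall i, 0 < sd i) -> uniq s -> 0 <= a ->
  IntL (gaussian_law sd) s (fun x => (a * expR (\sum_(i <- s) c i * x i))%:E) x =
  (a * expR (\sum_(i <- s) c i ^+ 2 * sd i ^+ 2 / 2))%:E.
Proof.
move=> sd0; elim: s a x => [|i s IH] a x /=; first by rewrite !big_nil.
move=> /andP[ins us] a0.
rewrite big_cons expRD mulrA -(IH _ x) //; last by rewrite mulr_ge0 // expR_ge0.
apply: IntL_ext => x' _.
rewrite /Int1 /gaussian_law.
transitivity (\int[normal_prob 0 (sd i)]_y
  ((a * expR (\sum_(j <- s) c j * x' j))%:E *
   (expR (- (0 * y ^+ 2 + (- c i) * y)))%:E))%E.
  apply: eq_integral => y _; rewrite -EFinM big_cons /upd eqxx expRD.
  congr (_%:E); rewrite mul0r add0r mulNr opprK [expR (c i * y) * _]mulrC mulrA.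
  congr (_ * expR _ * _); apply: eq_big_seq => j js.
  by case: eqP => // ji; rewrite -ji js in ins.
rewrite ge0_integralZl //; last 2 first.
- apply/measurable_EFinP; apply: measurableT_comp => //.
  apply: measurable_funN; apply: measurable_funD.
    by apply: measurable_funM => //; exact: measurable_funX.
  by apply: measurable_funM.
- by rewrite lee_fin mulr_ge0 // expR_ge0.
rewrite normal_prob_exp_quad // -EFinM; congr (_%:E).
rewrite mulr0 mul0r addr0 sqrtr1 invr1 mul1r sqrrN mulr1 -!mulrA; congr (_ * _).
exact: mulrC.
Qed.

Lemma gaussian_linear_tail {d} {T : measurableType d} (P : probability T R)
    {I : finType} (X : I -> T -> R) (sd c : I -> R) (V t : R) :
  indep_rvs P X ->
  (forall i B, measurable B -> P (X i @^-1` B) = gaussian_law sd i B) ->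
  (forall i, 0 < sd i) -> 0 < V -> 0 <= t ->
  \sum_i c i ^+ 2 * sd i ^+ 2 <= V ->
  measurable [set w | t <= \sum_i c i * X i w] /\
  (P [set w | (t <= \sum_i c i * X i w)%R] <= (expR (- (t ^+ 2 / (2 * V))))%:E)%E.
Proof.
move=> indX lawX sd0 V0 t0 hV.
have mS : measurable_fun setT (fun w => \sum_i c i * X i w).
  apply: measurable_sum => i; apply: measurable_funM => //.
  by have [h _] := indX; exact: h.
have mE : measurable [set w | t <= \sum_i c i * X i w].
  have := measurable_fun_ler (@measurable_cst _ _ T R setT t) mS.
  by move=> /(_ measurableT [set true] Logic.I); rewrite setTI.
split=> //.
(* The optimal exponent in Chernoff's bound for variance [V]. *)
pose th := t / V.
have th0 : 0 <= th by rewrite divr_ge0 // ltW.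
pose h (x : I -> R) := (expR (- (th * t)) *
  expR (\sum_(i <- enum I) (th * c i) * x i))%:E.
have mh : vmeas h.
  apply/measurable_EFinP; apply: measurable_funM => //.
  apply: measurableT_comp => //.
  apply: measurable_sum => i; apply: measurable_funM => //.
  exact: (measurable_tnth (T := measurableTypeR R) (enum_rank i)).
have h0 x : (0 <= h x)%E by rewrite lee_fin mulr_ge0 // expR_ge0.
apply: (@le_trans _ _ (\int[P]_w h (X ^~ w))%E).
  rewrite -(setIT [set w | _]) -integral_indic //.
  apply: ge0_le_integral => //.
  - by apply/measurable_EFinP; exact: measurable_indic.
  - exact: (vmeas_comp indX mh).
  move=> w _; rewrite lee_fin indicE.
  have [|_] := boolP (w \in _); last by rewrite mulr_ge0 // expR_ge0.
  rewrite inE /= => tw; rewrite -expRD -expR0 ler_expR big_enum /=.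
  have -> : \sum_i th * c i * X i w = th * \sum_i c i * X i w.
    by rewrite mulr_sumr; apply: eq_bigr => i _; rewrite mulrA.
  by rewrite addrC subr_ge0 ler_wpM2l.
rewrite (expectation_IntL indX lawX (enum I) mh h0).
under eq_integral => w _.
  rewrite IntL_exp_linear ?enum_uniq ?expR_ge0 //.
  over.
rewrite integral_cst //= probability_setT mule1 lee_fin -expRD ler_expR.
rewrite big_enum /=.
have -> : \sum_i (th * c i) ^+ 2 * sd i ^+ 2 / 2 =
    th ^+ 2 / 2 * \sum_i c i ^+ 2 * sd i ^+ 2.
  by rewrite mulr_sumr; apply: eq_bigr => i _; ring.
have : th ^+ 2 / 2 * (\sum_i c i ^+ 2 * sd i ^+ 2) <= th ^+ 2 / 2 * V.
  by apply: ler_wpM2l hV; apply: divr_ge0 => //; exact: sqr_ge0.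
have -> : th ^+ 2 / 2 * V = t ^+ 2 / (2 * V).
  by rewrite /th; field; rewrite gt_eqF.
have -> : th * t = t ^+ 2 / (2 * V) + t ^+ 2 / (2 * V).
  by rewrite /th; field; rewrite gt_eqF.
by move: (_ / (2 * V)) (_ * (\sum_i _)) => p q; clear; lra.
Qed.

End GaussianLinear.

Section WignerLinear.
Context {R : realType} {cplx : bool} {n : nat}.
Implicit Types (x : widx cplx n -> R) (q : widx cplx n).

Let wdelta q : widx cplx n -> R := upd (fun=> 0) q 1.

Lemma wext_sum x p : wext x p = \sum_q x q * wext (wdelta q) p.
Proof.
rewrite {1}/wext; case: insubP => [q0 _ q0p|np].
  rewrite (bigD1 q0) //= wext_upd q0p eqxx mulr1 big1 ?addr0 // => q qq0.
  rewrite wext_upd -q0p (inj_eq val_inj) eq_sym (negPf qq0) /wext valK.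
  by rewrite mulr0.
rewrite big1 // => q _; rewrite /wext insubN ?mulr0 //.
Qed.

Lemma inprod_wmat (Z : 'M[R[i]]_n) x :
  inprod Z (wmat x) = \sum_q inprod Z (wmat (wdelta q)) * x q.
Proof.
have -> : wmat x = \sum_q rC (x q) *: wmat (wdelta q).
  apply/matrixP => a c; rewrite summxE.
  rewrite (eq_bigr (fun q => rC (x q) * wmat (wdelta q) a c)); last first.
    by move=> q _; exact: matrix_scaleE.
  rewrite wmat_opair; apply: complex_ext; rewrite /= ?cRe_sum ?cIm_sum.
    rewrite wext_sum; apply: eq_bigr => q _.
    by rewrite wmat_opair cReM /= mul0r subr0.
  have -> : (if (a <= c)%N then wext x (opair a c, true)
             else - wext x (opair a c, true)) =
      (if (a <= c)%N then 1 else -1) * wext x (opair a c, true).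
    by case: ifP => _; rewrite ?mul1r ?mulN1r.
  rewrite wext_sum mulr_sumr; apply: eq_bigr => q _.
  rewrite wmat_opair cImM /= mul0r addr0.
  by case: ifP => _; rewrite ?mul1r ?mulN1r ?mulrN.
by rewrite inprod_sumr; apply: eq_bigr => q _; rewrite inprodZr mulrC.
Qed.

Lemma wext_sqr_sum x : \sum_p wext x p ^+ 2 = \sum_q x q ^+ 2.
Proof.
rewrite (bigID (widx_pred cplx n)) /= [X in _ + X]big1 ?addr0; last first.
  by move=> p np; rewrite /wext insubN // expr0n.
rewrite (big_sub (widx_pred cplx n) (fun p => wext x p ^+ 2)).
by apply: eq_bigr => q _; rewrite /wext valK.
Qed.

(** Each stored parameter occurs in at most two entries, whence the factor 2. *)
Lemma inprod_wmat_le x : inprod (wmat x) (wmat x) <= 2 * \sum_q x q ^+ 2.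
Proof.
pose f p := wext x (p, false) ^+ 2 + wext x (p, true) ^+ 2.
have f0 p : 0 <= f p by rewrite addr_ge0 ?sqr_ge0.
have fE : \sum_q x q ^+ 2 = \sum_a \sum_c f (a, c).
  rewrite -wext_sqr_sum pair_big /=.
  rewrite [RHS](eq_bigr (fun p => \sum_b wext x (p, b) ^+ 2)); last first.
    by move=> [a c] _; rewrite big_bool /f addrC.
  by rewrite pair_bigA /=; apply: eq_bigr => -[].
have le1 (a c : 'I_n) : f (opair a c) <= f (a, c) + f (c, a).
  by rewrite /opair; case: ifP => _; rewrite ?lerDl ?lerDr.
rewrite inprodE fE.
apply: (@le_trans _ _ (\sum_a \sum_c (f (a, c) + f (c, a)))).
  apply: ler_sum => a _; apply: ler_sum => c _; apply: le_trans (le1 a c).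
  rewrite wmat_opair /= /f -!expr2 lerD2l.
  by case: ifP => _ //; rewrite sqrrN.
under eq_bigr do rewrite big_split /=.
by rewrite big_split /= [X in _ + X]exchange_big /= -mulr2n mulr_natl.
Qed.

Lemma wmat_variance (sigma : R) (Z : 'M[R[i]]_n) : 0 < sigma ->
  \sum_q inprod Z (wmat (wdelta q)) ^+ 2 * wsd cplx n sigma (val q) ^+ 2 <=
  2 * sigma ^+ 2 * inprod Z Z.
Proof.
move=> s0; pose sd q := wsd cplx n sigma (val q).
pose c q := inprod Z (wmat (wdelta q)).
have sdle q : sd q ^+ 2 <= sigma ^+ 2.
  rewrite /sd /wsd; case: ifP => // _; rewrite expr_div_n sqr_sqrtr //.
  by rewrite ler_pdivrMr // ler_peMr ?sqr_ge0 // ler1n.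
set V := \sum_q _.
have V0 : 0 <= V by apply: sumr_ge0 => q _; apply: mulr_ge0; exact: sqr_ge0.
(* duality: V is the pairing of Z with the element u below, whose norm is O(V) *)
pose u q := c q * sd q ^+ 2.
have VE : V = inprod Z (wmat u).
  by rewrite inprod_wmat; apply: eq_bigr => q _; rewrite /u /c /sd; ring.
have uV : inprod (wmat u) (wmat u) <= 2 * sigma ^+ 2 * V.
  apply: le_trans (inprod_wmat_le u) _; rewrite -mulrA; apply: ler_wpM2l => //.
  rewrite mulr_sumr; apply: ler_sum => q _; rewrite /u exprMn [leRHS]mulrCA -/(c q) -/(sd q).
  apply: ler_wpM2l; first exact: sqr_ge0.
  by rewrite expr2; apply: ler_wpM2r; [exact: sqr_ge0|exact: sdle].
have := inprod_CS Z (wmat u); rewrite -VE => h.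
have h2 : V ^+ 2 <= inprod Z Z * (2 * sigma ^+ 2 * V).
  by apply: le_trans h _; apply: ler_wpM2l uV; exact: inprod_ge0.
have [V1|V1] := eqVneq V 0.
  by rewrite V1; apply: mulr_ge0; [apply: mulr_ge0 => //; exact: sqr_ge0|exact: inprod_ge0].
have Vp : 0 < V by rewrite lt_def V1.
rewrite -(ler_pM2r Vp) -expr2; apply: le_trans h2 _.
by rewrite le_eqVlt; apply/orP; left; apply/eqP; ring.
Qed.

(** The bilinear form is the pairing of [W] with the rank-one matrix y v^*, hence linear in the
    independent parameters, with variance at most 2 sigma^2 B^2 by [wmat_variance]. *)
Lemma wigner_bilinear_tail {d} {T : measurableType d} (P : probability T R)
    (sigma t B : R) (W : T -> 'M[R[i]]_n) (y v : 'cV[R[i]]_n) :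
  0 < sigma -> 0 <= t -> 0 < B ->
  inprod y y <= B -> inprod v v <= B -> gaussian_wigner P cplx n sigma W ->
  measurable [set w | t <= inprod y (W w *m v)] /\
  (P [set w | (t <= inprod y (W w *m v))%R] <=
     (expR (- (t ^+ 2 / (4 * sigma ^+ 2 * B ^+ 2))))%:E)%E.
Proof.
move=> s0 t0 B0 yB vB [hW indW lawW].
pose Z := y *m cadj v.
pose c q := inprod Z (wmat (wdelta q)).
have E w : inprod y (W w *m v) = \sum_q c q * wentry W (val q) w.
  rewrite -inprod_wmat wmat_wentry; last exact: hW.
  by rewrite /Z inprod_mulr cadjK.
have sd0 (q : widx cplx n) : 0 < wsd cplx n sigma (val q).
  by rewrite /wsd; case: ifP => _ //; rewrite divr_gt0 // sqrtr_gt0.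
have V0 : 0 < 2 * sigma ^+ 2 * B ^+ 2.
  by apply: mulr_gt0; [apply: mulr_gt0 => //|]; exact: exprn_gt0.
have ZZ : inprod Z Z <= B ^+ 2.
  rewrite -frob_sqr; apply: (@le_trans _ _ ((frob y * frob v) ^+ 2)).
    rewrite ler_sqr ?nnegrE ?mulr_ge0 ?frob_ge0 //.
    by rewrite -(frob_cadj v); exact: frobM.
  rewrite exprMn !frob_sqr expr2.
  by apply: ler_pM => //; exact: inprod_ge0.
have hV : \sum_q c q ^+ 2 * wsd cplx n sigma (val q) ^+ 2 <= 2 * sigma ^+ 2 * B ^+ 2.
  apply: le_trans (wmat_variance Z s0) _; apply: ler_wpM2l ZZ.
  by apply: mulr_ge0 => //; exact: sqr_ge0.
have lawW' (q : widx cplx n) A : measurable A -> P (wentry W (val q) @^-1` A) =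
    gaussian_law (fun q : widx cplx n => wsd cplx n sigma (val q)) q A.
  by move=> mA; exact: lawW.
have := gaussian_linear_tail indW lawW' sd0 V0 t0 hV.
have -> : 4 * sigma ^+ 2 * B ^+ 2 = 2 * (2 * sigma ^+ 2 * B ^+ 2) by ring.
by under eq_set do rewrite -E.
Qed.

End WignerLinear.

Section SpectralNorm.
Context {R : realType} (cplx : bool).

Lemma ratio_has_sup p q p' q' (f : 'M[R[i]]_(p, q) -> 'M[R[i]]_(p', q')) (c : R)
    (x0 : 'M[R[i]]_(p, q)) :
  Kmat cplx x0 -> x0 != 0 -> (forall x, Kmat cplx x -> frob (f x) <= c * frob x) ->
  has_sup [set frob (f x) / frob x | x in [set x | Kmat cplx x /\ x != 0]].
Proof.
move=> Kx0 x00 hf; split; first by exists (frob (f x0) / frob x0), x0.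
exists c => _ [x [Kx x0']] <-.
by rewrite ler_pdivrMr ?frob_gt0 // hf.
Qed.

Lemma specnorm_ge n (M : 'M[R[i]]_n) (x : 'cV[R[i]]_n) : Kmat cplx x ->
  frob (M *m x) <= specnorm cplx M * frob x.
Proof.
move=> Kx; have [->|x0] := eqVneq x 0; first by rewrite mulmx0 !frob0 mulr0.
rewrite -ler_pdivrMr ?frob_gt0 //; apply: sup_ubound; last by exists x.
have [_ h] := ratio_has_sup Kx x0 (fun x _ => frob_mulcV M x); exact: h.
Qed.

Lemma specnorm_le n (M : 'M[R[i]]_n) (c : R) : 0 <= c ->
  (forall x : 'cV_n, Kmat cplx x -> frob (M *m x) <= c * frob x) -> specnorm cplx M <= c.
Proof.
move=> c0 h; rewrite /specnorm; set S := [set _ | _ in _].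
have [[y Sy]|S0] := pselect (S !=set0).
  apply: ge_sup; first by exists y.
  by move=> _ [x [Kx x0] <-]; rewrite ler_pdivrMr ?frob_gt0 // h.
(* Without nonzero vectors, as for n = 0, the supremum of the empty set is 0 by convention. *)
have -> : S = set0 by apply/seteqP; split => // y Sy; apply: S0; exists y.
by rewrite sup0.
Qed.

Lemma specnorm_ge0 n (M : 'M[R[i]]_n) : 0 <= specnorm cplx M.
Proof.
rewrite /specnorm; set S := [set _ | _ in _].
have [[y Sy]|S0] := pselect (S !=set0); last first.
  have -> : S = set0 by apply/seteqP; split => // y Sy; apply: S0; exists y.
  by rewrite sup0.
have [x [Kx x0] _] := Sy.
have [_ h] := ratio_has_sup Kx x0 (fun x _ => frob_mulcV M x).
apply: le_trans (ub_le_sup h Sy).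
by have [z _ <-] := Sy; rewrite divr_ge0 ?frob_ge0.
Qed.

End SpectralNorm.

(** * Lattice points and nets of the unit ball *)

Section Grid.
Context {R : realType}.

Definition grid (N : nat) (j : 'I_(2 * N).+1) : R := j%:R - N%:R.

Lemma grid_round (N : nat) (r : R) : `|r| <= N%:R ->
  exists j : 'I_(2 * N).+1, `|r - grid j| <= 1.
Proof.
rewrite ler_norml => /andP[rl ru].
have h0 : 0 <= r + N%:R by rewrite -lerBlDr sub0r.
have /andP[tl tu] := Num.Theory.truncn_itv h0.
set tr := Num.Def.trunc _ in tl tu.
have trN : (tr < (2 * N).+1)%N.
  rewrite ltnS -(ler_nat R); apply: le_trans tl _.
  by rewrite mul2n -addnn natrD lerD2r.
exists (Ordinal trN); rewrite /grid /=.
rewrite -natr1 in tu; rewrite ler_norml; move: tl tu.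
by move: (tr%:R : R) (N%:R : R) => a b; clear; lra.
Qed.

(** Since exp (- j^2) <= 2^-|j| for integers j, both halves are dominated by geometric series: at
    most 2 for j >= 0 and at most 1 for j < 0. *)
Lemma grid_weight (N : nat) : \sum_(j < (2 * N).+1) expR (- grid j ^+ 2) <= 3.
Proof.
pose g (j : nat) : R := expR (- (j%:R - N%:R) ^+ 2).
have e2 (a : R) (k : nat) : a ^+ 2 = k%:R ^+ 2 -> expR (- a ^+ 2) <= 2^-1 ^+ k.
  move=> ->; apply: (@le_trans _ _ (expR (- 1) ^+ k)).
    rewrite -expRM_natl ler_expR mulrN1 lerN2 -natrX ler_nat.
    by case: k => // k; rewrite expnS expn1 leq_pmulr.
  apply: lerXn2r; rewrite ?nnegrE ?expR_ge0 ?invr_ge0 //.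
  rewrite expRN lef_pV2 ?posrE ?expR_gt0 //.
  by have := expR_ge1Dx (1 : R); lra.
have geo (m : nat) : \sum_(j < m) (2^-1 : R) ^+ j <= 2.
  suff -> : \sum_(j < m) (2^-1 : R) ^+ j = 2 - 2 * 2^-1 ^+ m.
    by rewrite lerBlDr lerDl mulr_ge0 // exprn_ge0 // invr_ge0.
  elim: m => [|m IH]; first by rewrite big_ord0 expr0; ring.
  by rewrite big_ord_recr /= IH exprS; field.
rewrite -(big_mkord xpredT g) (@big_cat_nat _ _ _ N) //=; last first.
  by rewrite mul2n -addnn -addnS leq_addr.
have h1 : \sum_(0 <= j < N) g j <= 1.
  rewrite big_nat_rev /= add0n big_mkord.
  apply: (@le_trans _ _ (\sum_(j < N) 2^-1 ^+ j.+1)).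
    apply: ler_sum => j _; apply: e2.
    rewrite natrB ?ltn_ord // -sqrrN; congr (_ ^+ 2); ring.
  under eq_bigr do rewrite exprS.
  by rewrite -mulr_sumr -ler_pdivlMl ?invr_gt0 // invrK mulr1.
have h2 : \sum_(N <= j < (2 * N).+1) g j <= 2.
  have -> : (2 * N).+1 = (N.+1 + N)%N by rewrite mul2n -addnn addSn.
  rewrite -{1}(add0n N) big_addn addnK big_mkord; apply: le_trans (geo N.+1).
  apply: ler_sum => j _; apply: e2; rewrite natrD; congr (_ ^+ 2); ring.
by move: h1 h2; move: (\sum_(_ <= _ < _) _) (\sum_(_ <= _ < _) _) => a b; clear; lra.
Qed.

(** The indicator of the ball is at most exp (D - |z|^2), which factors over the coordinates, each
    contributing at most 3 <= e^2. Counting the whole cube, with [N] of order n, would put an extra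
    log n into the exponent. *)
Lemma card_grid_ball (N D : nat) (I : finType) :
  #|[pred z : {ffun I -> 'I_(2 * N).+1} | \sum_p grid (z p) ^+ 2 <= D%:R]|%:R <=
  expR (D%:R + 2 * #|I|%:R) :> R.
Proof.
rewrite -sum1_card natr_sum.
apply: (@le_trans _ _ (\sum_(z : {ffun I -> 'I_(2 * N).+1})
    expR D%:R * \prod_p expR (- grid (z p) ^+ 2))).
  rewrite big_mkcond; apply: ler_sum => z _.
  have e : expR D%:R * \prod_p expR (- grid (z p) ^+ 2) =
      expR (D%:R - \sum_p grid (z p) ^+ 2).
    by rewrite expRD -sumrN expR_sum.
  rewrite e; case: ifP => [|_]; last exact: expR_ge0.
  rewrite inE => zD; apply: (@le_trans _ _ (expR 0)); first by rewrite expR0.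
  by rewrite ler_expR subr_ge0.
rewrite -mulr_sumr -(bigA_distr_bigA (fun _ j => expR (- grid j ^+ 2))) /=.
rewrite expRD; apply: ler_wpM2l; first exact: expR_ge0.
rewrite prodr_const cardT -cardE mulrC expRM_natl.
apply: lerXn2r; rewrite ?nnegrE ?expR_ge0 //.
  by apply: sumr_ge0 => j _; exact: expR_ge0.
apply: le_trans (grid_weight N) _.
by have := expR_ge1Dx (2 : R); lra.
Qed.

Definition bvec (n N : nat) (h : R) (z : {ffun 'I_n * bool -> 'I_(2 * N).+1}) : 'cV[R[i]]_n :=
  \col_a Complex (h * grid (z (a, false))) (h * grid (z (a, true))).

Lemma inprod_bvec (n N : nat) (h : R) (z : {ffun 'I_n * bool -> 'I_(2 * N).+1}) :
  inprod (bvec h z) (bvec h z) = h ^+ 2 * \sum_p grid (z p) ^+ 2.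
Proof.
have -> : \sum_p grid (z p) ^+ 2 = \sum_a \sum_b grid (z (a, b)) ^+ 2.
  by rewrite pair_bigA /=; apply: eq_bigr => -[].
rewrite inprodE mulr_sumr; apply: eq_bigr => a _.
by rewrite big_ord1 big_bool !mxE /=; ring.
Qed.

Lemma bvec_round (n N : nat) (h : R) (v : 'cV[R[i]]_n) : 0 < h -> h^-1 <= N%:R ->
  inprod v v <= 1 -> exists z : {ffun 'I_n * bool -> 'I_(2 * N).+1},
    inprod (v - bvec h z) (v - bvec h z) <= h ^+ 2 * (2 * n)%:R.
Proof.
move=> h0 hN v1.
pose co (p : 'I_n * bool) := if p.2 then complex.Im (v p.1 0) else complex.Re (v p.1 0).
have co1 p : `|co p| <= 1.
  rewrite -(@ler_sqr _ `|co p| 1) ?nnegrE // expr1n real_normK ?num_real //.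
  apply: le_trans v1; rewrite inprodE (bigD1 p.1) //= big_ord1.
  have rest : 0 <= \sum_(i < n | i != p.1) \sum_(j < 1)
     (complex.Re (v i j) * complex.Re (v i j) + complex.Im (v i j) * complex.Im (v i j)).
    by apply: sumr_ge0 => a _; apply: sumr_ge0 => c _; rewrite -!expr2 addr_ge0 ?sqr_ge0.
  rewrite -!expr2 /co; move: rest; move: (\sum_(_ | _) _) => rest.
  move: (sqr_ge0 (complex.Re (v p.1 0))) (sqr_ge0 (complex.Im (v p.1 0))).
  by case: p.2; move: (_ ^+ 2) (_ ^+ 2) => x y; clear; lra.
have rp p : exists j : 'I_(2 * N).+1, `|co p / h - grid j| <= 1.
  apply: grid_round; rewrite normrM [`|h^-1|]gtr0_norm ?invr_gt0 //.
  apply: le_trans hN; rewrite ler_piMl // invr_ge0; exact: ltW.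
have [z hz] := choice rp.
have hz2 p : (co p - h * grid (z p)) ^+ 2 <= h ^+ 2.
  have -> : co p - h * grid (z p) = h * (co p / h - grid (z p)).
    by field; rewrite gt_eqF.
  rewrite exprMn ler_piMr ?sqr_ge0 // -real_normK ?num_real //.
  by rewrite expr_le1.
exists [ffun p => z p]; rewrite inprodE.
apply: (@le_trans _ _ (\sum_(a < n) (h ^+ 2 + h ^+ 2))).
  apply: ler_sum => a _; rewrite big_ord1 !mxE !ffunE -!expr2.
  have cImN (u : R[i]) : complex.Im (- u) = - complex.Im u by case: u.
  rewrite !(cReD, cReN, cImD, cImN) /=.
  by apply: lerD; [exact: (hz2 (a, false))|exact: (hz2 (a, true))].
by rewrite sumr_const card_ord -mulr_natr natrM; lra.
Qed.

End Grid.

Section WignerNorm.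
Context {R : realType} {cplx : bool} {n : nat}.

(** Rounding moves a unit vector by at most 1/4 and leaves its norm at most 5/4, so the norm s
    satisfies s <= t + (1/4) (5/4) s + (1/4) s = t + 9 s / 16. *)
Lemma specnorm_net (h t : R) (N : nat) (M : 'M[R[i]]_n) :
  0 < h -> h^-1 <= N%:R -> h ^+ 2 * (2 * n)%:R <= 16^-1 -> 0 <= t ->
  (forall z z' : {ffun 'I_n * bool -> 'I_(2 * N).+1},
     h ^+ 2 * \sum_p grid (z p) ^+ 2 <= 25 / 16 -> h ^+ 2 * \sum_p grid (z' p) ^+ 2 <= 25 / 16 ->
     inprod (bvec h z) (M *m bvec h z') <= t) ->
  specnorm true M <= 16 / 7 * t.
Proof.
move=> h0 hN hn t0 ht; set s := specnorm true M.
have s0 : 0 <= s by exact: specnorm_ge0.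
have Kt p q (x : 'M[R[i]]_(p, q)) : Kmat true x by [].
have opM (x : 'cV[R[i]]_n) : frob (M *m x) <= s * frob x by exact: specnorm_ge.
have rnd (v : 'cV[R[i]]_n) : frob v <= 1 ->
    exists z : {ffun 'I_n * bool -> 'I_(2 * N).+1},
     [/\ frob (v - bvec h z) <= 4^-1, frob (bvec h z) <= 5 / 4 &
       h ^+ 2 * \sum_p grid (z p) ^+ 2 <= 25 / 16].
  move=> v1; have v1' : inprod v v <= 1.
    by rewrite -frob_sqr expr_le1 // frob_ge0.
  have [z hz] := bvec_round h0 hN v1'; exists z.
  have d1 : frob (v - bvec h z) <= 4^-1.
    rewrite -ler_sqr ?nnegrE ?frob_ge0 // frob_sqr.
    by apply: le_trans hz _; apply: le_trans hn _; lra.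
  have d2 : frob (bvec h z) <= 5 / 4.
    have -> : bvec h z = v - (v - bvec h z) by rewrite opprB addrC subrK.
    by apply: le_trans (frobB _ _) _; lra.
  split=> //; rewrite -inprod_bvec -frob_sqr.
  have -> : 25 / 16 = (5 / 4) ^+ 2 :> R by field.
  by rewrite ler_sqr ?nnegrE ?frob_ge0.
suff key : s <= t + 9 / 16 * s by lra.
apply: specnorm_le => [|x _]; first by lra.
have [->|x0] := eqVneq x 0; first by rewrite mulmx0 !frob0 mulr0.
have xp := frob_gt0 x0.
pose x1 := rC (frob x)^-1 *: x.
have xE : x = rC (frob x) *: x1.
  by rewrite scalerA -rCM divff ?gt_eqF // scale1r.
have x11 : frob x1 = 1.
  by rewrite frobZ gtr0_norm ?invr_gt0 // mulVf // gt_eqF.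
rewrite {1}xE -scalemxAr frobZ gtr0_norm // mulrC; apply: ler_wpM2r; first exact: ltW.
have [y0|y0] := eqVneq (M *m x1) 0; first by rewrite y0 frob0; lra.
have yp := frob_gt0 y0.
pose y1 := rC (frob (M *m x1))^-1 *: (M *m x1).
have y11 : frob y1 = 1.
  by rewrite frobZ gtr0_norm ?invr_gt0 // mulVf // gt_eqF.
have -> : frob (M *m x1) = inprod y1 (M *m x1).
  by rewrite inprodZl -frob_sqr expr2 mulrA mulVf ?mul1r // gt_eqF.
have [|z [z1 z2 z3]] := rnd x1; first by rewrite x11.
have [|z' [z1' z2' z3']] := rnd y1; first by rewrite y11.
move: (ht z' z z3' z3) z1 z2 z1' z2'.
move: (bvec h z) (bvec h z') => u u' hu z1 z2 z1' z2'.
clearbody x1 y1 s.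
have -> : inprod y1 (M *m x1) = inprod u' (M *m u) +
    (inprod (y1 - u') (M *m u) + inprod y1 (M *m (x1 - u))).
  rewrite (inprodBl (M *m u)) (mulmxBr M x1 u) (inprodBr y1).
  by move: (inprod _ _) (inprod _ _) (inprod _ _) => a b c; clear; ring.
have e1 : inprod (y1 - u') (M *m u) <= 4^-1 * (s * (5 / 4)).
  apply: le_trans (inprod_le _ _) _; apply: ler_pM; rewrite ?frob_ge0 //.
  by apply: le_trans (opM u) _; exact: (ler_wpM2l s0 z2).
have e2 : inprod y1 (M *m (x1 - u)) <= s * 4^-1.
  apply: le_trans (inprod_le _ _) _; rewrite y11 mul1r.
  by apply: le_trans (opM (x1 - u)) _; exact: (ler_wpM2l s0 z1).
by move: hu e1 e2; move: (inprod _ _) (inprod _ _) (inprod _ _) => a b c; clear; lra.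
Qed.

(** At most e^(108 n) pairs of net points stand against a tail e^(- 160 n) for each pair at level 40
    sigma sqrt n; the passage from the net costs 16/7, and 40 * 16/7 < 100. The norm is taken over
    complex vectors, which serves both fields. *)
Lemma wigner_norm_bound {d} {T : measurableType d} (P : probability T R)
    (sigma : R) (W : T -> 'M[R[i]]_n) :
  (0 < n)%N -> 0 < sigma -> gaussian_wigner P cplx n sigma W ->
  exists F : set T, [/\ measurable F, (P F <= (expR (- (n%:R / 2)))%:E)%E &
    forall w, ~ F w -> specnorm true (W w) <= 100 * sigma * Num.sqrt n%:R].
Proof.
move=> n0 s0 gW.
have nr0 : 0 < n%:R :> R by rewrite ltr0n.
(* The mesh gives h^2 * 2n = 1/16, a rounding error of 1/4, and turns the squared radius 25/16 into
   50 n grid units. *)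
pose N := (8 * n)%N; pose h : R := (4 * Num.sqrt (2 * n%:R))^-1.
pose t : R := 40 * sigma * Num.sqrt n%:R.
have q0 : 0 < Num.sqrt (2 * n%:R) :> R by rewrite sqrtr_gt0 mulr_gt0.
have h0 : 0 < h by rewrite invr_gt0 mulr_gt0.
have t0 : 0 <= t by rewrite mulr_ge0 ?sqrtr_ge0 // mulr_ge0 // ltW.
have h2 : h ^+ 2 = (32 * n%:R)^-1.
  by rewrite /h exprVn exprMn sqr_sqrtr ?mulr_ge0 ?(ltW nr0) //; congr (_^-1); ring.
have hN : h^-1 <= N%:R.
  rewrite invrK /N natrM; have : Num.sqrt (2 * n%:R) <= 2 * n%:R :> R.
    rewrite -[leRHS]ger0_norm ?mulr_ge0 // -sqrtr_sqr; apply: ler_wsqrtr.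
    by rewrite expr2 ler_peMl ?mulr_ge0 // -natrM ler1n muln_gt0.
  by lra.
have hn : h ^+ 2 * (2 * n)%:R <= 16^-1.
  by rewrite h2 natrM le_eqVlt; apply/orP; left; apply/eqP; field; rewrite gt_eqF.
pose Q := [pred z : {ffun 'I_n * bool -> 'I_(2 * N).+1} |
  \sum_p (grid (z p) : R) ^+ 2 <= (50 * n)%:R].
have QE (z : {ffun 'I_n * bool -> 'I_(2 * N).+1}) : (h ^+ 2 * \sum_p (grid (z p) : R) ^+ 2 <= 25 / 16) = Q z.
  rewrite /Q /= h2 mulrC ler_pdivrMr ?mulr_gt0 // natrM.
  by congr (_ <= _); field.
pose J := {z | Q z}.
pose E (j : J * J) := [set w | t <= inprod (bvec h (val j.1)) (W w *m bvec h (val j.2))].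
have bq (j : J) : inprod (bvec h (val j)) (bvec h (val j)) <= 25 / 16.
  by rewrite inprod_bvec QE; exact: valP.
have B0 : 0 < 25 / 16 :> R by [].
have hE j := wigner_bilinear_tail s0 t0 B0 (bq j.1) (bq j.2) gW.
have pE j : (P (E j) <= (expR (- (160 * n%:R)))%:E)%E.
  have [_ hj] := hE j; apply: le_trans hj _.
  rewrite lee_fin ler_expR lerN2 /t !exprMn sqr_sqrtr ?(ltW nr0) //.
  rewrite ler_pdivlMr; last by rewrite mulr_gt0 // mulr_gt0 // exprn_gt0.
  have : 0 <= n%:R * sigma ^+ 2 :> R by rewrite mulr_ge0 ?sqr_ge0 // ltW.
  by move: (sigma ^+ 2) (n%:R) => a b; clear; nra.
have mE j : measurable (E j) by have [] := hE j.
have [mU pU] := @measure_finite_union _ _ _ P _ E _ mE pE.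
exists (\big[setU/set0]_j E j); split => //.
  apply: le_trans pU _; rewrite lee_fin card_prod card_sig natrM.
  have cQ := card_grid_ball (R := R) N (50 * n) ('I_n * bool)%type.
  rewrite card_prod card_ord card_bool in cQ.
  have cQ2 : #|Q|%:R <= expR (54 * n%:R) :> R.
    apply: (le_trans cQ); rewrite ler_expR !natrM; lra.
  apply: (@le_trans _ _ (expR (54 * n%:R) * expR (54 * n%:R) * expR (- (160 * n%:R)))).
    by apply: ler_wpM2r; [exact: expR_ge0|apply: ler_pM].
  by rewrite -!expRD ler_expR; lra.
move=> w nF; apply: (@le_trans _ _ (16 / 7 * t)); last first.
  rewrite /t; have : 0 <= sigma * Num.sqrt n%:R by rewrite mulr_ge0 ?sqrtr_ge0 // ltW.
  by rewrite -!mulrA; move: (sigma * _) => a; clear; lra.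
apply: (specnorm_net h0 hN hn t0) => z z'; rewrite !QE => Qz Qz'.
rewrite leNgt; apply/negP => lt; apply: nF.
rewrite -bigcup_seq /=; exists (exist _ z Qz, exist _ z' Qz') => /=.
  by rewrite mem_index_enum.
exact: ltW.
Qed.

End WignerNorm.

(** * Nets in the span of the constraint matrices *)

Section GramSchmidt.
Context {R : realType} {p q : nat}.
Implicit Types (E Z : 'M[R[i]]_(p, q)) (s : seq 'M[R[i]]_(p, q)).

Fixpoint ortho_family s : Prop :=
  if s is E :: s' then
    [/\ inprod E E = 1, forall F, F \in s' -> inprod E F = 0 & ortho_family s']
  else True.

Definition ortho_proj s Z := \sum_(E <- s) rC (inprod E Z) *: E.

Lemma ortho_proj_orth s Z E : ortho_family s -> E \in s ->
  inprod E (Z - ortho_proj s Z) = 0.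
Proof.
elim: s Z E => [//|F s IH] Z E [FF Fs os].
have Fp : inprod F (ortho_proj s Z) = 0.
  rewrite inprod_sumr big_seq big1 // => G Gs.
  by rewrite inprodZr Fs // mulr0.
rewrite /ortho_proj big_cons -/(ortho_proj s Z) opprD addrA inE => /orP[/eqP ->|Es].
  by rewrite !inprodBr inprodZr FF mulr1 Fp subrr subr0.
have EF : inprod E F = 0 by rewrite inprodC Fs.
have := IH Z E os Es; rewrite !inprodBr inprodZr EF mulr0 subr0.
by [].
Qed.

Lemma ortho_bessel s Z : ortho_family s ->
  \sum_(E <- s) inprod E Z ^+ 2 <= inprod Z Z.
Proof.
elim: s Z => [|F s IH] Z /=; first by rewrite big_nil inprod_ge0.
move=> [FF Fs os]; rewrite big_cons.
pose Z' := Z - rC (inprod F Z) *: F.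
have ZZ : inprod Z' Z' = inprod Z Z - inprod F Z ^+ 2.
  rewrite /Z' !(inprodBl, inprodBr) !(inprodZl, inprodZr) FF (inprodC Z F).
  by move: (inprod F Z) (inprod Z Z) => a b; clear; ring.
have -> : \sum_(E <- s) inprod E Z ^+ 2 = \sum_(E <- s) inprod E Z' ^+ 2.
  apply: eq_big_seq => E Es.
  by rewrite /Z' inprodBr inprodZr (inprodC E F) (Fs E Es) mulr0 subr0.
by rewrite addrC -lerBrDr -ZZ; exact: IH.
Qed.

(** Bessel's inequality for each of the 2 p q real unit matrices E_ab and i E_ab; summed over these
    units, the squared coefficients count the family. *)
Lemma size_ortho_family s : ortho_family s -> (size s <= 2 * (p * q))%N.
Proof.
move=> os; rewrite -(ler_nat R).
have nrm : \sum_(E <- s) inprod E E = (size s)%:R.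
  elim: s os => [|F s IH] /=; first by rewrite big_nil.
  by move=> [FF _ os]; rewrite big_cons FF IH // nat1r.
rewrite -nrm.
pose u (a : 'I_p) (b : 'I_q) (c : R[i]) : 'M[R[i]]_(p, q) := c *: delta_mx a b.
have uE a b c E : inprod E (u a b c) =
    complex.Re (E a b) * complex.Re c + complex.Im (E a b) * complex.Im c.
  have z0 : c * 0 = 0 by exact: mulr0.
  rewrite inprodE (bigD1 a) //= (bigD1 b) //= big1 => [|j jb]; last first.
    by rewrite /u mxE mxE (negPf jb) andbF z0 /= !mulr0 addr0.
  rewrite big1 => [|k ka]; last first.
    by apply: big1 => j _; rewrite /u mxE mxE (negPf ka) z0 /= !mulr0 addr0.
  by rewrite /u mxE mxE !eqxx mulr1 !addr0.
have cIi : complex.Im ('i%C : R[i]) = 1 by [].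
have cRi : complex.Re ('i%C : R[i]) = 0 by [].
have uE1 a b E : inprod E (u a b 1) = complex.Re (E a b).
  by rewrite uE /= mulr1 mulr0 addr0.
have uEi a b E : inprod E (u a b 'i%C) = complex.Im (E a b).
  by rewrite uE cIi cRi mulr1 mulr0 add0r.
have uu1 a b : inprod (u a b 1) (u a b 1) = 1 by rewrite uE1 !mxE !eqxx mulr1.
have uui a b : inprod (u a b 'i%C) (u a b 'i%C) = 1.
  by rewrite uEi !mxE !eqxx mulr1.
have bes Z : inprod Z Z = 1 -> \sum_(E <- s) inprod E Z ^+ 2 <= 1.
  by move=> <-; exact: ortho_bessel.
clearbody u.
have -> : \sum_(E <- s) inprod E E = \sum_a \sum_b
   (\sum_(E <- s) inprod E (u a b 1) ^+ 2 + \sum_(E <- s) inprod E (u a b 'i%C) ^+ 2).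
  under eq_bigr do rewrite inprodE.
  rewrite exchange_big; apply: eq_bigr => a _; rewrite exchange_big /=.
  apply: eq_bigr => b _; rewrite -big_split; apply: eq_bigr => E _.
  by rewrite uE1 uEi !expr2.
apply: (@le_trans _ _ (\sum_(a < p) \sum_(b < q) (1 + 1))).
  apply: ler_sum => a _; apply: ler_sum => b _; apply: lerD.
    exact: (bes _ (uu1 a b)).
  exact: (bes _ (uui a b)).
rewrite !sumr_const !card_ord -mulrnA -[1 + 1]/(2%:R : R) -mulrnA ler_nat.
by rewrite [(q * p)%N]mulnC leqnn.
Qed.

End GramSchmidt.

Section HermitianNet.
Context {R : realType}.

(** Gram-Schmidt for the real inner product; the coefficients are real, so Hermitian matrices stay
    Hermitian. *)
Lemma ortho_basis n (s : seq 'M[R[i]]_n) : (forall B, B \in s -> cadj B = B) ->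
  exists t : seq 'M[R[i]]_n, [/\ (size t <= size s)%N, ortho_family t,
    forall E, E \in t -> cadj E = E &
    forall B, B \in s -> ortho_proj t B = B].
Proof.
elim: s => [_|B s IH hs]; first by exists [::].
have [|t [ts ot ht pt]] := IH; first by move=> F Fs; apply: hs; rewrite inE Fs orbT.
pose D := B - ortho_proj t B.
have [D0|D0] := eqVneq D 0.
  exists t; split => //; first exact: leqW.
  move=> F; rewrite inE => /orP[/eqP ->|]; last exact: pt.
  by move/eqP: D0; rewrite subr_eq0 => /eqP.
have Dp : 0 < frob D by exact: frob_gt0.
pose E := rC (frob D)^-1 *: D.
have ED F : F \in t -> inprod E F = 0.
  by move=> Ft; rewrite inprodZl inprodC ortho_proj_orth // mulr0.
have EE : inprod E E = 1.
  rewrite inprodZl inprodZr -frob_sqr; field; rewrite gt_eqF //.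
exists (E :: t); split => //.
- move=> F; rewrite inE => /orP[/eqP ->|]; last exact: ht.
  have hp : cadj (ortho_proj t B) = ortho_proj t B.
    rewrite cadj_sum; apply: eq_big_seq => F' F't.
    by rewrite cadjZ conj_rC ht.
  by rewrite cadjZ conj_rC cadjB hp hs // mem_head.
- move=> F; rewrite /ortho_proj big_cons inE => /orP[/eqP ->|Fs].
    rewrite -/(ortho_proj t B).
    have EB : inprod E B = frob D.
      have -> : B = D + ortho_proj t B by rewrite subrK.
      rewrite inprodDr inprod_sumr big_seq big1 ?addr0 => [|F' F't]; last first.
        by rewrite inprodZr ED // mulr0.
      by rewrite inprodZl -frob_sqr; field; rewrite gt_eqF.
    by rewrite EB scalerA -rCM divff ?gt_eqF // scale1r subrK.
  rewrite -/(ortho_proj t F) pt // -{1}(pt F Fs) inprod_sumr big_seq big1.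
    by rewrite scale0r add0r.
  by move=> F' F't; rewrite inprodZr ED // mulr0.
Qed.

(** Coordinates in an orthonormal basis of the span of the A_i are rounded to a grid of step rho /
    (2 n^2). The basis has at most [m] elements, which gives the exponent, and also at most 2 n^2 by
    [size_ortho_family], so that the rounding errors add up to at most [rho]. *)
Lemma hermitian_net n m (A : 'I_m -> 'M[R[i]]_n) (kap rho : R) (G : nat) :
  (0 < n)%N -> 0 < rho -> (forall i, cadj (A i) = A i) ->
  kap * (2 * n ^ 2)%:R <= rho * G%:R ->
  exists (J : finType) (N : J -> 'M[R[i]]_n),
    [/\ (#|J| <= (2 * G).+1 ^ m)%N, forall j, cadj (N j) = N j &
      forall mu, frob (Aadj A mu) <= kap -> exists j, frob (Aadj A mu - N j) <= rho].
Proof.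
move=> n0 r0 hA hG.
have [|t [ts ot ht pt]] := @ortho_basis n [seq A i | i <- enum 'I_m].
  by move=> B /mapP[i _ ->].
rewrite size_map size_enum_ord in ts.
have d0 : 0 < (2 * n ^ 2)%:R :> R by rewrite ltr0n muln_gt0 expn_gt0 n0.
pose h : R := rho / (2 * n ^ 2)%:R.
have h0 : 0 < h by rewrite divr_gt0.
have kG : kap <= h * G%:R by rewrite /h mulrAC ler_pdivlMr.
pose N (g : {ffun 'I_(size t) -> 'I_(2 * G).+1}) : 'M[R[i]]_n :=
  \sum_i rC (h * grid (g i)) *: tnth (in_tuple t) i.
exists {ffun 'I_(size t) -> 'I_(2 * G).+1}, N; split.
- by rewrite card_ffun !card_ord leq_pexp2l.
- move=> g; rewrite cadj_sum; apply: eq_bigr => i _.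
  by rewrite cadjZ conj_rC ht // mem_tnth.
move=> mu; set Z := Aadj A mu => Zk.
have ZE : Z = \sum_i rC (inprod (tnth (in_tuple t) i) Z) *: tnth (in_tuple t) i.
  transitivity (ortho_proj t Z); last by rewrite /ortho_proj big_tnth.
  rewrite /ortho_proj {1}/Z /Aadj.
  under [RHS]eq_bigr do rewrite inprod_sumr (big_morph (@rC R) (@rCD R) (@rC0 R)) scaler_suml.
  rewrite exchange_big; apply: eq_bigr => i _ /=.
  rewrite -{1}(pt (A i)) /ortho_proj; last by apply: map_f; rewrite mem_enum.
  rewrite scaler_sumr; apply: eq_bigr => E _.
  by rewrite inprodZr rCM scalerA.
have t1 i : inprod (tnth (in_tuple t) i) (tnth (in_tuple t) i) = 1.
  have : tnth (in_tuple t) i \in t by exact: mem_tnth.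
  move: (tnth _ i) => E; clear -ot; elim: t ot => [//|F t IH] [FF _ ot].
  by rewrite inE => /orP[/eqP -> //|]; exact: IH.
have rd i : exists j : 'I_(2 * G).+1, `|inprod (tnth (in_tuple t) i) Z / h - grid j| <= 1.
  apply: grid_round; rewrite normrM [`|h^-1|]gtr0_norm ?invr_gt0 //.
  rewrite ler_pdivrMr // [leRHS]mulrC; apply: le_trans kG; apply: le_trans Zk.
  rewrite -ler_sqr ?nnegrE ?frob_ge0 // real_normK ?num_real // frob_sqr.
  by apply: le_trans (inprod_CS _ _) _; rewrite t1 mul1r.
have [g hg] := choice rd.
exists [ffun i => g i]; rewrite {1}ZE /N -sumrB.
apply: (@le_trans _ _ (\sum_(i < size t) h)); last first.
  rewrite sumr_const card_ord -mulr_natr /h mulrAC ler_pdivrMr //.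
  apply: ler_wpM2l; first exact: ltW.
  by rewrite ler_nat -mulnn; exact: size_ortho_family.
apply: le_trans (frob_sum _ _) _; apply: ler_sum => i _.
rewrite ffunE -scalerBl -rCN -rCD frobZ /frob t1 sqrtr1 mulr1.
have -> : inprod (tnth (in_tuple t) i) Z - h * grid (g i) =
    h * (inprod (tnth (in_tuple t) i) Z / h - grid (g i)).
  by field; rewrite gt_eqF.
by rewrite normrM (gtr0_norm h0) ger_pMr.
Qed.

End HermitianNet.

(** * Semidefinite programming: deterministic part *)

Section MoorePenrose.
Context {R : realType}.

Lemma gram_unitmx r m (B : 'M[R]_(r, m)) : row_free B -> B *m B^T \in unitmx.
Proof.
move=> fB; rewrite -row_free_unit -kermx_eq0; apply/eqP/row_matrixP => i.
rewrite row0; apply/eqP.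
have h : row i (kermx (B *m B^T)) *m (B *m B^T) = 0 by rewrite -row_mul mulmx_ker row0.
set u := row i _ in h *.
suff uB : u *m B = 0 by rewrite -(mulmx_free_eq0 _ fB) uB.
have h2 : (u *m B) *m (u *m B)^T = 0 by rewrite trmx_mul mulmxA -(mulmxA u) h mul0mx.
apply/rowP => j; rewrite [RHS]mxE.
have := congr1 (fun M : 'M[R]_(1, 1) => M 0 0) h2; rewrite [RHS]mxE mxE => /eqP.
rewrite psumr_eq0 => [/allP /(_ j)|l _]; last by rewrite [X in _ * X]mxE -expr2 sqr_ge0.
rewrite mem_index_enum => /(_ isT); rewrite /= [X in _ * X]mxE -expr2 sqrf_eq0.
by move/eqP.
Qed.

(** Classical formula for a full-rank factorization; any matrix has one through its column and row
    bases. *)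
Lemma is_MP_factor r m (B D : 'M[R]_(r, m)) : row_free B -> row_free D ->
  exists X, is_MP (B^T *m D) X.
Proof.
move=> fB fD; have uB := gram_unitmx fB; have uD := gram_unitmx fD.
set H := B *m B^T in uB; set J := D *m D^T in uD.
have HT : H^T = H by rewrite trmx_mul trmxK.
have JT : J^T = J by rewrite trmx_mul trmxK.
pose X := D^T *m invmx J *m invmx H *m B.
have GX : B^T *m D *m X = B^T *m invmx H *m B.
  rewrite /X !mulmxA -(mulmxA B^T D) -/J -(mulmxA B^T J) mulmxV //.
  by rewrite mulmx1.
have XG : X *m (B^T *m D) = D^T *m invmx J *m D.
  rewrite /X !mulmxA -(mulmxA _ B) -/H -(mulmxA _ (invmx H)) mulVmx //.
  by rewrite mulmx1.
exists X; split.
- by rewrite GX !mulmxA -(mulmxA _ B) -/H -(mulmxA _ (invmx H)) mulVmx // mulmx1.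
- rewrite XG /X !mulmxA -(mulmxA _ D) -/J -(mulmxA _ (invmx J) J) mulVmx //.
  by rewrite mulmx1.
- by rewrite GX !trmx_mul trmxK trmx_inv HT mulmxA.
- by rewrite XG !trmx_mul trmxK trmx_inv JT mulmxA.
Qed.

Lemma is_MP_exists m (G : 'M[R]_m) : exists X, is_MP G X.
Proof.
have [||X hX] := @is_MP_factor _ _ (col_base G)^T (row_base G).
- by rewrite /row_free mxrank_tr; exact: col_base_full.
- exact: row_base_free.
by exists X; rewrite trmxK mulmx_base in hX.
Qed.

(** Since the Penrose equations have a solution, [xget] never falls back on its default 0. *)
Lemma pinvMP_is_MP m (G : 'M[R]_m) : is_MP G (pinvMP G).
Proof. by have [X hX] := is_MP_exists G; apply: (@xgetPex _ 0 [set X | is_MP G X]); exists X. Qed.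

End MoorePenrose.

(** * Passing between real and complex vectors *)

Section RealImaginarySplit.
Context {R : realType}.

Definition re_mx p q (M : 'M[R[i]]_(p, q)) := map_mx (fun z => rC (complex.Re z)) M.
Definition im_mx p q (M : 'M[R[i]]_(p, q)) := map_mx (fun z => rC (complex.Im z)) M.

Lemma Kmat_re p q (M : 'M[R[i]]_(p, q)) cplx : Kmat cplx (re_mx M).
Proof. by move=> i j; rewrite /Kscal mxE eqxx orbT. Qed.

Lemma Kmat_im p q (M : 'M[R[i]]_(p, q)) cplx : Kmat cplx (im_mx M).
Proof. by move=> i j; rewrite /Kscal mxE eqxx orbT. Qed.

Lemma re_mx_mul p q r (M : 'M[R[i]]_(p, q)) (z : 'M[R[i]]_(q, r)) :
  Kmat false M -> re_mx (M *m z) = M *m re_mx z.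
Proof.
move=> KM; apply/matrixP => i j; rewrite !mxE cRe_sum.
rewrite (big_morph (@rC R) (@rCD R) (@rC0 R)); apply: eq_bigr => l _.
rewrite mxE; apply: complex_ext; have /eqP M0 : complex.Im (M i l) == 0 := KM i l.
  by rewrite !cReM /= M0 !mul0r subr0.
by rewrite [RHS]cImM /= M0 mul0r mulr0 addr0.
Qed.

Lemma im_mx_mul p q r (M : 'M[R[i]]_(p, q)) (z : 'M[R[i]]_(q, r)) :
  Kmat false M -> im_mx (M *m z) = M *m im_mx z.
Proof.
move=> KM; apply/matrixP => i j; rewrite !mxE cIm_sum.
rewrite (big_morph (@rC R) (@rCD R) (@rC0 R)); apply: eq_bigr => l _.
rewrite mxE; apply: complex_ext; have /eqP M0 : complex.Im (M i l) == 0 := KM i l.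
  by rewrite cReM cImM /= M0 !mul0r subr0 addr0.
by rewrite [RHS]cImM /= M0 mul0r mulr0 addr0.
Qed.

Lemma inprod_re_im p q (u v : 'M[R[i]]_(p, q)) :
  inprod u v = inprod (re_mx u) (re_mx v) + inprod (im_mx u) (im_mx v).
Proof.
rewrite !inprodE -big_split; apply: eq_bigr => i _ /=.
rewrite -big_split; apply: eq_bigr => j _ /=.
by rewrite !mxE /= !mulr0 !addr0.
Qed.

End RealImaginarySplit.

Section KMatrices.
Context {R : realType} (cplx : bool).
Implicit Types (p q r : nat).

Lemma KmatD p q (M N : 'M[R[i]]_(p, q)) : Kmat cplx M -> Kmat cplx N -> Kmat cplx (M + N).
Proof.
move=> hM hN i j; move: (hM i j) (hN i j); rewrite /Kscal matrix_addE cImD.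
by case: (cplx) => //= /eqP -> /eqP ->; rewrite addr0.
Qed.

Lemma KmatN p q (M : 'M[R[i]]_(p, q)) : Kmat cplx M -> Kmat cplx (- M).
Proof.
move=> hM i j; move: (hM i j); rewrite /Kscal mxE.
by case: (cplx) => //=; case: (M i j) => a c /= /eqP ->; rewrite oppr0.
Qed.

Lemma Kmat0 p q : Kmat cplx (0 : 'M[R[i]]_(p, q)).
Proof. by move=> i j; rewrite /Kscal mxE eqxx orbT. Qed.

Lemma KmatZ p q a (M : 'M[R[i]]_(p, q)) : Kmat cplx M -> Kmat cplx (rC a *: M).
Proof.
move=> hM i j; move: (hM i j); rewrite /Kscal matrix_scaleE cImM /=.
by case: (cplx) => //= /eqP ->; rewrite mulr0 mul0r addr0.
Qed.

Lemma KmatM p q r (M : 'M[R[i]]_(p, q)) (N : 'M[R[i]]_(q, r)) :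
  Kmat cplx M -> Kmat cplx N -> Kmat cplx (M *m N).
Proof.
move=> hM hN i j; rewrite /Kscal mxE cIm_sum.
case: (cplx) hM hN => //= hM hN; rewrite big1 // => l _.
have /eqP h1 : complex.Im (M i l) == 0 := hM i l.
have /eqP h2 : complex.Im (N l j) == 0 := hN l j.
by rewrite cImM h1 h2 mulr0 mul0r addr0.
Qed.

Lemma Kmat_cadj p q (M : 'M[R[i]]_(p, q)) : Kmat cplx M -> Kmat cplx (cadj M).
Proof.
move=> hM i j; move: (hM j i); rewrite /Kscal cadjE cIm_conj.
by case: (cplx) => //= /eqP ->; rewrite oppr0.
Qed.

Lemma Kmat_Aadj n m (A : 'I_m -> 'M[R[i]]_n) mu :
  (forall i, Kmat cplx (A i)) -> Kmat cplx (Aadj A mu).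
Proof.
move=> hA; rewrite /Aadj; elim/big_ind: _ => [|x y|i _]; first exact: Kmat0.
  exact: KmatD.
exact: KmatZ.
Qed.

Lemma specnorm_mul n k (M : 'M[R[i]]_n) (Z : 'M[R[i]]_(n, k)) : Kmat cplx Z ->
  frob (M *m Z) <= specnorm cplx M * frob Z.
Proof.
move=> KZ; have s0 := specnorm_ge0 cplx M.
rewrite -ler_sqr ?nnegrE ?mulr_ge0 ?frob_ge0 // exprMn !frob_sqr.
rewrite inprod_col (inprod_col Z) mulr_sumr; apply: ler_sum => j _.
rewrite colE -mulmxA -colE -!frob_sqr -exprMn ler_sqr ?nnegrE ?mulr_ge0 ?frob_ge0 //.
by apply: specnorm_ge => i l; rewrite mxE.
Qed.

(** In the real case the hypothesis tests real vectors only, but [M] and [N] are then real, so the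
    form at z is the sum of its values at the real and imaginary parts of z. *)
Lemma quad_form_ext n (M N : 'M[R[i]]_n) : Kmat cplx M -> Kmat cplx N ->
  (forall x : 'cV_n, Kmat cplx x -> inprod x (M *m x) <= inprod x (N *m x)) ->
  forall z : 'cV_n, inprod z (M *m z) <= inprod z (N *m z).
Proof.
move=> KM KN h z; have [cT|cF] : cplx = true \/ cplx = false by case: (cplx); [left|right].
  by apply: h; rewrite cT.
rewrite cF in KM KN.
rewrite (inprod_re_im z (M *m z)) (inprod_re_im z (N *m z)) !re_mx_mul // !im_mx_mul //.
by apply: lerD; apply: h; [exact: Kmat_re|exact: Kmat_im].
Qed.

Lemma psd_quad n (X : 'M[R[i]]_n) : selfadj cplx X -> psd cplx X ->
  forall z : 'cV_n, 0 <= inprod z (X *m z).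
Proof.
move=> [KX _] hX z.
suff h : forall z : 'cV_n, inprod z (0 *m z) <= inprod z (X *m z).
  by have := h z; rewrite mul0mx inprod0r.
apply: quad_form_ext => //; first exact: Kmat0.
move=> x Kx; rewrite mul0mx inprod0r /inprod mulmxA.
have := hX x Kx; rewrite /mxtrace big_ord1 lecE /= => /andP[_].
by [].
Qed.

Lemma psd_mul_cadj n k (Y : 'M[R[i]]_(n, k)) : psd cplx (Y *m cadj Y).
Proof.
move=> x _; pose v := cadj Y *m x.
have -> : cadj x *m (Y *m cadj Y) *m x = cadj v *m v by rewrite cadjM cadjK !mulmxA.
rewrite mxE; apply: sumr_ge0 => i _; rewrite cadjE.
by case: (v i 0) => a c; rewrite lecE /=; apply/andP; split; [apply/eqP; ring|nra].
Qed.

End KMatrices.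

Section PsdDecomposition.
Context {R : realType}.

Lemma psd_decomp n (X : 'M[R[i]]_n) : cadj X = X ->
  (forall z : 'cV_n, 0 <= inprod z (X *m z)) ->
  exists (d : 'I_n -> R) (u : 'I_n -> 'cV[R[i]]_n),
    [/\ forall j, 0 <= d j, forall j, inprod (u j) (u j) = 1 &
        X = \sum_j rC (d j) *: (u j *m cadj (u j))].
Proof.
move=> hX pX; have [U [d [UU _ XE]]] := herm_spectral hX.
pose u j := cadj U *m ecol j.
have uu j : inprod (u j) (u j) = 1.
  by rewrite inprod_mull cadjK mulmxA UU mul1mx inprod_ecol ecolE eqxx.
have XS : X = \sum_j rC (d j) *: (u j *m cadj (u j)).
  rewrite XE; have -> : diag_mx (\row_j rC (d j)) =
      \sum_j rC (d j) *: (ecol j *m cadj (ecol j)) :> 'M[R[i]]_n.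
    apply/matrixP => a c; rewrite summxE !mxE.
    rewrite (eq_bigr (fun j => rC (d j) * ((a == j)%:R * (c == j)%:R))); last first.
      move=> j _; rewrite matrix_scaleE mxE big_ord1 cadjE !ecolE.
      by case: (a == j); case: (c == j); rewrite ?conjc1 ?conjc0.
    rewrite (bigD1 a) //= eqxx mul1r big1 ?addr0 => [|j ja]; last first.
      by rewrite eq_sym (negPf ja) mul0r mulr0.
    by rewrite [c == a]eq_sym; case: (a == c); rewrite ?mulr1 ?mulr0 ?mulr1n ?mulr0n.
  rewrite mulmx_sumr mulmx_suml; apply: eq_bigr => j _.
  by rewrite /u cadjM cadjK -scalemxAr -scalemxAl !mulmxA.
exists d, u; split => // j.
have := pX (u j); rewrite {1}XE /u -!mulmxA (mulmxA U) UU mul1mx.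
rewrite inprod_mull cadjK mulmxA UU mul1mx inprod_ecol mul_diag_mx mxE ecolE eqxx.
by rewrite mulr1 mxE.
Qed.

Lemma retr_rank1_sum n (d : 'I_n -> R) (u : 'I_n -> 'cV[R[i]]_n) :
  retr (\sum_j rC (d j) *: (u j *m cadj (u j))) = \sum_j d j * inprod (u j) (u j).
Proof.
have -> (M : 'M[R[i]]_n) : retr M = inprod 1%:M M by rewrite /inprod cadj1 mul1mx.
rewrite inprod_sumr; apply: eq_bigr => j _.
by rewrite inprodZr inprodC inprod_mulr cadjK mul1mx.
Qed.

(** Spectral decomposition of [X], with the lower bound on [S] applied to each eigenvector. *)
Lemma psd_pairing n (X S : 'M[R[i]]_n) (th : R) : cadj X = X ->
  (forall z : 'cV_n, 0 <= inprod z (X *m z)) ->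
  (forall z : 'cV_n, - (th * inprod z z) <= inprod z (S *m z)) ->
  - (th * retr X) <= inprod S X.
Proof.
move=> hX pX hS; have [d [u [d0 u1 XE]]] := psd_decomp hX pX.
have tX : retr X = \sum_j d j.
  by rewrite XE retr_rank1_sum; apply: eq_bigr => j _; rewrite u1 mulr1.
rewrite tX {1}XE inprod_sumr mulr_sumr -sumrN; apply: ler_sum => j _.
rewrite inprodZr -(inprod_mulr S) inprodC.
have := ler_wpM2l (d0 j) (hS (u j)); rewrite u1 mulr1; apply: le_trans.
by rewrite mulrN mulrC.
Qed.

Lemma psd_trace0 n (X : 'M[R[i]]_n) : cadj X = X ->
  (forall z : 'cV_n, 0 <= inprod z (X *m z)) -> retr X <= 0 -> X = 0.
Proof.
move=> hX pX tX; have [d [u [d0 u1 XE]]] := psd_decomp hX pX.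
have tE : retr X = \sum_j d j.
  by rewrite XE retr_rank1_sum; apply: eq_bigr => j _; rewrite u1 mulr1.
rewrite tE in tX.
have : \sum_j d j == 0 by rewrite eq_le tX sumr_ge0.
rewrite psumr_eq0 // => /allP h; rewrite XE big1 // => j _.
have /eqP -> := h j (mem_index_enum j).
by rewrite rC0 scale0r.
Qed.

End PsdDecomposition.

(** * Multipliers and projection onto the tangent space *)

Section Projection.
Context {R : realType} {n m k : nat} (A : 'I_m -> 'M[R[i]]_n) (Y : 'M[R[i]]_(n, k)).
Implicit Types (H : 'M[R[i]]_(n, k)) (mu : 'cV[R]_m).

Lemma Aop_mulE H i : Aop A (H *m cadj Y) i 0 = inprod (A i *m Y) H.
Proof. by rewrite mxE -inprod_mulr. Qed.

Lemma inprod_AadjY mu H :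
  inprod (Aadj A mu *m Y) H = \sum_i mu i 0 * inprod (A i *m Y) H.
Proof.
rewrite /Aadj mulmx_suml inprod_suml; apply: eq_bigr => i _.
by rewrite -scalemxAl inprodZl.
Qed.

(** The residual v satisfies v^T G = 0, hence A^*(v) Y = 0, hence v is orthogonal to the right side
    and v^T v = 0. The normal equations are thus solvable even when the A_i Y are linearly
    dependent. *)
Lemma gram_range H :
  Gram A Y *m (pinvMP (Gram A Y) *m Aop A (H *m cadj Y)) = Aop A (H *m cadj Y).
Proof.
have [GXG _ GXT _] := pinvMP_is_MP (Gram A Y).
set G := Gram A Y in GXG GXT *; set X := pinvMP G in GXG GXT *.
set be := Aop A (H *m cadj Y).
pose v := be - G *m (X *m be).
have vG : v^T *m G = 0.
  by rewrite linearB /= mulmxBl (mulmxA G) trmx_mul GXT -(mulmxA be^T) GXG subrr.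
have dot (a c : 'cV[R]_m) : (a^T *m c) 0 0 = \sum_i a i 0 * c i 0.
  by rewrite mxE; apply: eq_bigr => i _; rewrite mxE.
have AvY : Aadj A v *m Y = 0.
  apply: inprod_eq0; rewrite inprod_AadjY.
  transitivity ((v^T *m G *m v) 0 0); last by rewrite vG mul0mx mxE.
  rewrite -mulmxA dot; apply: eq_bigr => i _; congr (_ * _).
  rewrite inprodC inprod_AadjY mxE; apply: eq_bigr => j _.
  by rewrite [G i j]mxE mulrC inprodC.
have vbe : (v^T *m be) 0 0 = 0.
  rewrite dot; transitivity (inprod (Aadj A v *m Y) H); last by rewrite AvY inprod0l.
  by rewrite inprod_AadjY; apply: eq_bigr => i _; rewrite Aop_mulE.
have vv : (v^T *m v) 0 0 = 0.
  by rewrite {2}/v mulmxBr (mulmxA v^T) vG mul0mx subr0.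
suff v0 : v = 0 by apply/esym/eqP; rewrite -subr_eq0 -/v v0.
apply/colP => i; rewrite [RHS]mxE; apply/eqP; rewrite -sqrf_eq0.
have /eqP : \sum_i v i 0 ^+ 2 = 0.
  by rewrite -[RHS]vv dot; apply: eq_bigr => j _; exact: expr2.
rewrite psumr_eq0 => [/allP /(_ i)|j _]; last exact: sqr_ge0.
by rewrite mem_index_enum; exact.
Qed.

(** By the normal equations, the pseudo-inverse subtracts from [H] exactly its component in the span
    of the A_i Y: the rest is the orthogonal projection onto the tangent space. *)
Lemma tangent_residual H i :
  inprod (A i *m Y)
    (H - Aadj A (pinvMP (Gram A Y) *m Aop A (H *m cadj Y)) *m Y) = 0.
Proof.
set nu := pinvMP _ *m _; rewrite inprodBr; apply/eqP; rewrite subr_eq0; apply/eqP.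
transitivity ((Gram A Y *m nu) i 0); first by rewrite gram_range Aop_mulE.
rewrite [RHS]inprodC inprod_AadjY mxE.
by apply: eq_bigr => j _; rewrite [Gram A Y i j]mxE mulrC inprodC.
Qed.

End Projection.

Section OperatorBound.
Context {R : realType} (cplx : bool) {n m : nat} (A : 'I_m -> 'M[R[i]]_n).

Lemma frob_Aadj_Aop_bounded (X : 'M[R]_m) :
  exists c : R, forall Z, frob (Aadj A (X *m Aop A Z)) <= c * frob Z.
Proof.
exists (\sum_i \sum_j `|X i j| * (frob (A j) * frob (A i))) => Z.
apply: le_trans (frob_sum _ _) _; rewrite mulr_suml; apply: ler_sum => i _.
rewrite frobZ mxE mulr_suml.
apply: (@le_trans _ _ ((\sum_j `|X i j| * (frob (A j) * frob Z)) * frob (A i))).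
  apply: ler_wpM2r; first exact: frob_ge0.
  apply: le_trans (ler_norm_sum _ _ _) _; apply: ler_sum => j _.
  rewrite normrM; apply: ler_wpM2l; first exact: normr_ge0.
  rewrite mxE ler_norml inprod_le andbT; exact: inprod_ge.
rewrite mulr_suml le_eqVlt; apply/orP; left; apply/eqP; apply: eq_bigr => j _.
by move: (frob _) (frob _) (frob _) `|_| => a c e g; clear; ring.
Qed.

Lemma opnorm_bound (X : 'M[R]_m) (Z : 'M[R[i]]_n) : Kmat cplx Z ->
  frob (Aadj A (X *m Aop A Z)) <= opnorm cplx (fun Z => Aadj A (X *m Aop A Z)) * frob Z.
Proof.
move=> KZ; have [c hc] := frob_Aadj_Aop_bounded X.
have [Z0|Z0] := eqVneq Z 0.
  by have := hc Z; rewrite Z0 frob0 !mulr0.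
rewrite -ler_pdivrMr ?frob_gt0 //; apply: sup_ubound; last by exists Z.
by have [] := @ratio_has_sup _ cplx _ _ _ _ (fun Z => Aadj A (X *m Aop A Z)) c Z KZ Z0 (fun Z _ => hc Z).
Qed.

Lemma opnorm_ge0 (X : 'M[R]_m) : 0 <= opnorm cplx (fun Z => Aadj A (X *m Aop A Z)).
Proof.
rewrite /opnorm; set S := [set _ | _ in _].
have [[y Sy]|S0] := pselect (S !=set0); last first.
  have -> : S = set0 by apply/seteqP; split => // y Sy; apply: S0; exists y.
  by rewrite sup0.
have [Z [KZ Z0] _] := Sy; have [c hc] := frob_Aadj_Aop_bounded X.
have [_ h] := @ratio_has_sup _ cplx _ _ _ _ (fun Z => Aadj A (X *m Aop A Z)) c Z KZ Z0 (fun Z _ => hc Z).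
apply: le_trans (ub_le_sup h Sy).
by have [Z' _ <-] := Sy; rewrite divr_ge0 ?frob_ge0.
Qed.

End OperatorBound.

Section Arithmetic.
Context {R : realType}.

(** The exact factor is (2 + K R) (1 + K R); rounding it up to (2 + K R)^2 gives the square that
    appears in eta. *)
Lemma curvature_arith (K Rt s0 s p : R) : 0 <= K -> 0 <= Rt -> 0 <= s0 ->
  2 * (K * (p * s) * s * ((1 + K * Rt) * s0 * p)) +
    (1 + K * Rt) * s0 * (K * (p * s)) ^+ 2 * Rt <=
  K * (2 + K * Rt) ^+ 2 * s0 * s ^+ 2 * p ^+ 2.
Proof.
move=> K0 R0 s00; have KR0 : 0 <= K * Rt by exact: mulr_ge0.
have -> : 2 * (K * (p * s) * s * ((1 + K * Rt) * s0 * p)) +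
    (1 + K * Rt) * s0 * (K * (p * s)) ^+ 2 * Rt =
   (2 + K * Rt) * (1 + K * Rt) * (K * s0 * s ^+ 2 * p ^+ 2) by ring.
have -> : K * (2 + K * Rt) ^+ 2 * s0 * s ^+ 2 * p ^+ 2 =
   (2 + K * Rt) * (2 + K * Rt) * (K * s0 * s ^+ 2 * p ^+ 2) by ring.
apply: ler_wpM2r.
  by apply: mulr_ge0; [apply: mulr_ge0; [exact: mulr_ge0|exact: sqr_ge0]|exact: sqr_ge0].
by apply: ler_wpM2l; lra.
Qed.

Lemma curvature_arith_sum (eH yy xx xSx e g c q B : R) :
  - eH * yy <= xSx - 2 * e + g -> eH * yy <= eH * xx -> - c <= e -> g <= q ->
  2 * c + q <= B * xx -> - ((eH + B) * xx) <= xSx.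
Proof.
rewrite mulNr [(eH + B) * xx]mulrDl; move: (eH * yy) (eH * xx) (B * xx) => a a' b'.
by move=> h1 h2 h3 h4 h5; lra.
Qed.

Lemma gap_arith (p q r t th Rt u : R) : - (th * r) <= p -> th * r <= th * Rt -> q <= u ->
  q + t - (th * Rt + u) <= p + t.
Proof. by move: (th * r) (th * Rt) => x y; lra. Qed.

Lemma multiplier_arith (K Rt s0 p a c : R) : a <= s0 * p -> c <= K * (s0 * Rt) * p ->
  a + c <= (1 + K * Rt) * s0 * p.
Proof.
have -> : (1 + K * Rt) * s0 * p = s0 * p + K * (s0 * Rt) * p by ring.
by move=> *; exact: lerD.
Qed.

End Arithmetic.

(** * Approximate critical points and the duality gap *)

Section SDP.
Context {R : realType} (cplx : bool) {n m k : nat} (A : 'I_m -> 'M[R[i]]_n)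
  (b : 'cV[R]_m) (RR Kc : R).
Hypotheses (hA : forall i, selfadj cplx (A i))
  (hR : forall X, feasible cplx A b X -> complex.Re (\tr X) <= RR)
  (hK : forall Y, Mset cplx A b k Y ->
       opnorm cplx (fun Z => Aadj A (pinvMP (Gram A Y) *m Aop A Z)) <= Kc).

Let KA i : Kmat cplx (A i). Proof. by have [] := hA i. Qed.

Section Point.
Variable Y : 'M[R[i]]_(n, k).
Hypothesis hY : Mset cplx A b k Y.
Let KY : Kmat cplx Y. Proof. by have [] := hY. Qed.

Lemma feasible_mul_cadj : feasible cplx A b (Y *m cadj Y).
Proof.
have [_ hb] := hY; split=> //; last exact: psd_mul_cadj.
by split; [apply: KmatM => //; exact: Kmat_cadj|rewrite cadjM cadjK].
Qed.

Lemma inprod_le_trace : inprod Y Y <= RR.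
Proof.
have := hR feasible_mul_cadj; rewrite -/(retr _) retr_mulC.
by rewrite retr_inprod.
Qed.

Lemma trace_bound_ge0 : 0 <= RR.
Proof. exact: le_trans (inprod_ge0 Y) inprod_le_trace. Qed.

Lemma opnorm_const_ge0 : 0 <= Kc.
Proof. by apply: le_trans (hK hY); exact: opnorm_ge0. Qed.

Lemma frob_multiplier_le Z : Kmat cplx Z ->
  frob (Aadj A (pinvMP (Gram A Y) *m Aop A Z)) <= Kc * frob Z.
Proof.
move=> KZ; apply: le_trans (opnorm_bound A _ KZ) _.
by apply: ler_wpM2r; [exact: frob_ge0|exact: hK].
Qed.

(** H = A_i Y is normal to the tangent space, so its projection there vanishes and H = A^*(nu) Y;
    the operator bound then gives |H| <= K |H Y^*| |Y| <= K R |H|. *)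
Lemma one_le_KR i : A i *m Y != 0 -> 1 <= Kc * RR.
Proof.
move=> AY0; pose H := A i *m Y.
pose nu := pinvMP (Gram A Y) *m Aop A (H *m cadj Y).
have res := tangent_residual A Y H; rewrite -/nu in res.
have H0 : H - Aadj A nu *m Y = 0.
  apply: inprod_eq0; rewrite {1}inprodBl {1}/H (res i) inprod_AadjY big1 ?subr0 //.
  by move=> j _; rewrite (res j) mulr0.
have KH : Kmat cplx (H *m cadj Y) by do !apply: KmatM => //; exact: Kmat_cadj.
have K0 := opnorm_const_ge0.
have h : frob H <= Kc * RR * frob H.
  have -> : frob H = frob (Aadj A nu *m Y).
    by congr frob; apply/eqP; rewrite -subr_eq0 H0.
  apply: le_trans (frobM _ _) _.
  apply: (@le_trans _ _ (Kc * (frob H * frob Y) * frob Y)).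
    apply: ler_wpM2r; first exact: frob_ge0.
    apply: le_trans (frob_multiplier_le KH) _; apply: ler_wpM2l => //.
    by rewrite -(frob_cadj Y); exact: frobM.
  have HE : H = Aadj A nu *m Y by apply/eqP; rewrite -subr_eq0 H0.
  rewrite -HE; have := inprod_le_trace; rewrite -frob_sqr => hh.
  have := ler_wpM2l (mulr_ge0 K0 (frob_ge0 H)) hh.
  by move: (frob H) (frob Y) => p q; rewrite expr2; lra.
by move: h; rewrite -{1}[frob H]mul1r ler_pM2r // frob_gt0.
Qed.

Section Cost.
Variables (C : 'M[R[i]]_n) (s0 : R).
Hypotheses (hC : selfadj cplx C) (s00 : 0 <= s0) (hs0 : specnorm cplx C <= s0).
Let S := S_of A C Y.
Let KC : Kmat cplx C. Proof. by have [] := hC. Qed.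

Lemma Kmat_S_of : Kmat cplx S.
Proof. by apply: KmatD => //; apply: KmatN; exact: Kmat_Aadj. Qed.

Lemma cadj_S_of : cadj S = S.
Proof.
have [_ hC2] := hC.
rewrite /S /S_of cadjB hC2; congr (_ - _); rewrite cadj_sum.
by apply: eq_bigr => i _; rewrite cadjZ conj_rC; have [_ ->] := hA i.
Qed.

(** Radius of the ball in which the multiplier matrices are discretized. *)
Lemma frob_Aadj_mu_of : frob (Aadj A (mu_of A C Y)) <= Kc * (s0 * RR).
Proof.
have K0 := opnorm_const_ge0.
have KYY : Kmat cplx (Y *m cadj Y) by apply: KmatM => //; exact: Kmat_cadj.
rewrite /mu_of -mulmxA; apply: le_trans (frob_multiplier_le (KmatM KC KYY)) _.
apply: ler_wpM2l => //; apply: le_trans (specnorm_mul C KYY) _.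
apply: ler_pM => //; [exact: specnorm_ge0|exact: frob_ge0|].
apply: le_trans (frobM _ _) _; rewrite frob_cadj -expr2 frob_sqr.
exact: inprod_le_trace.
Qed.

Lemma frob_S_of_mul q (Z : 'M[R[i]]_(n, q)) : Kmat cplx Z ->
  frob (S *m Z) <= (1 + Kc * RR) * s0 * frob Z.
Proof.
move=> KZ; rewrite /S /S_of mulmxBl; apply: le_trans (frobB _ _) _.
have h1 : frob (C *m Z) <= s0 * frob Z.
  by apply: le_trans (specnorm_mul C KZ) _; apply: ler_wpM2r => //; exact: frob_ge0.
have h2 : frob (Aadj A (mu_of A C Y) *m Z) <= Kc * (s0 * RR) * frob Z.
  apply: le_trans (frobM _ _) _; apply: ler_wpM2r; first exact: frob_ge0.
  exact: frob_Aadj_mu_of.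
exact: multiplier_arith h1 h2.
Qed.

(** The multiplier acts as an approximate dual solution: on the affine constraint set, <C, X> - <S,
    X> is the constant <mu, b>. Hence the gap against a feasible X is <S, Y Y^*> - <S, X>, at most
    |S Y| |Y| + th Tr X. *)
Lemma gap_bound (eg th : R) : 0 <= eg -> 0 <= th ->
  frob (2%:R *: (S *m Y)) <= eg ->
  (forall z : 'cV_n, - (th * inprod z z) <= inprod z (S *m z)) ->
  0 <= gcost C Y - fstar cplx A b C /\
  gcost C Y - fstar cplx A b C <= th * RR + eg / 2%:R * Num.sqrt RR.
Proof.
move=> eg0 th0 hfo hS.
have [_ hb] := hY.
have bi i : b i 0 = inprod (A i) (Y *m cadj Y) by rewrite -hb mxE.
have gE : gcost C Y = inprod C (Y *m cadj Y).
  by rewrite /gcost inprod_mulr.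
have gap X : feasible cplx A b X ->
    gcost C Y - (th * RR + eg / 2%:R * Num.sqrt RR) <= inprod C X.
  move=> fX; have [sX AX pX] := fX; have [_ hX] := sX.
  have CS Z : Aop A Z = b -> inprod C Z = inprod S Z + \sum_i mu_of A C Y i 0 * b i 0.
    move=> AZ; have -> : C = S + Aadj A (mu_of A C Y) by rewrite subrK.
    rewrite inprodDl {1}/S; congr (_ + _).
    rewrite /Aadj inprod_suml; apply: eq_bigr => i _.
    by rewrite -/S inprodZl subrK -AZ !mxE.
  rewrite gE (CS _ hb) (CS _ AX).
  have pq := psd_quad sX pX.
  have h1 := psd_pairing hX pq hS.
  have h2 : th * retr X <= th * RR by apply: ler_wpM2l => //; exact: hR.
  have h3 : inprod S (Y *m cadj Y) <= eg / 2%:R * Num.sqrt RR.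
    rewrite -inprod_mulr; apply: le_trans (inprod_le _ _) _.
    apply: ler_pM; rewrite ?frob_ge0 //.
      move: hfo; rewrite -(rC_nat (R := R) 2) frobZ ger0_norm // => hfo.
      by rewrite ler_pdivlMr // mulrC.
    by apply: ler_wsqrtr; exact: inprod_le_trace.
  exact: gap_arith h1 h2 h3.
have fe : [set inprod C X | X in feasible cplx A b] !=set0.
  by exists (inprod C (Y *m cadj Y)), (Y *m cadj Y) => //; exact: feasible_mul_cadj.
have lb : lbound [set inprod C X | X in feasible cplx A b]
    (gcost C Y - (th * RR + eg / 2%:R * Num.sqrt RR)).
  by move=> _ [X fX <-]; exact: gap.
split.
  (* The gap estimate also bounds the set of values from below, so that [inf] is a genuine
     infimum. *)
  rewrite subr_ge0 /fstar gE; apply: ge_inf; first by exists (gcost C Y - (th * RR + eg / 2%:R * Num.sqrt RR)).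
  by exists (Y *m cadj Y) => //; exact: feasible_mul_cadj.
rewrite lerBlDl -lerBlDr; exact: lb_le_inf.
Qed.

(** The direction H = x z^* is tangent up to a correction D Y, where D is linear in H Y^* = x (Y
    z)^* and therefore has norm at most K |x| s. Passing from H to its projection changes the
    quadratic form of [S] only to second order in [s]. *)
Lemma curvature_of_short_vector (eH s : R) (z : 'cV[R[i]]_k) (x : 'cV[R[i]]_n) :
  0 <= eH -> 0 <= s ->
  (forall Yd, tangent cplx A Y Yd ->
    - eH * frob Yd ^+ 2 <= inprod Yd (S *m Yd)) ->
  Kmat cplx z -> Kmat cplx x -> frob z = 1 -> frob (Y *m z) <= s ->
  - ((eH + Kc * (2 + Kc * RR) ^+ 2 * s0 * s ^+ 2) * inprod x x) <= inprod x (S *m x).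
Proof.
move=> eH0 ss0 hso Kz Kx z1 Yzs.
have K0 := opnorm_const_ge0; have R0 := trace_bound_ge0.
have KS := Kmat_S_of.
pose H := x *m cadj z.
have KH : Kmat cplx H by apply: KmatM => //; exact: Kmat_cadj.
pose nu := pinvMP (Gram A Y) *m Aop A (H *m cadj Y).
pose D := Aadj A nu; pose Yd := H - D *m Y.
have KD : Kmat cplx D by exact: Kmat_Aadj.
have res : forall i, inprod (A i *m Y) Yd = 0 by exact: tangent_residual.
have tY : tangent cplx A Y Yd.
  by split; [apply: KmatD => //; apply: KmatN; exact: KmatM|exact: res].
have zz : inprod z z = 1 by rewrite -frob_sqr z1 expr1n.
have czz : cadj z *m z = 1%:M.
  apply/matrixP => a c; rewrite !ord1 !mxE eqxx; apply: complex_ext.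
    by move: zz; rewrite /inprod /mxtrace big_ord1 mxE.
  rewrite /= cIm_sum big1 // => l _; rewrite cadjE cImM cRe_conj cIm_conj; ring.
have HH : inprod H H = inprod x x.
  by rewrite /H inprod_mulr cadjK -mulmxA czz mulmx1.
have DYd : inprod (D *m Y) Yd = 0.
  by rewrite inprod_AadjY big1 // => i _; rewrite res mulr0.
have YdYd : inprod Yd Yd <= inprod x x.
  rewrite -HH; have -> : H = Yd + D *m Y by rewrite subrK.
  rewrite (inprodDl _ Yd (D *m Y)) (inprodDr Yd Yd) (inprodDr (D *m Y) Yd).
  by rewrite (inprodC Yd (D *m Y)) DYd addr0 add0r lerDl inprod_ge0.
have Dn : frob D <= Kc * (frob x * s).
  apply: le_trans (frob_multiplier_le _) _; first by apply: KmatM => //; exact: Kmat_cadj.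
  apply: ler_wpM2l => //; rewrite /H -mulmxA -cadjM; apply: le_trans (frobM _ _) _.
  by rewrite frob_cadj; apply: ler_wpM2l => //; exact: frob_ge0.
set sS := (1 + Kc * RR) * s0.
have sS0 : 0 <= sS by apply: mulr_ge0 => //; apply: addr_ge0 => //; exact: mulr_ge0.
have KR0 : 0 <= Kc * RR by exact: mulr_ge0.
have cross : - (Kc * (frob x * s) * s * (sS * frob x)) <= inprod (D *m Y) (S *m H).
  (* Moving z to the left factor makes Y z appear a second time, so the cross term is quadratic in
     [s] rather than linear. *)
  have -> : inprod (D *m Y) (S *m H) = inprod (D *m (Y *m z)) (S *m x).
    by rewrite (mulmxA D) [RHS]inprod_mulr -(mulmxA S).
  apply: le_trans (inprod_ge _ _); rewrite lerN2.
  apply: ler_pM; [exact: frob_ge0|exact: frob_ge0| |exact: frob_S_of_mul].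
  apply: le_trans (frobM _ _) _.
  by apply: ler_pM; [exact: frob_ge0|exact: frob_ge0|exact: Dn|exact: Yzs].
have quad : inprod (D *m Y) (S *m (D *m Y)) <= sS * (Kc * (frob x * s)) ^+ 2 * RR.
  apply: le_trans (inprod_le _ _) _.
  apply: (@le_trans _ _ (frob (D *m Y) * (sS * frob (D *m Y)))).
    by apply: ler_wpM2l; [exact: frob_ge0|apply: frob_S_of_mul; exact: KmatM].
  rewrite mulrCA -mulrA; apply: ler_wpM2l => //; rewrite -expr2 frob_sqr.
  apply: (@le_trans _ _ (frob D ^+ 2 * frob Y ^+ 2)).
    rewrite -exprMn -frob_sqr ler_sqr ?nnegrE ?mulr_ge0 ?frob_ge0 //; exact: frobM.
  apply: ler_pM; rewrite ?sqr_ge0 //; last by rewrite frob_sqr; exact: inprod_le_trace.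
  by rewrite ler_sqr ?nnegrE ?frob_ge0 // mulr_ge0 // mulr_ge0 // frob_ge0.
have xSx : inprod H (S *m H) = inprod x (S *m x).
  by rewrite /H mulmxA inprod_mulr cadjK -!mulmxA czz mulmx1.
have expand : inprod Yd (S *m Yd) =
    inprod H (S *m H) - 2 * inprod (D *m Y) (S *m H) + inprod (D *m Y) (S *m (D *m Y)).
  have sw : inprod H (S *m (D *m Y)) = inprod (D *m Y) (S *m H).
    by rewrite inprodC inprod_mull cadj_S_of.
  rewrite /Yd (mulmxBr S) (inprodBl _ H) !(inprodBr _ (S *m H)) sw.
  by move: (inprod _ _) (inprod _ _) (inprod _ _) => p q r; clear; ring.
have := hso Yd tY; rewrite expand xSx frob_sqr => main.
have e1 : eH * inprod Yd Yd <= eH * inprod x x by exact: ler_wpM2l.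
have xx := frob_sqr x.
rewrite -xx in main e1 *.
have fin := @curvature_arith R Kc RR s0 s (frob x) K0 R0 s00.
exact: (curvature_arith_sum main e1 cross quad fin).
Qed.

End Cost.
End Point.
End SDP.

Section Dichotomy.
Context {R : realType} (cplx : bool) {n m k : nat} (A : 'I_m -> 'M[R[i]]_n)
  (b : 'cV[R]_m) (RR Kc : R).
Hypotheses (hA : forall i, selfadj cplx (A i))
  (hR : forall X, feasible cplx A b X -> complex.Re (\tr X) <= RR)
  (hK : forall Y, Mset cplx A b k Y ->
       opnorm cplx (fun Z => Aadj A (pinvMP (Gram A Y) *m Aop A Z)) <= Kc).

Lemma injective_ext p q (Y : 'M[R[i]]_(p, q)) : Kmat cplx Y ->
  (forall z : 'cV_q, Kmat cplx z -> Y *m z = 0 -> z = 0) ->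
  forall z : 'cV_q, Y *m z = 0 -> z = 0.
Proof.
move=> KY h z Yz; have [cT|cF] : cplx = true \/ cplx = false by case: (cplx); [left|right].
  by apply: h => //; rewrite cT.
rewrite cF in KY.
have r0 : re_mx z = 0.
  by apply: h; [exact: Kmat_re|rewrite -re_mx_mul // Yz; apply/matrixP => i j; rewrite !mxE].
have i0 : im_mx z = 0.
  by apply: h; [exact: Kmat_im|rewrite -im_mx_mul // Yz; apply/matrixP => i j; rewrite !mxE].
apply: inprod_eq0; rewrite inprod_re_im r0 i0 !inprod0l addr0 //.
Qed.

(* If Y is small on some direction z, rank-one tangent directions built on z show
   that the dual matrix is almost positive; otherwise FOSP makes it nearly vanish
   on the whole range of Y. *)
Lemma sosp_dichotomy (C : 'M[R[i]]_n) (s0 e eg eH : R) (Y : 'M[R[i]]_(n, k)) :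
  selfadj cplx C -> 0 <= s0 -> specnorm cplx C <= s0 -> 0 < e -> 0 <= eg -> 0 <= eH ->
  is_SOSP cplx A b C eg eH Y ->
  (forall z : 'cV_n,
     - ((eH + Kc * (2 + Kc * RR) ^+ 2 * s0 * (eg / e) ^+ 2) * inprod z z) <=
     inprod z (S_of A C Y *m z)) \/
  (forall z : 'cV_k, Y *m z = 0 -> z = 0) /\
  (forall z : 'cV_k, inprod (S_of A C Y *m (Y *m z)) (S_of A C Y *m (Y *m z)) <=
     (e / 2) ^+ 2 * inprod (Y *m z) (Y *m z)).
Proof.
move=> hC s00 hs0 e0 eg0 eH0 [[hY hfo] hso].
have KY : Kmat cplx Y by have [] := hY.
have KS := Kmat_S_of hA Y hC.
(* The ratio eg / e separates the cases: if |Y z| > (eg / e) |z| for every nonzero z, then |S Y z|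
   <= (eg / 2) |z| is below (e / 2) |Y z|. *)
have [[z [Kz z0 hz]]|nz] := pselect (exists z : 'cV[R[i]]_k,
    [/\ Kmat cplx z, z != 0 & e * frob (Y *m z) <= eg * frob z]).
  left; have zp := frob_gt0 z0.
  pose z1 := rC (frob z)^-1 *: z.
  have Kz1 : Kmat cplx z1 by exact: KmatZ.
  have z11 : frob z1 = 1.
    by rewrite frobZ gtr0_norm ?invr_gt0 // mulVf // gt_eqF.
  have Yz1 : frob (Y *m z1) <= eg / e.
    rewrite -scalemxAr frobZ gtr0_norm ?invr_gt0 // ler_pdivrMl //.
    by rewrite mulrA ler_pdivlMr // mulrC [frob z * _]mulrC.
  set th := eH + _.
  have h (x : 'cV[R[i]]_n) : Kmat cplx x -> - (th * inprod x x) <= inprod x (S_of A C Y *m x).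
    move=> Kx.
    exact: (curvature_of_short_vector hA hR hK hY hC s00 hs0 eH0
      (divr_ge0 eg0 (ltW e0)) hso Kz1 Kx z11 Yz1).
  have q (x : 'cV[R[i]]_n) : inprod x ((rC (- th))%:M *m x) = - (th * inprod x x).
    by rewrite mul_scalar_mx inprodZr mulNr.
  move=> x; rewrite -q; apply: quad_form_ext => //.
    move=> a c; rewrite /Kscal mxE; case: (a == c); last by rewrite mulr0n eqxx orbT.
    by rewrite mulr1n eqxx orbT.
  by move=> y Ky; rewrite q; exact: h.
right.
have gt (z : 'cV[R[i]]_k) : Kmat cplx z -> z != 0 -> eg * frob z < e * frob (Y *m z).
  move=> Kz z0; rewrite ltNge; apply/negP => hz; apply: nz; exists z; split => //.
split.
  apply: injective_ext => // z Kz Yz; apply/eqP; apply: contraT => z0.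
  have := gt z Kz z0; rewrite Yz frob0 mulr0 ltNge mulr_ge0 ?frob_ge0 //.
set S := S_of A C Y in hfo KS *.
have SY : 2 * frob (S *m Y) <= eg.
  by move: hfo; rewrite -(rC_nat (R := R) 2) frobZ ger0_norm.
have hK' (z : 'cV[R[i]]_k) : Kmat cplx z ->
    frob (S *m (Y *m z)) <= e / 2 * frob (Y *m z).
  move=> Kz; have [->|z0] := eqVneq z 0; first by rewrite !mulmx0 !frob0 mulr0.
  have h1 : frob (S *m (Y *m z)) <= frob (S *m Y) * frob z.
    by rewrite mulmxA; exact: frob_mulcV.
  have h2 := ltW (gt z Kz z0).
  have h3 : 2 * frob (S *m Y) * frob z <= eg * frob z.
    by apply: ler_wpM2r => //; exact: frob_ge0.
  move: h1 h2 h3; rewrite -mulrA; move: (frob (S *m Y) * _) (eg * _) (frob (S *m _)) => p q r.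
  by move: (frob _) => t h1 h2 h3; lra.
have qS (z : 'cV[R[i]]_k) : inprod z ((cadj (S *m Y) *m (S *m Y)) *m z) =
    inprod (S *m (Y *m z)) (S *m (Y *m z)).
  by rewrite -(mulmxA (cadj _)) inprodC inprod_mull cadjK -(mulmxA S).
have qY (z : 'cV[R[i]]_k) : inprod z ((rC ((e / 2) ^+ 2) *: (cadj Y *m Y)) *m z) =
    (e / 2) ^+ 2 * inprod (Y *m z) (Y *m z).
  by rewrite -scalemxAl inprodZr -(mulmxA (cadj _)) [inprod z _]inprodC inprod_mull cadjK.
move=> z; rewrite -qS -qY; apply: quad_form_ext.
- have KSY : Kmat cplx (S *m Y) by exact: KmatM.
  by apply: KmatM => //; exact: Kmat_cadj.
- by apply: KmatZ; apply: KmatM => //; exact: Kmat_cadj.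
move=> x Kx; rewrite qS qY -!frob_sqr -exprMn.
rewrite ler_sqr ?nnegrE ?frob_ge0 //; first exact: hK'.
by apply: mulr_ge0; [apply: divr_ge0 => //; exact: ltW|exact: frob_ge0].
Qed.

(** For b = 0 the feasible set is a cone, and a nonnegative trace that is bounded on a cone
    vanishes. *)
Lemma feasible_trivial (Y0 X : 'M[R[i]]_n) : b = 0 -> feasible cplx A b Y0 ->
  feasible cplx A b X -> X = 0.
Proof.
move=> b0 fY fX; have [sX AX pX] := fX; have [KX hX] := sX.
have pq := psd_quad sX pX.
have scal t : 0 <= t -> t * retr X <= RR.
  move=> t0; have := hR (_ : feasible cplx A b (rC t *: X)).
  rewrite -/(retr _) retrZ; apply; split.
  - by split; [exact: KmatZ|rewrite cadjZ conj_rC hX].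
  - apply/colP => i; have := congr1 (fun M : 'cV[R]_m => M i 0) AX.
    by rewrite b0 /= !mxE inprodZr => ->; rewrite mulr0.
  - move=> x Kx; rewrite -scalemxAr -scalemxAl mxE mulr_ge0 ?pX //.
    by rewrite lecE /= eqxx.
apply: psd_trace0 => //; rewrite leNgt; apply/negP => tp.
have := scal 0 (lexx 0); rewrite mul0r => RR0.
have t0 : 0 <= (RR + 1) / retr X by apply: divr_ge0; [exact: addr_ge0|exact: ltW].
have := scal _ t0; rewrite divfK ?gt_eqF //.
by lra.
Qed.

End Dichotomy.

(** * Constants and conclusion *)

Section Constants.
Context {R : realType}.
Variables (n m k : nat) (sigma q Cop : R).
Hypotheses (n0 : (0 < n)%N) (m0 : (0 < m)%N) (sigma0 : 0 < sigma) (q1 : 1 <= q)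
  (hCop : 3 * sigma * Num.sqrt n%:R <= Cop).

(* Must dominate 100 / (3 sb_const), and make the net of [net_parameter] finer than sqrt sb_eps. *)
Definition c_univ : R := expR 200.

Let xi := 6 * (q * Cop) * Num.sqrt (c_univ * n%:R) / sigma.
Let sn : R := Num.sqrt n%:R.

Let sn0 : 0 < sn. Proof. by rewrite sqrtr_gt0 ltr0n. Qed.
Let snn : sn ^+ 2 = n%:R. Proof. by rewrite sqr_sqrtr. Qed.
Let n1 : 1 <= n%:R :> R. Proof. by rewrite ler1n. Qed.

Lemma sqrt_c_univ : Num.sqrt (c_univ * n%:R) = expR 100 * sn.
Proof.
rewrite sqrtrM ?expR_ge0 //; congr (_ * _).
have -> : c_univ = expR 100 ^+ 2 by rewrite -expRM_natl; congr expR; ring.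
by rewrite sqrtr_sqr ger0_norm ?expR_ge0.
Qed.

Let xiE : xi = 6 * (q * Cop) * expR 100 * sn / sigma.
Proof. by rewrite /xi sqrt_c_univ; ring. Qed.

(** Uses q >= 1 and Cop >= 3 sigma sqrt n: one factor sqrt n comes from [Cop], the other from the
    square root inside xi. *)
Lemma rate_ge : 18 * n%:R * expR 100 <= xi.
Proof.
rewrite xiE ler_pdivlMr // -snn.
have Cop0 : 0 <= Cop.
  by apply: le_trans hCop; rewrite mulr_ge0 ?sqrtr_ge0 // mulr_ge0 // ltW.
have h : 3 * sigma * sn <= q * Cop.
  by apply: le_trans hCop _; rewrite ler_peMl.
have e0 : 0 <= expR 100 * sn :> R by rewrite mulr_ge0 ?expR_ge0 // ltW.
have := ler_wpM2l e0 h.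
have -> : 18 * sn ^+ 2 * expR 100 * sigma = 6 * (expR 100 * sn * (3 * sigma * sn)) by ring.
have -> : 6 * (q * Cop) * expR 100 * sn = 6 * (expR 100 * sn * (q * Cop)) by ring.
by move=> h'; exact: ler_wpM2l.
Qed.

Let e100 : 101 <= expR 100 :> R.
Proof. by have := expR_ge1Dx (100 : R); lra. Qed.

Let e52 : expR 100 * expR (- 52) = expR 48 :> R.
Proof. by rewrite -expRD; congr expR; lra. Qed.

Let e48 : 49 <= expR 48 :> R.
Proof. by have := expR_ge1Dx (48 : R); lra. Qed.

Lemma rate_ge_nat : n%:R <= xi.
Proof.
apply: le_trans rate_ge; rewrite mulrAC; apply: ler_peMl; first exact: ler0n.
by move: e100; lra.
Qed.

Lemma ln_rate_ge : 100 <= ln (1 + xi).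
Proof.
have x0 : 0 <= xi by apply: le_trans rate_ge_nat; exact: ler0n.
rewrite -[leLHS]expRK ler_ln ?posrE ?expR_gt0 //; last by rewrite ltr_pwDl.
apply: (@le_trans _ _ xi); last by rewrite lerDr.
apply: le_trans rate_ge; apply: ler_peMl; first exact: expR_ge0.
by move: n1; lra.
Qed.

Lemma sqrt_sb_eps : Num.sqrt (sb_eps n k sigma) = expR (- 52) * sigma * k%:R / sn :> R.
Proof.
have -> : sb_eps n k sigma = (expR (- 52) * sigma * k%:R / sn) ^+ 2 :> R.
  rewrite /sb_eps /sb_const expr_div_n !exprMn snn; congr (_ * _ * _ / _).
  by rewrite -expRM_natl; congr expR; ring.
rewrite sqrtr_sqr ger0_norm //.
by rewrite divr_ge0 ?(ltW sn0) // mulr_ge0 // mulr_ge0 ?expR_ge0 // ltW.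
Qed.

(** The radius satisfies 2 kap <= rho xi, and n <= xi, so a [G] just above xi^3 suffices; then 2 G +
    1 <= 2 xi^3 + 3 <= (1 + xi)^4. The truncation is increased by one in order to stay above
    xi^3. *)
Lemma net_parameter : (8 <= k)%N ->
  exists G : nat,
    100 / 3 * (q * Cop) * (2 * n ^ 2)%:R <= Num.sqrt (sb_eps n k sigma) / 2 * G%:R /\
    (2 * G).+1%:R <= (1 + xi) ^+ 4.
Proof.
move=> k8; set rho := _ / 2; set kap := 100 / 3 * _.
have kr : 8 <= k%:R :> R by rewrite (ler_nat R 8 k).
have es0 : 0 < expR (- 52) * sigma / sn :> R.
  by rewrite divr_gt0 // mulr_gt0 // expR_gt0.
have rhoE : rho = (expR (- 52) * sigma / sn) * (k%:R / 2).
  by rewrite /rho sqrt_sb_eps; ring.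
have rho0 : 0 < rho by rewrite rhoE; apply: mulr_gt0 => //; lra.
have x0 : 0 <= xi by apply: le_trans rate_ge_nat; exact: ler0n.
have kx : kap * 2 <= rho * xi.
  have qC : q * Cop = xi * sigma / (6 * expR 100 * sn).
    by rewrite xiE; field; rewrite !gt_eqF // expR_gt0.
  have -> : kap * 2 = xi * sigma / sn * (100 / 9 / expR 100).
    by rewrite /kap qC; field; rewrite !gt_eqF // expR_gt0.
  have -> : rho * xi = xi * sigma / sn * (expR (- 52) * (k%:R / 2)).
    by rewrite rhoE; ring.
  apply: ler_wpM2l; first by rewrite divr_ge0 ?(ltW sn0) // mulr_ge0 // ltW.
  rewrite ler_pdivrMr ?expR_gt0 // mulrAC [_ * expR 100]mulrC e52.
  have : 49 * 4 <= expR 48 * (k%:R / 2) :> R.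
    by apply: ler_pM; [| |exact: e48|]; lra.
  by lra.
have kn : kap * (2 * n ^ 2)%:R <= rho * xi ^+ 3.
  rewrite natrM natrX mulrA.
  apply: (@le_trans _ _ (rho * xi * n%:R ^+ 2)).
    by apply: ler_wpM2r => //; exact: sqr_ge0.
  rewrite -mulrA; apply: ler_wpM2l; first exact: ltW.
  rewrite (exprS xi 2); apply: ler_wpM2l => //.
  by rewrite ler_sqr ?nnegrE // rate_ge_nat.
have x30 : 0 <= xi ^+ 3 by exact: exprn_ge0.
have /andP[t1 t2] := Num.Theory.truncn_itv x30.
set t := Num.Def.trunc _ in t1 t2; exists t.+1; split.
  apply: le_trans kn _; apply: ler_wpM2l; first exact: ltW.
  exact: ltW.
have -> : (2 * t.+1).+1%:R = 2 * t%:R + 3 :> R.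
  by rewrite -natr1 natrM -natr1; ring.
have x1 : 1 <= xi by exact: le_trans n1 rate_ge_nat.
have -> : (1 + xi) ^+ 4 = 1 + 4 * xi + 6 * xi ^+ 2 + 4 * xi ^+ 3 + xi ^+ 4 by ring.
have := exprn_ge0 4 x0; have := sqr_ge0 xi.
by move: t1 x30 x1; move: (xi ^+ 2) (xi ^+ 3) (xi ^+ 4) (t%:R : R) xi => a c d e f; lra.
Qed.

Section Dimension.
Variable delta : R.
Hypotheses (delta01 : 0 < delta < 1)
  (hk : 3 * (ln n%:R + Num.sqrt (ln delta^-1) + Num.sqrt (m%:R * ln (1 + xi))) <= k%:R).

Let lnn0 : 0 <= ln n%:R :> R. Proof. exact: ln_ge0. Qed.
Let mL0 : 0 <= m%:R * ln (1 + xi).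
Proof. by apply: mulr_ge0 => //; move: ln_rate_ge; lra. Qed.
Let ld0 : 0 <= ln delta^-1.
Proof. by case/andP: delta01 => d0 d1; rewrite ln_ge0 // invf_ge1 // ltW. Qed.
Let s1 : 0 <= Num.sqrt (ln delta^-1) := sqrtr_ge0 _.
Let s2 : 0 <= Num.sqrt (m%:R * ln (1 + xi)) := sqrtr_ge0 _.

Lemma dim_ln : ln n%:R <= k%:R / 3 :> R.
Proof. by move: hk lnn0 s1 s2; lra. Qed.

Lemma dim_sqr_rate : 9 * (m%:R * ln (1 + xi)) <= k%:R ^+ 2.
Proof.
have -> : 9 * (m%:R * ln (1 + xi)) = (3 * Num.sqrt (m%:R * ln (1 + xi))) ^+ 2.
  by rewrite exprMn sqr_sqrtr // ; congr (_ * _); ring.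
by rewrite ler_sqr ?nnegrE ?mulr_ge0 //; move: hk lnn0 s1; lra.
Qed.

Lemma dim_sqr_delta : 9 * ln delta^-1 <= k%:R ^+ 2.
Proof.
have -> : 9 * ln delta^-1 = (3 * Num.sqrt (ln delta^-1)) ^+ 2.
  by rewrite exprMn sqr_sqrtr // ; congr (_ * _); ring.
by rewrite ler_sqr ?nnegrE ?mulr_ge0 //; move: hk lnn0 s2; lra.
Qed.

(** The logarithm is at least 100 and m >= 1, so k^2 >= 900; in particular k %/ 8 is positive and
    there is a pivot. *)
Lemma dim_ge8 : (8 <= k)%N.
Proof.
rewrite -(ler_nat R) -ler_sqr ?nnegrE //; apply: le_trans dim_sqr_rate.
have : 1 * 100 <= m%:R * ln (1 + xi).
  by apply: ler_pM => //; [rewrite ler1n|exact: ln_rate_ge].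
by lra.
Qed.

(** The net costs exp (4 k^2 / 9). Since ln n <= k / 3, the pivots gain exp (- 29 k l / 3) after the
    choice of indices, with l >= k / 16. The difference 29/48 - 4/9 = 23/144 exceeds the 1/9 that
    [delta] requires. *)
Lemma failure_bound (G : nat) : (2 * G).+1%:R <= (1 + xi) ^+ 4 ->
  (2 * G).+1%:R ^+ m * (n%:R ^+ (k %/ 8) * expR (- (10 * k%:R)) ^+ (k %/ 8)) <= delta.
Proof.
move=> hG; set l := (k %/ 8)%N.
have x0 : 0 <= xi by apply: le_trans rate_ge_nat; exact: ler0n.
have xp : 0 < 1 + xi by rewrite ltr_pwDl.
have nE : n%:R = expR (ln n%:R) :> R by rewrite lnK // posrE ltr0n.
have xE : 1 + xi = expR (ln (1 + xi)) by rewrite lnK.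
(* Rounding down loses at most a factor 2: k < 8 l + 8 and l >= 1. *)
have lk : k%:R / 16 <= l%:R :> R.
  rewrite ler_pdivrMr // -natrM ler_nat.
  have := divn_eq k 8; have := ltn_pmod k (isT : 0 < 8)%N; rewrite -/l.
  have l1 : (0 < l)%N by rewrite divn_gt0 // dim_ge8.
  move=> h e; rewrite e.
  apply: (@leq_trans (l * 8 + 8)); first by rewrite leq_add2l ltnW.
  have -> : (l * 16 = l * 8 + l * 8)%N by rewrite -mulnDr.
  by rewrite leq_add2l leq_pmull.
have h1 : (2 * G).+1%:R ^+ m <= expR (4 / 9 * k%:R ^+ 2) :> R.
  apply: (@le_trans _ _ ((1 + xi) ^+ 4 ^+ m)).
    by apply: lerXn2r; rewrite ?nnegrE // exprn_ge0 // ltW.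
  rewrite xE -!expRM_natl ler_expR; have := dim_sqr_rate.
  by rewrite [m%:R * (4 * _)]mulrCA; move: (m%:R * _) (k%:R ^+ 2) => a c; lra.
have h2 : n%:R ^+ l * expR (- (10 * k%:R)) ^+ l <= expR (- (29 / 3 * k%:R * l%:R)) :> R.
  rewrite {1}nE -!expRM_natl -expRD ler_expR.
  have := ler_wpM2l (ler0n R l) dim_ln.
  by move: (ln _) => a; move: (l%:R : R) (k%:R : R) => c e; nra.
apply: (@le_trans _ _ (expR (4 / 9 * k%:R ^+ 2) * expR (- (29 / 3 * k%:R * l%:R)))).
  by apply: ler_pM => //; rewrite ?exprn_ge0 // mulr_ge0 // exprn_ge0 // expR_ge0.
have d0 : 0 < delta by case/andP: delta01.
have -> : delta = expR (- ln delta^-1) by rewrite lnV ?posrE // opprK lnK.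
rewrite -expRD ler_expR.
have kl := ler_wpM2l (ler0n R k) lk.
move: dim_sqr_delta kl; rewrite -[29 / 3 * k%:R * l%:R]mulrA; move: (ln _) (k%:R * l%:R) => a c.
by move: (k%:R : R) => e; have := sqr_ge0 e; rewrite expr2; lra.
Qed.

(** The square of eg / sqrt sb_eps brings in n / (sb_const sigma^2 k^2); k^2 >= 9 m L yields the
    denominator of eta, and 100 / (3 sb_const) <= e^200 its numerator. *)
Lemma curvature_constant (Kc Kt eg : R) : 0 <= Kc -> 0 <= Kt ->
  Kc * (2 + Kt) ^+ 2 * (100 / 3 * Cop) * (eg / Num.sqrt (sb_eps n k sigma)) ^+ 2 <=
  eg ^+ 2 * (c_univ * n%:R * Kc * (2 + Kt) ^+ 2 * Cop /
               (9 * m%:R * sigma ^+ 2 * ln (1 + xi))).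
Proof.
move=> K0 Kt0.
have k0 : 0 < k%:R :> R by rewrite ltr0n (leq_trans _ dim_ge8).
have mLp : 0 < 9 * (m%:R * ln (1 + xi)).
  by apply: mulr_gt0 => //; apply: mulr_gt0; [rewrite ltr0n|move: ln_rate_ge; lra].
have Cop0 : 0 <= Cop.
  by apply: le_trans hCop; rewrite mulr_ge0 ?sqrtr_ge0 // mulr_ge0 // ltW.
have sb0 : 0 <= sb_eps n k sigma :> R.
  apply: divr_ge0 => //; apply: mulr_ge0; [apply: mulr_ge0|]; rewrite ?sqr_ge0 //; exact: expR_ge0.
rewrite expr_div_n sqr_sqrtr //.
set B := Kc * (2 + Kt) ^+ 2 * Cop * n%:R / sigma ^+ 2 * eg ^+ 2.
have B0 : 0 <= B.
  apply: mulr_ge0; [apply: divr_ge0; [|exact: sqr_ge0]|exact: sqr_ge0].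
  by apply: mulr_ge0 => //; apply: mulr_ge0 => //; apply: mulr_ge0 => //; exact: sqr_ge0.
have sc0 : 0 < sb_const :> R by exact: expR_gt0.
have L0 : 0 < ln (1 + xi) by move: ln_rate_ge; lra.
have mr0 : 0 < m%:R :> R by rewrite ltr0n.
have nr0 : 0 < n%:R :> R by rewrite ltr0n.
have -> : Kc * (2 + Kt) ^+ 2 * (100 / 3 * Cop) * (eg ^+ 2 / sb_eps n k sigma) =
    B * (100 / 3 / sb_const / k%:R ^+ 2).
  by rewrite /B /sb_eps; field; rewrite !gt_eqF.
have -> : eg ^+ 2 * (c_univ * n%:R * Kc * (2 + Kt) ^+ 2 * Cop /
    (9 * m%:R * sigma ^+ 2 * ln (1 + xi))) = B * (c_univ / (9 * (m%:R * ln (1 + xi)))).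
  by rewrite /B; field; rewrite !gt_eqF.
apply: ler_wpM2l => //; apply: ler_pM.
- by rewrite divr_ge0 ?(ltW sc0).
- by rewrite invr_ge0 sqr_ge0.
- rewrite /sb_const expRN invrK /c_univ.
  have -> : expR 200 = expR 96 * expR 104 :> R by rewrite -expRD; congr expR; lra.
  apply: ler_wpM2r; first exact: expR_ge0.
  by have := expR_ge1Dx (96 : R); lra.
by rewrite lef_pV2 ?posrE ?exprn_gt0 // dim_sqr_rate.
Qed.

End Dimension.
End Constants.

Lemma near_kernel_perturb {R : realType} n k (S D : 'M[R[i]]_n) (Y : 'M[R[i]]_(n, k)) (e : R) :
  0 <= e -> frob D <= Num.sqrt e / 2 -> (forall z : 'cV_k, Y *m z = 0 -> z = 0) ->
  (forall z : 'cV_k, inprod (S *m (Y *m z)) (S *m (Y *m z)) <=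
     (Num.sqrt e / 2) ^+ 2 * inprod (Y *m z) (Y *m z)) ->
  near_kernel e k (S + D).
Proof.
move=> e0 hD injY hS; exists Y; split => // z.
have r0 : 0 <= Num.sqrt e / 2 by rewrite divr_ge0 // sqrtr_ge0.
have h1 : frob (S *m (Y *m z)) <= Num.sqrt e / 2 * frob (Y *m z).
  have := hS z; rewrite -!frob_sqr -exprMn ler_sqr ?nnegrE ?mulr_ge0 ?frob_ge0 //.
have h2 : frob (D *m (Y *m z)) <= Num.sqrt e / 2 * frob (Y *m z).
  apply: le_trans (frob_mulcV _ _) _; apply: ler_wpM2r => //; exact: frob_ge0.
have h3 : frob ((S + D) *m (Y *m z)) <= Num.sqrt e * frob (Y *m z).
  rewrite mulmxDl; apply: le_trans (frobD _ _) _; apply: le_trans (lerD h1 h2) _.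
  by rewrite -mulrDl -splitr.
rewrite -!frob_sqr -[e in leRHS](sqr_sqrtr e0) -exprMn.
rewrite ler_sqr ?nnegrE ?mulr_ge0 ?frob_ge0 ?sqrtr_ge0 //.
Qed.

(** * The exceptional event and its complement *)

Section MainEvents.
Context {R : realType} (cplx : bool) {n m k : nat}
  (C : 'M[R[i]]_n) (A : 'I_m -> 'M[R[i]]_n) (b : 'cV[R]_m) (RR Kc sigma delta : R).
Hypotheses (hC : selfadj cplx C) (hA : forall i, selfadj cplx (A i))
  (hR : forall X, feasible cplx A b X -> complex.Re (\tr X) <= RR)
  (hK : forall Y, Mset cplx A b k Y ->
       opnorm cplx (fun Z => Aadj A (pinvMP (Gram A Y) *m Aop A Z)) <= Kc)
  (sigma0 : 0 < sigma) (delta01 : 0 < delta < 1).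

Let Cop := specnorm cplx C + 3 * sigma * Num.sqrt n%:R.
Let q := RR * Kc.
Let L := ln (1 + 6 * (q * Cop) * Num.sqrt (c_univ * n%:R) / sigma).
Let eta := c_univ * n%:R * Kc * (2 + Kc * RR) ^+ 2 * Cop /
               (9 * m%:R * sigma ^+ 2 * L).
Hypothesis hk :
  3 * (ln n%:R + Num.sqrt (ln delta^-1) + Num.sqrt (m%:R * L)) <= k%:R.

(** Every feasible matrix is 0, so cost and optimal value vanish for any cost matrix and only the
    sign of the bound remains. For m = 0 the condition on [Y0] is vacuous, which places that case
    here. *)
Lemma degenerate_gap (Y0 Y : 'M[R[i]]_(n, k)) (D : 'M[R[i]]_n) (eg eH : R) :
  Mset cplx A b k Y0 -> (forall i, A i *m Y0 = 0) -> Mset cplx A b k Y ->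
  0 <= eg -> 0 <= eH ->
  0 <= gcost D Y - fstar cplx A b D /\
  gcost D Y - fstar cplx A b D <= (eH + eg ^+ 2 * eta) * RR + eg / 2 * Num.sqrt RR.
Proof.
move=> hY0 AY0 hY eg0 eH0.
have b0 : b = 0.
  have [_ <-] := hY0; apply/colP => i.
  by rewrite Aop_mulE AY0 inprod0l mxE.
have f0 := feasible_mul_cadj hY0.
have all0 X : feasible cplx A b X -> X = 0 by exact: (feasible_trivial hR b0 f0).
have YY := all0 _ (feasible_mul_cadj hY).
have g0 : gcost D Y = 0 by rewrite /gcost inprod_mulr YY inprod0r.
have -> : fstar cplx A b D = 0.
  rewrite /fstar; have -> : [set inprod D X | X in feasible cplx A b] = [set 0].
    apply/seteqP; split => [_ [X /all0 -> <-]|_ ->] /=; first by rewrite inprod0r.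
    by exists (Y0 *m cadj Y0) => //; rewrite (all0 _ f0) inprod0r.
  exact: inf1.
have R0 : 0 <= RR := trace_bound_ge0 hR hY.
have K0 : 0 <= Kc := opnorm_const_ge0 hK hY.
have Cop0 : 0 <= Cop.
  apply: addr_ge0; first exact: specnorm_ge0.
  by apply: mulr_ge0; [apply: mulr_ge0 => //; exact: ltW|exact: sqrtr_ge0].
have L0 : 0 <= L.
  apply: ln_ge0; rewrite lerDl; apply: divr_ge0; last exact: ltW.
  apply: mulr_ge0; last exact: sqrtr_ge0.
  by apply: mulr_ge0 => //; apply: mulr_ge0 => //; exact: mulr_ge0.
have eta0 : 0 <= eta.
  apply: divr_ge0.
    apply: mulr_ge0 => //; apply: mulr_ge0; last exact: sqr_ge0.
    by apply: mulr_ge0 => //; apply: mulr_ge0 => //; exact: expR_ge0.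
  by apply: mulr_ge0 => //; apply: mulr_ge0; [exact: mulr_ge0|exact: sqr_ge0].
rewrite g0 subrr; split => //; apply: addr_ge0.
  by apply: mulr_ge0 => //; apply: addr_ge0 => //; apply: mulr_ge0 => //; exact: sqr_ge0.
by apply: mulr_ge0; [exact: divr_ge0|exact: sqrtr_ge0].
Qed.

Context d (T : measurableType d) (P : probability T R) (W : T -> 'M[R[i]]_n).
Hypothesis gW : gaussian_wigner P cplx n sigma W.

(** Excluded are a large norm of [W] and, for each net point N_j, a near-kernel of C - N_j + W. None
    of this depends on [Y], [eg] or [eH]: for any critical point, a net point near its multiplier
    matrix is picked afterwards. *)
Lemma good_event (Y1 : 'M[R[i]]_(n, k)) (i1 : 'I_m) :
  Mset cplx A b k Y1 -> A i1 *m Y1 != 0 ->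
  exists E : set T, [/\ measurable E,
    ((1 - delta - expR (- (n%:R / 2)))%:E <= P E)%E &
    forall w, E w -> forall (eg eH : R), 0 <= eg -> 0 <= eH ->
    forall Y : 'M[R[i]]_(n, k), is_SOSP cplx A b (C + W w) eg eH Y ->
      0 <= gcost (C + W w) Y - fstar cplx A b (C + W w) /\
      gcost (C + W w) Y - fstar cplx A b (C + W w)
          <= (eH + eg ^+ 2 * eta) * RR + eg / 2 * Num.sqrt RR].
Proof.
move=> hY1 AY1.
have R0 : 0 <= RR := trace_bound_ge0 hR hY1.
have K0 : 0 <= Kc := opnorm_const_ge0 hK hY1.
have q1 : 1 <= q by rewrite /q mulrC; exact: (one_le_KR hA hR hK hY1 AY1).
have m0 : (0 < m)%N by apply: leq_ltn_trans (ltn_ord i1).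
have n0 : (0 < n)%N.
  case: (posnP n) => // n00; move/eqP: AY1; case.
  by apply/matrixP => a; have := ltn_ord a; rewrite {2}n00.
have hCop : 3 * sigma * Num.sqrt n%:R <= Cop by rewrite lerDr specnorm_ge0.
have k8 := dim_ge8 n0 m0 sigma0 q1 hCop hk.
have [G [hG1 hG2]] := net_parameter n0 sigma0 q1 hCop k8.
have sq0 : 0 < Num.sqrt (sb_eps n k sigma) :> R.
  rewrite (sqrt_sb_eps _ n0 sigma0) divr_gt0 ?sqrtr_gt0 ?ltr0n //.
  by rewrite mulr_gt0 ?ltr0n ?(leq_trans _ k8) // mulr_gt0 // expR_gt0.
have rho0 : 0 < Num.sqrt (sb_eps n k sigma) / 2 :> R by rewrite divr_gt0.
have hA2 i : cadj (A i) = A i by have [] := hA i.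
have [J [N [cJ hN net]]] := hermitian_net n0 rho0 hA2 hG1.
have [F [mF PF hF]] := wigner_norm_bound n0 sigma0 gW.
have hCN j : cadj (C - N j) = C - N j by rewrite cadjB hN; have [_ ->] := hC.
have /choice[Ev hEv] := fun j => near_kernel_bound n0 k8 sigma0 (hCN j) gW.
set p := n%:R ^+ (k %/ 8) * expR (- (10 * k%:R)) ^+ (k %/ 8) : R.
have p0 : 0 <= p by apply: mulr_ge0; apply: exprn_ge0 => //; exact: expR_ge0.
have mEv j : measurable (Ev j) by have [] := hEv j.
have pEv j : (P (Ev j) <= p%:E)%E by have [] := hEv j.
have [mU pU] := @measure_finite_union _ _ _ P _ Ev _ mEv pEv.
set U := \big[setU/set0]_j Ev j in mU pU.
have pU' : (P U <= delta%:E)%E.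
  apply: le_trans pU _; rewrite lee_fin.
  apply: le_trans (failure_bound n0 m0 sigma0 q1 hCop delta01 hk hG2).
  by apply: ler_wpM2r => //; rewrite -natrX ler_nat.
exists (~` (F `|` U)); split.
- by apply: measurableC; exact: measurableU.
- rewrite probability_setC; last exact: measurableU.
  have : (P (F `|` U) <= (expR (- (n%:R / 2)) + delta)%:E)%E.
    by apply: le_trans (measureU2 P mF mU) _; rewrite EFinD; exact: leeD.
  have : P (F `|` U) \is a fin_num by apply: fin_num_measure; exact: measurableU.
  move=> /fineK <-; rewrite -EFinB !lee_fin; lra.
move=> w nw eg eH eg0 eH0 Y hso; have [[hY hfo] _] := hso.
have nF : ~ F w by move=> Fw; apply: nw; left.
have nU j : ~ near_kernel (sb_eps n k sigma) k (C - N j + W w).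
  move=> nk; apply: nw; right; rewrite /U -bigcup_seq /=; exists j; first by rewrite /= mem_index_enum.
  by have [_ _] := hEv j; exact.
have hCW : selfadj cplx (C + W w).
  have [hW _ _] := gW; have [KC hC2] := hC; have [KW hW2] := hW w.
  by split; [exact: KmatD|rewrite cadjD hC2 hW2].
(* The norm estimate for [W] has the constant 100 where [Cop] has 3; the ratio is absorbed by
   [c_univ]. *)
pose s0 := 100 / 3 * Cop.
have Cop0 : 0 <= Cop by apply: le_trans hCop; rewrite mulr_ge0 ?sqrtr_ge0 // mulr_ge0 // ltW.
have s00 : 0 <= s0 by rewrite mulr_ge0 // divr_ge0.
have hs0 : specnorm cplx (C + W w) <= s0.
  apply: specnorm_le => // x Kx; rewrite mulmxDl; apply: le_trans (frobD _ _) _.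
  have h1 := specnorm_ge C Kx.
  have h2 : frob (W w *m x) <= 100 * sigma * Num.sqrt n%:R * frob x.
    apply: le_trans (@specnorm_ge _ true _ (W w) x _) _ => //.
    by apply: ler_wpM2r; [exact: frob_ge0|exact: hF].
  apply: le_trans (lerD h1 h2) _; rewrite -mulrDl; apply: ler_wpM2r; first exact: frob_ge0.
  rewrite /s0 /Cop; have := specnorm_ge0 cplx C.
  have -> : 100 * sigma * Num.sqrt n%:R = 100 / 3 * (3 * sigma * Num.sqrt n%:R) by field.
  move: (specnorm cplx C) (3 * sigma * _) => a c a0; rewrite mulrDr lerD2r.
  by rewrite ler_peMl // ler_pdivlMr // mul1r ler_nat.
have hmu : frob (Aadj A (mu_of A (C + W w) Y)) <= 100 / 3 * (q * Cop).
  apply: le_trans (frob_Aadj_mu_of hR hK hY hCW hs0) _.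
  by rewrite le_eqVlt; apply/orP; left; apply/eqP; rewrite /s0 /q; ring.
have [j hj] := net _ hmu.
set th := eH + eg ^+ 2 * eta.
have hth : eH + Kc * (2 + Kc * RR) ^+ 2 * s0 * (eg / Num.sqrt (sb_eps n k sigma)) ^+ 2 <= th.
  rewrite /th lerD2l /s0 /eta /L.
  exact: (curvature_constant n0 m0 sigma0 q1 hCop hk eg K0 (mulr_ge0 K0 R0)).
(* With threshold sqrt sb_eps, the second case bounds [S] by half of it on the range of [Y]; the net
   error uses the other half, which produces an excluded near-kernel. *)
have [hpos|[injY hS]] := sosp_dichotomy hA hR hK hCW s00 hs0 sq0 eg0 eH0 hso; last first.
  case: (nU j).
  have -> : C - N j + W w = S_of A (C + W w) Y + (Aadj A (mu_of A (C + W w) Y) - N j).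
    by rewrite /S_of addrA subrK addrAC.
  by apply: near_kernel_perturb hj injY hS; apply/ltW; rewrite -sqrtr_gt0.
have th0 : 0 <= th.
  apply: le_trans hth; apply: addr_ge0 => //; apply: mulr_ge0; last exact: sqr_ge0.
  by apply: mulr_ge0 => //; apply: mulr_ge0 => //; exact: sqr_ge0.
apply: (gap_bound hR hY eg0 th0 hfo) => z.
apply: le_trans (hpos z); rewrite lerN2; apply: ler_wpM2r => //; exact: inprod_ge0.
Qed.

End MainEvents.

Unset Implicit Arguments.

Theorem theorem1 (R : realType) :
  exists c0 : R, 0 < c0 /\
  forall (cplx : bool) (n m k : nat)
    (C : 'M[R[i]]_n) (A : 'I_m -> 'M[R[i]]_n) (b : 'cV[R]_m)
    (RR Kc sigma delta : R),
    selfadj cplx C ->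
    (forall i, selfadj cplx (A i)) ->
    smooth_manifold_assumption cplx A b ->
    compactK (feasible cplx A b) ->
    (forall X, feasible cplx A b X -> complex.Re (\tr X) <= RR) ->
    (forall Y, Mset cplx A b k Y ->
       opnorm cplx (fun Z => Aadj A (pinvMP (Gram A Y) *m Aop A Z)) <= Kc) ->
    0 < sigma -> 0 < delta < 1 ->
    let Cop := specnorm cplx C + 3%:R * sigma * Num.sqrt n%:R in
    let kappa := RR * Kc * Cop in
    let L := ln (1 + 6%:R * kappa * Num.sqrt (c0 * n%:R) / sigma) in
    let eta := c0 * n%:R * Kc * (2%:R + Kc * RR) ^+ 2 * Cop /
               (9%:R * m%:R * sigma ^+ 2 * L) in
    3%:R * (ln n%:R + Num.sqrt (ln delta^-1) + Num.sqrt (m%:R * L)) <= k%:R ->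
    forall (d : measure_display) (T : measurableType d) (P : probability T R)
      (W : T -> 'M[R[i]]_n),
    gaussian_wigner P cplx n sigma W ->
    exists E : set T, [/\ measurable E,
      ((1 - delta - expR (- (n%:R / 2%:R)))%:E <= P E)%E &
      forall w, E w ->
      forall (eg eH : R), 0 <= eg -> 0 <= eH ->
      forall Y : 'M[R[i]]_(n, k), is_SOSP cplx A b (C + W w) eg eH Y ->
        0 <= gcost (C + W w) Y - fstar cplx A b (C + W w) /\
        gcost (C + W w) Y - fstar cplx A b (C + W w)
          <= (eH + eg ^+ 2 * eta) * RR + eg / 2%:R * Num.sqrt RR].
Proof.
exists c_univ; split; first exact: expR_gt0.
move=> cplx n m k C A b RR Kc sigma delta hC hA _ _ hR hK s0 d01 Cop kappa L eta hk
  d T P W gW.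
(* For the cases without randomness the whole space serves as the event. *)
have all (Q : T -> Prop) : (forall w, Q w) -> exists E : set T, [/\ measurable E,
    ((1 - delta - expR (- (n%:R / 2%:R)))%:E <= P E)%E & forall w, E w -> Q w].
  move=> h; exists setT; split => //.
  rewrite probability_setT lee_fin; have /andP[d0 _] := d01.
  by have := expR_ge0 (- (n%:R / 2) : R); lra.
have [[Y0 [hY0 AY0]]|nY0] := pselect (exists Y0 : 'M[R[i]]_(n, k),
    Mset cplx A b k Y0 /\ forall i, A i *m Y0 = 0).
  apply: all => w eg eH eg0 eH0 Y [[hY _] _].
  exact: (degenerate_gap C hR hK s0 (C + W w) hY0 AY0 hY eg0 eH0).
have [[Y1 hY1]|nY1] := pselect (exists Y1 : 'M[R[i]]_(n, k), Mset cplx A b k Y1).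
  have [[i1 hi]|ni] := pselect (exists i1, A i1 *m Y1 != 0).
    exact: (good_event hC hA hR hK s0 d01 hk gW hY1 hi).
  exfalso; apply: nY0; exists Y1; split => // i; apply/eqP; apply: contraT => hi.
  by case: ni; exists i.
(* Without a point of the constraint set there is no critical point to consider. *)
by apply: all => w eg eH eg0 eH0 Y [[hY _] _]; case: nY1; exists Y.
Qed.
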